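(* There exists an exponent $p\in\mathcal{E}$ such that $p\in SO\setminus C(\dot{\mathbb{R}})$.
   Context: For a measurable a.e. finite function $p:\mathbb{R}\to[1,\infty]$, $L^{p(\cdot)}(\mathbb{R})$ is the set of all complex-valued (measurable) functions $f$ on $\mathbb{R}$ such that $I_{p(\cdot)}(f/\lambda):=\int_{\mathbb{R}}|f(x)/\lambda|^{p(x)}dx<\infty$ for some $\lambda>0$, with norm $\|f\|_{p(\cdot)}:=\inf\{\lambda>0: I_{p(\cdot)}(f/\lambda)\le 1\}$. The Cauchy singular integral operator is $(Sf)(x):=\frac{1}{\pi i}\int_{\mathbb{R}}\frac{f(\tau)}{\tau-x}d\tau$ for $f\in L^1_{\rm loc}(\mathbb{R})$, in the principal value sense. $\mathcal{E}$ is the class of exponents $p:\mathbb{R}\to[1,\infty]$ that are continuous on $\mathbb{R}$, satisfy $1<\operatorname{ess\,inf}_{x\in\mathbb{R}}p(x)$ and $\operatorname{ess\,sup}_{x\in\mathbb{R}}p(x)<\infty$, and are such that $S$ is bounded on $L^{p(\cdot)}(\mathbb{R})$. For continuous $f:\mathbb{R}\to\mathbb{C}$ and $J\subset\mathbb{R}$ let $\operatorname{osc}(f,J):=\sup_{t,\tau\in J}|f(t)-f(\tau)|$. $SO$ is the set of all bounded continuous $f:\mathbb{R}\to\mathbb{C}$ with $\lim_{x\to+\infty}\operatorname{osc}(f,[-2x,-x]\cup[x,2x])=0$. $C(\dot{\mathbb{R}})$ is the set of continuous $c:\mathbb{R}\to\mathbb{C}$ having finite limits at $-\infty$ and $+\infty$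 that are equal: $c(-\infty)=c(+\infty)$. *)

(* Defs.v *)
From HB Require Import structures.
From mathcomp Require Import all_boot all_order all_algebra.
From mathcomp Require Import all_classical all_reals all_analysis.
From mathcomp Require Import measurable_realfun ess_sup_inf.
From mathcomp.real_closed Require Import complex.

Set Implicit Arguments.
Unset Strict Implicit.
Unset Printing Implicit Defensive.

Import Order.TTheory GRing.Theory Num.Theory.
Import numFieldNormedType.Exports.
Import Normc.

Local Open Scope classical_set_scope.
Local Open Scope complex_scope.
Local Open Scope ring_scope.

(* Complex values live in R[i]^o, an alias of R[i] on which the library finds the
   topology of the modulus; normc z is the modulus as an element of R, whereas
   `|z| is an element of R[i]. *)

Section complex_valued_functions.
Context {R : realType}.
Local Notation mu := (@lebesgue_measure R).
Local Notation C := R[i]^o.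
Implicit Types (f : R -> C) (D : set R).

(* Borel measurability, the library's structure on R; every Lebesgue measurable
   function agrees almost everywhere with a Borel measurable one. *)
Definition cmeasurable_fun D f : Prop :=
  measurable_fun D (fun x => complex.Re (f x)) /\
  measurable_fun D (fun x => complex.Im (f x)).

Definition cintegrable D f : Prop :=
  mu.-integrable D (fun x => (complex.Re (f x))%:E) /\
  mu.-integrable D (fun x => (complex.Im (f x))%:E).

Definition cintegral D f : C :=
  (\int[mu]_(x in D) complex.Re (f x))%R +i*
  (\int[mu]_(x in D) complex.Im (f x))%R.

Definition L1loc : set (R -> C) :=
  [set f : R -> C | cmeasurable_fun [set: R] f /\
    forall K, compact K -> (\int[mu]_(x in K) (normc (f x))%:E < +oo)%E].

End complex_valued_functions.

Section variable_Lebesgue_space.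
Context {R : realType}.
Local Notation mu := (@lebesgue_measure R).
Local Notation C := R[i]^o.
Implicit Types (p : R -> \bar R) (f : R -> C).

Definition variable_exponent : set (R -> \bar R) :=
  [set p : R -> \bar R | [/\ measurable_fun [set: R] p, forall x, (1 <= p x)%E &
               {ae mu, forall x, (p x < +oo)%E}]].

(* Exponents are finite almost everywhere, so the junk value fine +oo = 0 is
   only used on a null set. *)
Definition modular p f : \bar R :=
  (\int[mu]_x (normc (f x) `^ fine (p x))%R%:E)%E.

Definition Lvar p : set (R -> C) :=
  [set f : R -> C | cmeasurable_fun [set: R] f /\
    exists2 lam : R, 0 < lam & (modular p (fun x => (f x / lam%:C)%R) < +oo)%E].

Definition Lvar_norm p f : R :=
  inf [set lam : R | 0 < lam /\ (modular p (fun x => (f x / lam%:C)%R) <= 1)%E].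

End variable_Lebesgue_space.

Section Cauchy_singular_integral.
Context {R : realType}.
Local Notation mu := (@lebesgue_measure R).
Local Notation C := R[i]^o.
Implicit Types (p : R -> \bar R) (f : R -> C) (x e : R).

Definition off_ball x e : set R := [set t | e < `|t - x|].

Definition Cauchy_integrand f x (t : R) : C := f t / (t - x)%:C.

Definition truncated_Cauchy f x e : C :=
  cintegral (off_ball x e) (Cauchy_integrand f x).

Definition pv_exists f x : Prop :=
  (forall e, 0 < e -> cintegrable (off_ball x e) (Cauchy_integrand f x)) /\
  cvg (truncated_Cauchy f x e @[e --> 0^'+]).

(* Meaningful at the points x where pv_exists f x holds. *)
Definition Cauchy_S f (x : R) : C :=
  ((pi : R)%:C * 'i%C)^-1 * lim (truncated_Cauchy f x e @[e --> 0^'+]).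

Definition Cauchy_S_defined f : Prop :=
  L1loc f /\ {ae mu, forall x, pv_exists f x}.

Definition Cauchy_S_bounded p : Prop :=
  exists M : R, forall f, Lvar p f ->
    [/\ Cauchy_S_defined f, Lvar p (Cauchy_S f) &
        Lvar_norm p (Cauchy_S f) <= M * Lvar_norm p f].

Definition class_E : set (R -> \bar R) :=
  [set p : R -> \bar R | [/\ variable_exponent p, continuous p,
               (1 < ess_inf mu p)%E, (ess_sup mu p < +oo)%E &
               Cauchy_S_bounded p]].

End Cauchy_singular_integral.

Section slowly_oscillating_functions.
Context {R : realType}.
Local Notation C := R[i]^o.
Implicit Types (f : R -> C) (J : set R).

Definition osc f J : \bar R :=
  ereal_sup [set (normc (f z.1 - f z.2))%:E | z in J `*` J].

Definition SO : set (R -> C) :=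
  [set f : R -> C | [/\ continuous f, exists M : R, forall x, normc (f x) <= M &
    osc f (`[- (2 * x), - x] `|` `[x, 2 * x]) @[x --> +oo%R] --> 0%E]].

(* Continuous functions on the one-point compactification of R. *)
Definition Cdot : set (R -> C) :=
  [set c : R -> C | continuous c /\
    exists l : C, c x @[x --> -oo%R] --> l /\ c x @[x --> +oo%R] --> l].

End slowly_oscillating_functions.

(* Main.v *)
Require Import Defs.
From mathcomp Require Import all_boot all_order all_algebra.
From mathcomp Require Import all_classical all_reals all_analysis.
From mathcomp Require Import measurable_realfun ess_sup_inf.
From mathcomp.real_closed Require Import complex.
From mathcomp Require Import ring lra.

(** The exponent is p (x) = 3 + sin (ln (1 + ln (1 + |x|))) / 8. The phase
  ln (1 + ln (1 + |x|)) is unbounded, so p has no limit at infinity; but over the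
  shell x <= |t| <= 2 x it changes by O (1 / ln x), so p oscillates slowly. The
  work lies in the boundedness of S on the variable Lebesgue space. It rests on
  two properties of p only: its range stays well inside [2, 4], and
  |p (x) - p (t)| is at most |ln rho| / (8 (1 + ln m)), where rho is the ratio of
  1 + |x| and 1 + |t| and m is the smaller of the two (expo_slow).

  Constant exponents 2 and 4. For f with compact support let F be its Cauchy
  integral in the upper half plane. By Cauchy's theorem the integrals of F ^ 2 and
  of F ^ 4 along horizontal lines vanish (holomorphic_pair_integral0), so the real
  part of F is bounded in L^2 and in L^4 by the imaginary part, up to sign a Poisson
  integral of f. Up to sign the truncated Hilbert transform differs from the real
  part of F at height e by no more than a Poisson integral of |f|. Hence
  trunc_hilbert_L2 and trunc_hilbert_L4, with constants independent of the
  truncation.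

  Weights. If phi changes by a factor at most rho ^ (1 / 8) when 1 + |x| changes
  by a factor rho, then the commutator of phi with the truncated transform has a
  kernel dominated by a positive kernel homogeneous of degree -1 in 1 + |x| and
  1 + |t|, to which the Schur test applies (commutator_kernel, schur_test). So the
  L^2 and L^4 bounds hold with the weight phi (weighted_trunc_hilbert_L2,
  weighted_trunc_hilbert_L4).

  The modular inequality. The integral of |T f| ^ p is bounded by a multiple of the
  sum over n of the integrals of exp (n p) over {|T f| >= exp n}, and of exp (- n p) over
  {|T f| >= exp (- n)} (layer_cake). Cutting f at the height of the level and
  using the exponent 2 above and 4 below bounds each level by an integral of
  psi (|f| / level), psi (s) = min (s ^ 2, s ^ 4) (weighted_level). As p stays
  away from 2 and 4, these bounds sum over the levels to the modular of f
  (high_levels_sum, low_levels_sum). The weight exp (n p) of a high level is not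
  slowly varying, but it is constant up to a factor on intervals of length
  1 / (n + 1), and there the far part of f is negligible against exp n
  (local_level, high_level). The weight exp (- N p) of a low level varies slowly
  where 1 + |x| >= exp N, by the bound on p; where 1 + |x| < exp N the weight is
  frozen, at the price of a term of geometric size (low_level). This gives
  modular_bound, uniformly in the truncation.

  Principal values. The maximal truncation is controlled by Cotlar's inequality
  and the Hardy-Littlewood maximal function, hence of weak type in L^2
  (weak_type_maximal); the truncations converge for Lipschitz functions in L^2,
  which are dense, so they converge almost everywhere for every f in L^2, and by
  localization for every f of finite modular (pv_ae). Fatou's lemma passes the
  modular inequality to the limit (pv_lim_modular). *)

Set Implicit Arguments.
Unset Strict Implicit.
Unset Printing Implicit Defensive.

Import Order.TTheory GRing.Theory Num.Theory.
Import numFieldNormedType.Exports.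
Import Normc.

Local Open Scope classical_set_scope.
Local Open Scope complex_scope.
Local Open Scope ring_scope.

(** * Measurability and integrals of real functions on the line *)

Section measurability_of_real_functions.
Context {R : realType} (d : measure_display) (T : measurableType d).
Implicit Types (f g : T -> R).

(** The inverse is x * (x ^ 2) ^ (-1), and real powers are measurable; this covers
  0, where the inverse is 0. *)
Lemma measurable_inv f :
  measurable_fun setT f -> measurable_fun setT (fun x => (f x)^-1).
Proof.
move=> mf.
rewrite (_ : (fun x => _) = (fun x => f x * ((f x ^+ 2) `^ (-1)))); last first.
  apply/funext => x; rewrite powR_inv1 ?sqr_ge0//.
  have [->|fx0] := eqVneq (f x) 0; first by rewrite invr0 mul0r.
  by field.
apply: measurable_funM => //.
exact: (measurableT_comp (measurable_powR (-1)) (measurable_funX 2 mf)).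
Qed.

Lemma measurable_fun_powR2 f g :
  measurable_fun setT f -> measurable_fun setT g ->
  measurable_fun setT (fun x => f x `^ g x).
Proof.
move=> mf mg; rewrite /powR; apply: measurable_fun_ifT => //.
- exact: measurable_fun_eqr.
- apply: (@measurableT_comp _ _ _ _ _ _ (fun b : bool => (b%:R : R))) => //.
  exact: measurable_fun_eqr.
- apply: measurableT_comp => //; apply: measurable_funM => //.
  exact: measurableT_comp.
Qed.

Lemma measurable_EFin f :
  measurable_fun setT f -> measurable_fun setT (fun x => (f x)%:E).
Proof. by move=> mf; exact/measurable_EFinP. Qed.

End measurability_of_real_functions.

Ltac meas_step := first
  [ match goal with
    | |- measurable_fun _ (fun x => x) => exact: measurable_id
    | |- measurable_fun _ (fun _ => ?c) => exact: measurable_cst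
    end
  | assumption
  | match goal with
    | |- measurable_fun _ fst => exact: measurable_fst
    | |- measurable_fun _ snd => exact: measurable_snd
    | |- measurable_fun _ (fun x => x.1) => exact: measurable_fst
    | |- measurable_fun _ (fun x => x.2) => exact: measurable_snd
    | |- measurable_fun _ (fun x => (_)%:E) => apply: measurable_EFin
    | |- measurable_fun _ (fun x => _ + _) => apply: measurable_funD
    | |- measurable_fun _ (fun x => (_ + _)%E) => apply: emeasurable_funD
    | |- measurable_fun _ (fun x => (_ * _)%E) => apply: emeasurable_funM
    | |- measurable_fun _ (fun x => - _) => apply: measurable_funN
    | |- measurable_fun _ (fun x => _ * _) => apply: measurable_funM
    | |- measurable_fun _ (fun x => (_)^-1) => apply: measurable_inv
    | |- measurable_fun _ (fun x => _ ^+ _) => apply: measurable_funX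
    | |- measurable_fun _ (fun x => `|_|) => apply: measurableT_comp
    | |- measurable_fun _ (fun x => Num.max _ _) => apply: measurable_maxr
    | |- measurable_fun _ (fun x => Num.min _ _) => apply: measurable_minr
    | |- measurable_fun _ (fun x => expR _) => apply: measurableT_comp
    | |- measurable_fun _ (fun x => ln _) => apply: measurableT_comp
    | |- measurable_fun _ (fun x => sin _) => apply: measurableT_comp
    | |- measurable_fun _ (fun x => Num.sqrt _) => apply: measurableT_comp
    | |- measurable_fun _ (fun x => _ `^ _) => apply: measurable_fun_powR2
    | |- measurable_fun _ (fun x => if _ then _ else _) =>
        apply: measurable_fun_ifT
    | |- measurable_fun _ (fun x => _ < _) => apply: measurable_fun_ltr
    | |- measurable_fun _ (fun x => _ <= _) => apply: measurable_fun_ler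
    | |- measurable_fun _ (fun x => _ == _) => apply: measurable_fun_eqr
    | |- measurable_fun _ (fun x => _ && _) => apply: measurable_and
    | |- measurable_fun _ (fun x => _.1) => apply: measurable_fst
    | |- measurable_fun _ (fun x => ?f _) =>
       first [is_var f | is_const f]; apply: (@measurableT_comp _ _ _ _ _ _ f)
    | |- measurable_fun _ GRing.inv => exact: (measurable_inv (@measurable_id _ _ _))
    end
  | done ].
Ltac meas := repeat meas_step.

Section integrals_of_real_functions.
Context {R : realType}.
Local Notation mu := (@lebesgue_measure R).
Implicit Types (f g w : R -> R).

Lemma ge0_le_integralT (f g : R -> \bar R) :
  measurable_fun setT f -> measurable_fun setT g ->
  (forall x, 0 <= f x)%E -> (forall x, f x <= g x)%E ->
  (\int[mu]_x f x <= \int[mu]_x g x)%E.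
Proof. by move=> mf mg f0 fg; apply: ge0_le_integral. Qed.

Lemma eq_integralR (D : set R) (f g : R -> \bar R) :
  (forall t, D t -> f t = g t) -> (\int[mu]_(t in D) f t = \int[mu]_(t in D) g t)%E.
Proof. by move=> fg; apply: eq_integral => t; rewrite inE => /fg. Qed.

Lemma le_integralT f g : measurable_fun setT f -> measurable_fun setT g ->
  (forall x, 0 <= f x) -> (forall x, f x <= g x) ->
  (\int[mu]_x (f x)%:E <= \int[mu]_x (g x)%:E)%E.
Proof.
move=> mf mg f0 fg; apply: ge0_le_integral => //.
- by move=> x _; rewrite lee_fin.
- exact: measurable_EFin.
- exact: measurable_EFin.
- by move=> x _; rewrite lee_fin.
Qed.

Lemma ge0_integralDT f g : measurable_fun setT f -> measurable_fun setT g ->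
  (forall x, 0 <= f x) -> (forall x, 0 <= g x) ->
  (\int[mu]_x (f x + g x)%:E = \int[mu]_x (f x)%:E + \int[mu]_x (g x)%:E)%E.
Proof.
move=> mf mg f0 g0; under eq_integral do rewrite EFinD.
rewrite ge0_integralD//.
- by move=> x _; rewrite lee_fin.
- exact: measurable_EFin.
- by move=> x _; rewrite lee_fin.
- exact: measurable_EFin.
Qed.

Lemma ge0_integralZT (c : R) f : measurable_fun setT f ->
  (forall x, 0 <= f x) -> 0 <= c ->
  (\int[mu]_x (c * f x)%:E = c%:E * \int[mu]_x (f x)%:E)%E.
Proof.
move=> mf f0 c0; under eq_integral do rewrite EFinM.
rewrite ge0_integralZl//.
- exact: measurable_EFin.
- by move=> x _; rewrite lee_fin.
Qed.

Lemma integralT_ge0 f : (forall x, 0 <= f x) -> (0 <= \int[mu]_x (f x)%:E)%E.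
Proof. by move=> f0; apply: integral_ge0 => x _; rewrite lee_fin. Qed.

Lemma ge0_integral_seriesT (h : nat -> R -> R) :
  (forall n, measurable_fun setT (h n)) -> (forall n x, 0 <= h n x) ->
  (\int[mu]_x (\sum_(n <oo) (h n x)%:E) = \sum_(n <oo) \int[mu]_x (h n x)%:E)%E.
Proof.
move=> mh h0; rewrite integral_nneseries// => [n|n x _]; last by rewrite lee_fin.
exact: measurable_EFin (mh n).
Qed.

(** The density w carries the kernel of an integral operator: a bound on its mass
  turns into a pointwise bound of the square of the operator. *)
Lemma cauchy_schwarz w g (A : R) : measurable_fun setT w ->
  measurable_fun setT g -> (forall x, 0 <= w x) -> (forall x, 0 <= g x) ->
  0 < A -> (\int[mu]_x (w x)%:E <= A%:E)%E ->
  ((\int[mu]_x (w x * g x)%:E) ^+ 2 <= A%:E * \int[mu]_x (w x * g x ^+ 2)%:E)%E.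
Proof.
move=> mw mg w0 g0 A0 wA.
have wg0 x : 0 <= w x * g x by rewrite mulr_ge0.
have wg20 x : 0 <= w x * g x ^+ 2 by rewrite mulr_ge0 ?sqr_ge0.
have G0 : (0 <= \int[mu]_x (w x * g x)%:E)%E by exact: integralT_ge0.
have B0 : (0 <= \int[mu]_x (w x * g x ^+ 2)%:E)%E by exact: integralT_ge0.
have young (s : R) : 0 < s -> (2%:E * \int[mu]_x (w x * g x)%:E <=
    s%:E * A%:E + s^-1%:E * \int[mu]_x (w x * g x ^+ 2)%:E)%E.
  move=> s0; apply: (@le_trans _ _ (s%:E * \int[mu]_x (w x)%:E +
      s^-1%:E * \int[mu]_x (w x * g x ^+ 2)%:E)%E); last first.
    by rewrite leeD2r// lee_wpmul2l// lee_fin ltW.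
  rewrite -!ge0_integralZT ?invr_ge0 ?(ltW s0)//; try by meas.
  rewrite -ge0_integralDT//; try by meas.
  - apply: le_integralT; try by meas.
    + by move=> x; rewrite mulr_ge0.
    + move=> x; rewrite -subr_ge0.
      have -> : s * w x + s^-1 * (w x * g x ^+ 2) - 2 * (w x * g x) =
          w x * (s^-1 * (s - g x) ^+ 2) by field; rewrite gt_eqF.
      by rewrite mulr_ge0// mulr_ge0 ?sqr_ge0// invr_ge0 ltW.
  - by move=> x; rewrite mulr_ge0// ltW.
  - by move=> x; rewrite mulr_ge0// invr_ge0 ltW.
move: young B0; case: (\int[mu]_x (w x * g x ^+ 2)%:E)%E => [b| |] // young B0; last first.
  by rewrite mulry gtr0_sg// mul1e leey.
have := young 1 ltr01.
move: G0 young; case: (\int[mu]_x (w x * g x)%:E)%E => [c| |] // c0 young _; last first.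
  have := young 1 ltr01; rewrite mulry gtr0_sg// mul1e -!EFinM -EFinD.
  by rewrite leye_eq.
rewrite -EFin_expe -EFinM lee_fin.
rewrite lee_fin in c0; move: c0; rewrite le_eqVlt => /predU1P[<-|c0].
  by rewrite expr0n/= mulr_ge0// ltW.
have := young (c / A) (divr_gt0 c0 A0).
rewrite -!EFinM -EFinD lee_fin divfK ?gt_eqF// invf_div => h.
have {}h : c <= A / c * b by lra.
by rewrite expr2 -ler_pdivlMr// mulrAC.
Qed.

Lemma nneseries_term_le (u : nat -> \bar R) j : (forall n, 0 <= u n)%E ->
  (u j <= \sum_(n <oo) u n)%E.
Proof.
move=> u0; apply: le_trans (nneseries_lim_ge j.+1 _); last by [].
by rewrite big_nat_recr//= leeDr// sume_ge0.
Qed.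

Lemma dyadic_scale (e u : R) :  0 < e -> e < u ->
  exists j : nat, 2 ^+ j * e < u /\ u <= 2 ^+ j.+1 * e.
Proof.
move=> e0 eu.
have ex : exists j, u <= 2 ^+ j.+1 * e.
  exists (Num.truncn (u / e)); rewrite -ler_pdivrMr//.
  apply: (le_trans (ltW (truncnS_gt _))).
  rewrite -natrX ler_nat (leq_trans (ltnW (ltn_expl _ (ltnSn 1))))//.
case: (ex_minnP ex) => j uj jmin; exists j; split => //.
case: j uj jmin => [|j] uj jmin; first by rewrite expr0 mul1r.
by rewrite ltNge; apply/negP => /jmin; rewrite ltnn.
Qed.

(** Averages bounded by a constant at every scale control the tail of the kernel
  e / u ^+ 2: the tail is cut into the dyadic shells 2 ^ j e < |u| <= 2 ^ (j + 1) e. *)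
Lemma tail_le_averages g (x e k : R) : measurable_fun setT g ->
  (forall t, 0 <= g t) -> 0 < e -> 0 <= k ->
  (forall r : R, 0 < r -> (\int[mu]_t (if `|t - x| <= r then g t else 0)%:E <= (k * r)%:E)%E) ->
  (\int[mu]_t (if e < `|t - x| then g t * (e / (t - x) ^+ 2) else 0)%:E <= (4 * k)%:E)%E.
Proof.
move=> mg g0 e0 k0 avg.
pose h (j : nat) t := (4 ^- j / e) * (if `|t - x| <= 2 ^+ j.+1 * e then g t else 0).
have c0 j : 0 <= (4 ^- j / e : R) by rewrite mulr_ge0 ?invr_ge0 ?exprn_ge0 ?ltW.
have i0 j t : 0 <= (if `|t - x| <= 2 ^+ j.+1 * e then g t else 0).
  by case: ifP.
have h0 j t : 0 <= h j t by rewrite mulr_ge0.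
have mh j : measurable_fun setT (h j) by rewrite /h; meas.
apply: (@le_trans _ _ (\int[mu]_t (\sum_(j <oo) (h j t)%:E))%E).
  apply: ge0_le_integralT; first by meas.
  - by apply: ge0_emeasurable_sum => [j t _ _|j _]; [rewrite lee_fin|meas].
  - move=> t; case: ifPn => // et; rewrite lee_fin mulr_ge0//.
    by rewrite divr_ge0 ?sqr_ge0 ?ltW.
  move=> t; case: ifPn => [et|_]; last first.
    by apply: nneseries_ge0 => j _ _; rewrite lee_fin.
  have [j [ju uj]] := dyadic_scale e0 et.
  apply: (@le_trans _ _ (h j t)%:E).
    rewrite /h uj lee_fin mulrC ler_wpM2r//.
    have ju0 : 0 < 2 ^+ j * e by rewrite mulr_gt0 ?exprn_gt0.
    have -> : 4 ^- j / e = e / (2 ^+ j * e) ^+ 2.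
      rewrite exprMn -exprM mulnC exprM (_ : 2 ^+ 2 = 4); last by rewrite expr2; lra.
      by field; rewrite gt_eqF//= expf_neq0.
    have tx0 : 0 < (t - x) ^+ 2 by rewrite exprn_even_gt0//= -normr_gt0 (lt_trans e0).
    rewrite ler_wpM2l ?(ltW e0)// lef_pV2 ?posrE ?(exprn_gt0 2 ju0)//.
    by rewrite -(real_normK (num_real (t - x))) ler_sqr ?nnegrE// ltW.
  by apply: (nneseries_term_le (u := fun i => (h i t)%:E)) => i; rewrite lee_fin.
rewrite ge0_integral_seriesT//.
apply: (@le_trans _ _ (\sum_(j <oo) ((4 * k) / (2 ^ j.+1)%:R)%:E)%E); last first.
  exact: (@epsilon_trick0 _ (4 * k) xpredT (mulr_ge0 (ler0n _ 4) k0)).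
apply: lee_nneseries => [j _ _|j _]; first exact: integralT_ge0.
rewrite /h ge0_integralZT//; last by meas.
apply: (@le_trans _ _ ((4 ^- j / e)%:E * (k * (2 ^+ j.+1 * e))%:E)%E).
  by rewrite lee_wpmul2l ?lee_fin// avg// mulr_gt0 ?exprn_gt0.
rewrite -EFinM lee_fin natrX.
have -> : (4:R) = 2 ^+ 2 by rewrite expr2; lra.
rewrite -exprM mulnC exprM (exprS 2 j).
rewrite le_eqVlt; apply/orP; left; apply/eqP.
by field; rewrite ?gt_eqF ?exprn_gt0.
Qed.

Lemma integral_ifE (P : pred R) (f : R -> \bar R) :
  (\int[mu]_t (if P t then f t else 0) = \int[mu]_(t in [set t | P t]) f t)%E.
Proof.
rewrite [RHS]integral_mkcond; apply: eq_integral => t _; rewrite patchE.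
by case: ifPn => Pt; [rewrite mem_set|rewrite memNset//; exact/negP].
Qed.

Lemma integral_EFin_ifE (P : pred R) f :
  (\int[mu]_t (if P t then f t else 0)%:E = \int[mu]_(t in [set t | P t]) (f t)%:E)%E.
Proof. by rewrite -integral_ifE; apply: eq_integral => t _; case: ifP. Qed.

Lemma set_ball_itv (x r : R) : [set t | `|t - x| <= r] = `[x - r, x + r]%classic.
Proof. by apply/seteqP; split => t /=; rewrite in_itv/= ler_distl. Qed.

Lemma integral_ball_cst (c x r : R) : 0 <= r ->
  (\int[mu]_t (if `|t - x| <= r then c else 0)%:E = (c * (2 * r))%:E)%E.
Proof.
move=> r0; rewrite integral_EFin_ifE set_ball_itv integral_cst//=.
rewrite lebesgue_measure_itv/= lte_fin.
case: ltP => h; first by rewrite -EFinB -EFinM; congr EFin; ring.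
rewrite (_ : r = 0) ?mulr0 ?mule0//; lra.
Qed.

(** The ball of radius y contributes at most 2, the rest is the tail of
  a constant function. *)
Lemma poisson_kernel_mass (x y : R) : 0 < y ->
  (\int[mu]_t (y / ((t - x) ^+ 2 + y ^+ 2))%:E <= 10%:E)%E.
Proof.
move=> y0; have y20 : 0 < y ^+ 2 by rewrite exprn_gt0.
apply: (@le_trans _ _ (\int[mu]_t ((if `|t - x| <= y then y^-1 else 0) +
   (if y < `|t - x| then 1 * (y / (t - x) ^+ 2) else 0))%:E)%E).
  apply: le_integralT; try by meas.
    by move=> t; rewrite divr_ge0 ?(ltW y0)// addr_ge0 ?sqr_ge0 ?ltW.
  move=> t; case: leP => ty; rewrite ?addr0 ?add0r ?mul1r.
    rewrite ler_pdivrMr ?ltr_wpDl ?sqr_ge0// mulrDr.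
    rewrite (_ : y^-1 * y ^+ 2 = y); last by field; rewrite gt_eqF.
    by rewrite lerDr mulr_ge0 ?sqr_ge0// invr_ge0 ltW.
  have tx0 : 0 < (t - x) ^+ 2.
    by rewrite exprn_even_gt0//= -normr_gt0 (lt_trans y0).
  rewrite ler_wpM2l ?(ltW y0)// lef_pV2 ?posrE ?ltr_wpDl ?sqr_ge0//.
  by rewrite lerDl ltW.
rewrite ge0_integralDT; try by meas.
- rewrite integral_ball_cst ?(ltW y0)// (_ : 10%:E = (y^-1 * (2 * y) + 4 * 2)%:E)%E; last first.
    by congr EFin; field; rewrite gt_eqF.
  rewrite EFinD leeD2l// (tail_le_averages (g := fun=> 1))// => r r0.
  by rewrite integral_ball_cst ?(ltW r0)// mul1r.
- by move=> t; case: ifP => // _; rewrite invr_ge0 ltW.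
- by move=> t; case: ifP => // _; rewrite mul1r divr_ge0 ?sqr_ge0 ?ltW.
Qed.

Lemma FTC_is_derive (f F : R -> R) (a b : R) : a <= b ->
  (forall t, a <= t <= b -> {for t, continuous f}) ->
  (forall t, a <= t <= b -> is_derive t (1:R) F (f t)) ->
  (\int[mu]_(t in `[a, b]) (f t)%:E = (F b - F a)%:E)%E.
Proof.
rewrite le_eqVlt => /predU1P[<-|ab] cf dF.
  by rewrite set_itv1 integral_set1 subrr.
have cF t : a <= t <= b -> {for t, continuous F}.
  by move=> /dF [dFt _]; exact/differentiable_continuous/derivable1_diffP.
have {}cf : {within `[a, b], continuous f}.
  by apply: continuous_in_subspaceT => t; rewrite inE/= in_itv/= => /cf.
rewrite (@continuous_FTC2 _ f F _ _ ab cf)//.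
- split.
  + by move=> t; rewrite in_itv/= => /andP[at_ tb]; have [] := dF t; rewrite ?(ltW at_) ?(ltW tb).
  + by apply: cvg_at_right_filter; apply: cF; rewrite lexx ltW.
  + by apply: cvg_at_left_filter; apply: cF; rewrite lexx andbT ltW.
- move=> t; rewrite in_itv/= => /andP[at_ tb]; rewrite derive1E.
  by have [] := dF t; rewrite ?(ltW at_) ?(ltW tb).
Qed.

(** The ball is cut at its center: on each half |t - x| is affine. *)
Lemma radial_integral (f F : R -> R) (x B : R) : 0 <= B ->
  (forall u : R, 0 <= f u) ->
  (forall u : R, 0 <= u -> {for u, continuous f}) ->
  (forall u : R, 0 <= u -> is_derive u (1:R) F (f u)) ->
  measurable_fun setT (fun t : R => f `|t - x|) ->
  (\int[mu]_t (if `|t - x| <= B then f `|t - x| else 0)%:E = (2 * (F B - F 0))%:E)%E.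
Proof.
move=> B0 f0 cf dF mf.
rewrite integral_EFin_ifE set_ball_itv.
rewrite (@itv_bndbnd_setU _ _ _ (BLeft x)); last 2 first.
  by rewrite bnd_simp lerBlDr lerDl.
  by rewrite bnd_simp lerDl.
rewrite ge0_integral_setU//=; last 3 first.
- by apply: measurable_funTS; exact: measurable_EFin.
- by move=> t _; rewrite lee_fin.
- apply/disj_setPS => t []/=; rewrite !in_itv/= => /andP[_ tx] /andP[xt _].
  by move: (lt_le_trans tx xt); rewrite ltxx.
rewrite integral_itv_bndo_bndc; last first.
  by apply: measurable_funTS; exact: measurable_EFin.
rewrite (@eq_integralR _ _ (fun t : R => (f (x - t))%:E)); last first.
  by move=> t; rewrite /= in_itv/= => /andP[_ tx]; rewrite distrC ger0_norm// subr_ge0.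
rewrite [X in (_ + X)%E](@eq_integralR _ _ (fun t : R => (f (t - x))%:E)); last first.
  by move=> t; rewrite /= in_itv/= => /andP[xt _]; rewrite ger0_norm// subr_ge0.
have -> : (\int[mu]_(t in `[(x - B)%R, x]) (f (x - t))%:E = (- F (x - x) - - F (x - (x - B)))%:E)%E.
  apply: (@FTC_is_derive _ (fun t : R => - F (x - t))).
  - by rewrite lerBlDr lerDl.
  - move=> t /andP[_ tx].
    apply: (@continuous_comp _ _ _ (fun t : R => x - t) f); last by apply: cf; rewrite subr_ge0.
    by apply: cvgB; [exact: cvg_cst|exact: cvg_id].
  - move=> t /andP[_ tx].
    have := dF (x - t); rewrite subr_ge0 => /(_ tx) d.
    have d2 : is_derive t (1:R) (fun t : R => x - t) (-1).
      by apply: is_derive_eq; ring.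
    have d3 := @is_derive1_comp _ F (fun t : R => x - t) _ _ _ d d2.
    have d4 : is_derive t (1:R) (- (F \o (fun t : R => x - t))) (- (f (x - t) * -1)).
      exact: is_deriveN.
    by apply: (is_derive_eq d4); ring.
have -> : (\int[mu]_(t in `[x, (x + B)%R]) (f (t - x))%:E = (F (x + B - x) - F (x - x))%:E)%E.
  apply: (@FTC_is_derive _ (fun t : R => F (t - x))).
  - by rewrite lerDl.
  - move=> t /andP[xt _].
    apply: (@continuous_comp _ _ _ (fun t : R => t - x) f); last by apply: cf; rewrite subr_ge0.
    by apply: cvgB; [exact: cvg_id|exact: cvg_cst].
  - move=> t /andP[xt _].
    have := dF (t - x); rewrite subr_ge0 => /(_ xt) d.
    have d2 : is_derive t (1:R) (fun t : R => t - x) 1 by apply: is_derive_eq; ring.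
    have d3 := @is_derive1_comp _ F (fun t : R => t - x) _ _ _ d d2.
    by apply: (is_derive_eq d3); ring.
rewrite -EFinD; congr EFin.
by rewrite subrr (_ : x - (x - B) = B) 1?(_ : x + B - x = B); ring.
Qed.

Definition wgt (u : R) : R := 1 + `|u|.

Lemma wgt_ge1 u : 1 <= wgt u. Proof. by rewrite lerDl. Qed.
Lemma wgt_gt0 u : 0 < wgt u. Proof. exact: lt_le_trans ltr01 (wgt_ge1 u). Qed.
Hint Resolve wgt_ge1 wgt_gt0 : core.

Lemma integral_wgt_ball (q x B : R) : q != 1 -> 0 <= B ->
  (\int[mu]_t (if `|t - x| <= B then wgt (t - x) `^ (- q) else 0)%:E =
   (2 / (1 - q) * ((1 + B) `^ (1 - q) - 1))%:E)%E.
Proof.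
move=> q1 B0.
apply: (eq_trans (@radial_integral (fun u => (1 + u) `^ (- q))
  (fun u => (1 - q)^-1 * (1 + u) `^ (1 - q)) x B B0 _ _ _ _)).
- by move=> u; rewrite powR_ge0.
- move=> u u0; apply: (@continuous_comp _ _ _ (fun u : R => 1 + u) (fun v => v `^ (- q))).
    by apply: cvgD; [exact: cvg_cst|exact: cvg_id].
  have u10 : 0 < 1 + u by rewrite ltr_wpDr.
  have [d _] := is_derive1_powR (- q) u10.
  exact/differentiable_continuous/derivable1_diffP.
- move=> u u0.
  have u10 : 0 < 1 + u by rewrite ltr_wpDr.
  have d := is_derive1_powR (1 - q) u10.
  have d2 : is_derive u (1:R) (fun u : R => 1 + u) 1 by apply: is_derive_eq; ring.
  have d3 := @is_derive1_comp _ _ (fun u : R => 1 + u) _ _ _ d d2.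
  have d4 := @is_deriveZ _ _ _ _ ((1 - q)^-1) _ _ _ d3.
  apply: (is_derive_eq d4); rewrite mulr1 -[_ *: _]/(_ * _) mulKf ?subr_eq0 1?eq_sym//.
  by congr (_ `^ _); ring.
- by meas.
- by rewrite addr0 powR1; congr EFin; field; rewrite subr_eq0 eq_sym.
Qed.

Lemma integral_le_balls f (K : \bar R) (x : R) : measurable_fun setT f ->
  (forall t, 0 <= f t) ->
  (forall n : nat, (\int[mu]_t (if `|t - x| <= n%:R then f t else 0)%:E <= K)%E) ->
  (\int[mu]_t (f t)%:E <= K)%E.
Proof.
move=> mf f0 fK.
pose h n t := if `|t - x| <= n%:R then f t else 0.
have h0 n t : 0 <= h n t by rewrite /h; case: ifP.
have -> : (\int[mu]_t (f t)%:E = \int[mu]_t limn (fun n => (h n t)%:E))%E.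
  apply: eq_integralR => t _; apply/esym/cvg_lim => //.
  apply: cvg_near_cst; near=> n; rewrite /h ifT//.
  by near: n; exact: nbhs_infty_ger.
rewrite monotone_convergence//.
- apply: lime_le; last by apply: nearW.
  apply: ereal_nondecreasing_is_cvgn => m n mn.
  apply: le_integralT => [| |t|t]; rewrite /h; try by meas.
    by case: ifP.
  case: ifPn => tm; last by case: ifP.
  by rewrite ifT// (le_trans tm)// ler_nat.
- by move=> n; apply: measurable_EFin; rewrite /h; meas.
- by move=> n t _; rewrite lee_fin.
- move=> t _ m n mn; rewrite lee_fin /h.
  case: ifPn => tm; last by case: ifP.
  by rewrite ifT// (le_trans tm)// ler_nat.
Unshelve. all: by end_near. Qed.

(** The two halves of the Schur test: (1 + |u|) ^ (- q) integrates to X ^ (1 - q) up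
  to a constant over 1 + |u| <= X if q < 1, and over 1 + |u| > X if q > 1. *)
Lemma integral_wgt_inside (s x X : R) : 0 < s -> s < 1 -> 1 <= X ->
  (\int[mu]_t (if wgt (t - x) <= X then wgt (t - x) `^ (- s) else 0)%:E <=
   (2 / (1 - s) * X `^ (1 - s))%:E)%E.
Proof.
move=> s0 s1 X1.
rewrite (@eq_integralR _ _ (fun t : R => (if `|t - x| <= X - 1 then wgt (t - x) `^ (- s) else 0)%:E)); last first.
  by move=> t _; rewrite /wgt lerBrDl.
rewrite integral_wgt_ball ?lt_eqF ?subr_ge0// lee_fin ler_wpM2l//.
  by rewrite divr_ge0// subr_ge0 ltW.
by rewrite (addrC 1 (X - 1)) subrK gerBl.
Qed.

Lemma integral_wgt_outside (s x X : R) : 0 < s -> 1 <= X ->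
  (\int[mu]_t (if X < wgt (t - x) then wgt (t - x) `^ (- (1 + s)) else 0)%:E <=
   (2 / s * X `^ (- s))%:E)%E.
Proof.
move=> s0 X1.
have s1 : 1 + s != 1 by rewrite gt_eqF// ltrDl.
have e1 : 1 - (1 + s) = - s by ring.
apply: (integral_le_balls (x := x)).
- by rewrite /wgt; meas.
- by move=> t; case: ifP => // _; rewrite powR_ge0.
move=> n; have [nX|Xn] := leP (n%:R) (X - 1).
  rewrite (@eq_integralR _ _ (fun=> 0%E)) => [|t _].
    by rewrite integral0 lee_fin mulr_ge0 ?powR_ge0// divr_ge0// ltW.
  case: ifPn => // tn; rewrite ifN// -leNgt /wgt -lerBrDl.
  exact: le_trans nX.
have := integral_wgt_ball x s1 (ler0n R n).
rewrite (@eq_integralR _ _ (fun t : R => ((if `|t - x| <= X - 1 then wgt (t - x) `^ (- (1 + s)) else 0) +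
  (if `|t - x| <= n%:R then if X < wgt (t - x) then wgt (t - x) `^ (- (1 + s)) else 0 else 0))%:E)); last first.
  move=> t _; rewrite /wgt -ltrBlDl; congr EFin.
  have [tX|Xt] := leP `|t - x| (X - 1).
    by rewrite (le_trans tX (ltW Xn)) addr0.
  by rewrite add0r.
rewrite ge0_integralDT; first last.
- by move=> t; case: ifP => // _; case: ifP => // _; rewrite powR_ge0.
- by move=> t; case: ifP => // _; rewrite powR_ge0.
- by rewrite /wgt; meas.
- by rewrite /wgt; meas.
rewrite integral_wgt_ball ?subr_ge0// e1.
set I := (X in (_ + X)%E = _ -> _).
rewrite (addrC 1 (X - 1)) subrK.
rewrite -/I; case: I => [i| |]//; rewrite -EFinD => -[ei].
rewrite lee_fin (_ : i = 2 / - s * ((1 + n%:R) `^ (- s) - 1) - 2 / - s * (X `^ (- s) - 1)); last by rewrite -ei; ring.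
have p0 : 0 <= (1 + n%:R : R) `^ (- s) by exact: powR_ge0.
rewrite -subr_ge0.
have -> : 2 / s * X `^ (- s) - (2 / - s * ((1 + n%:R) `^ (- s) - 1) - 2 / - s * (X `^ (- s) - 1))
   = 2 / s * (1 + n%:R) `^ (- s) by field; rewrite gt_eqF.
by rewrite mulr_ge0// divr_ge0// ltW.
Qed.

End integrals_of_real_functions.
#[global] Hint Resolve wgt_ge1 wgt_gt0 : core.

(** * Real-valued integrals and integrals with a parameter *)

Section Rintegral_real_line.
Context {R : realType}.
Local Notation mu := (@lebesgue_measure R).
Implicit Types (f g : R -> R).

Lemma integrable_of_bound f g : measurable_fun setT f -> measurable_fun setT g ->
  (forall t, `|f t| <= g t) -> (\int[mu]_t (g t)%:E < +oo)%E ->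
  mu.-integrable setT (EFin \o f).
Proof.
move=> mf mg fg goo; apply/integrableP; split; first exact: measurable_EFin.
apply: le_lt_trans goo; apply: le_integralT => //.
by apply: measurableT_comp.
Qed.

Lemma integrable_meas f : mu.-integrable setT (EFin \o f) -> measurable_fun setT f.
Proof. by move=> /integrableP[/measurable_EFinP]. Qed.

Lemma integrable_abs_lty f : mu.-integrable setT (EFin \o f) ->
  (\int[mu]_t `|f t|%:E < +oo)%E.
Proof. by move=> /integrableP[]. Qed.

Lemma Rintegral_abs_le f (K : R) : mu.-integrable setT (EFin \o f) ->
  (\int[mu]_t `|f t|%:E <= K%:E)%E -> `|\int[mu]_t f t| <= K.
Proof.
move=> fi fK; rewrite -lee_fin EFin_normr_Rintegral//.
apply: le_trans fK; apply: le_abse_integral => //.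
by case/integrableP: fi.
Qed.

Lemma Rintegral_EFin f : mu.-integrable setT (EFin \o f) ->
  ((\int[mu]_t f t)%R%:E = \int[mu]_t (f t)%:E)%E.
Proof. by move=> fi; rewrite /Rintegral fineK//; exact: integrable_fin_num. Qed.

Lemma Rintegral_dominated (h : nat -> R -> R) f g :
  (forall n, measurable_fun setT (h n)) -> measurable_fun setT g ->
  (forall t, h n t @[n --> \oo] --> f t) -> (\int[mu]_t (g t)%:E < +oo)%E ->
  (forall n t, `|h n t| <= g t) ->
  \int[mu]_t h n t @[n --> \oo] --> \int[mu]_t f t.
Proof.
move=> mh mg hf goo hg.
have g0 t : 0 <= g t by exact: le_trans (hg 0%N t).
have gi : mu.-integrable setT (EFin \o g).
  by apply: (integrable_of_bound mg mg) => // t; rewrite ger0_norm.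
have mf : measurable_fun setT f.
  by apply: (measurable_fun_cvg (h := h)).
have fi : mu.-integrable setT (EFin \o f).
  apply: (integrable_of_bound mf mg) => // t.
  have : `|h n t| @[n --> \oo] --> `|f t| by apply: cvg_norm.
  move=> h1; rewrite -(cvg_lim _ h1)//; apply: limr_le; first by apply/cvg_ex; exists `|f t|.
  exact: nearW.
apply: fine_cvg; rewrite fineK; last exact: integrable_fin_num.
apply: (@dominated_cvg _ _ _ mu setT measurableT (fun n t => (h n t)%:E) _ (EFin \o g)) => //.
- by move=> n; exact: measurable_EFin (mh n).
- by move=> t _; apply: cvg_EFin; [exact: nearW|exact: hf].
- by move=> n t _; rewrite /= lee_fin hg.
Qed.

Lemma integral_wgt2 (x : R) : (\int[mu]_t (wgt (t - x) ^- 2)%:E <= 2%:E)%E.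
Proof.
apply: (integral_le_balls (x := x)).
- by rewrite /wgt; meas.
- by move=> t; rewrite invr_ge0; apply: exprn_ge0; exact: ltW (wgt_gt0 _).
move=> n; have n0 : 0 <= n%:R :> R by [].
have q1 : (2 : R) != 1 by rewrite gt_eqF// ltr1n.
rewrite (@eq_integralR _ _ _ (fun t => (if `|t - x| <= n%:R then wgt (t - x) `^ (- 2) else 0)%:E)).
  rewrite integral_wgt_ball// lee_fin.
  have -> : 2 / (1 - 2) * ((1 + n%:R) `^ (1 - 2) - 1) = 2 - 2 * ((1 + n%:R) `^ (1 - 2)) :> R by field.
  by rewrite gerBl mulr_ge0// powR_ge0.
by move=> t _; rewrite powRN powR_mulrn// ltW// wgt_gt0.
Qed.

Section parametric_integral.
Variables (f : R -> R) (k k' : R -> R -> R) (a b C : R).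
Hypothesis fi : mu.-integrable setT (EFin \o f).
Hypothesis mk : forall z, measurable_fun setT (k z).
Hypothesis kC : forall z t, a < z < b -> `|k z t| <= C.

Lemma parametric_integrable z : a < z < b ->
  mu.-integrable setT (EFin \o (fun t => f t * k z t)).
Proof.
move=> zab; have mf := integrable_meas fi.
apply: (@integrable_of_bound _ (fun t => C * `|f t|)); first by apply: measurable_funM.
- by meas.
- by move=> t; rewrite normrM mulrC ler_wpM2r// kC.
have C0 : 0 <= C by apply: le_trans (kC 0 zab).
rewrite ge0_integralZT//; last by meas.
by rewrite lte_mul_pinfty// integrable_abs_lty.
Qed.

(** Differentiation under the integral sign, for f integrable and a kernel that is
  bounded together with its derivative: C |f| dominates. *)
Lemma parametric_derive z : a < z < b ->
  (forall z t, a < z < b -> is_derive z (1:R) (k^~ t) (k' z t)) ->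
  (forall z t, a < z < b -> `|k' z t| <= C) ->
  is_derive z (1:R) (fun z => \int[mu]_t (f t * k z t)) (\int[mu]_t (f t * k' z t)).
Proof.
move=> zab dk k'C; have mf := integrable_meas fi.
have C0 : 0 <= C by apply: le_trans (kC 0 zab).
have G0 t : 0 <= C * `|f t| by rewrite mulr_ge0.
have Gi : mu.-integrable setT (EFin \o (fun t => C * `|f t|)).
  apply: (@integrable_of_bound _ (fun t => C * `|f t|)); try by meas.
    by move=> t; rewrite ger0_norm.
  rewrite ge0_integralZT//; last by meas.
  by rewrite lte_mul_pinfty// integrable_abs_lty.
have dfk z' t : a < z' < b -> is_derive z' (1:R) (fun z => f t * k z t) (f t * k' z' t).
  by move=> z'ab; exact: (is_deriveZ (f t) (dk z' t z'ab)).
have zI : `]a, b[%classic z by rewrite /= in_itv.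
have p1 z' t : a < z' < b -> partial1of2 (fun z t => f t * k z t) z' t = f t * k' z' t.
  by move=> z'ab; rewrite partial1of2E; have [_ ->] := dfk z' t z'ab.
have hi z' : `]a, b[%classic z' -> mu.-integrable setT (EFin \o (fun t => f t * k z' t)).
  by rewrite /= in_itv => /parametric_integrable.
have hd z' t : `]a, b[%classic z' -> setT t -> derivable (fun z => f t * k z t) z' 1.
  by rewrite /= in_itv/= => z'ab _; have [] := dfk z' t z'ab.
have hG z' t : `]a, b[%classic z' -> setT t ->
    `|partial1of2 (fun z t => f t * k z t) z' t| <= C * `|f t|.
  by rewrite /= in_itv/= => z'ab _; rewrite p1// normrM mulrC ler_wpM2r// k'C.
apply: DeriveDef; first exact: (derivable_under_integral measurableT zI hi hd G0 Gi hG).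
rewrite -derive1E (differentiation_under_integral measurableT zI hi hd G0 Gi hG).
by apply: eq_Rintegral => t _; rewrite p1.
Qed.

Lemma parametric_continuous z : a < z < b ->
  (forall z t, a < z < b -> {for z, continuous (k^~ t)}) ->
  {for z, continuous (fun z => \int[mu]_t (f t * k z t))}.
Proof.
move=> zab ck; have mf := integrable_meas fi.
have C0 : 0 <= C by apply: le_trans (kC 0 zab).
have Gi : mu.-integrable setT (EFin \o (fun t => C * `|f t|)).
  apply: (@integrable_of_bound _ (fun t => C * `|f t|)); try by meas.
    by move=> t; rewrite ger0_norm// mulr_ge0.
  rewrite ge0_integralZT//; last by meas.
  by rewrite lte_mul_pinfty// integrable_abs_lty.
apply: (@continuity_under_integral _ _ _ mu (fun z t => f t * k z t) setT measurableT a b _ _ (fun t => C * `|f t|) Gi).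
- by move=> z' /=; rewrite in_itv => /parametric_integrable.
- apply: aeW => t _ z' /set_mem/=; rewrite in_itv/= => z'ab.
  by apply: cvgM; [exact: cvg_cst|exact: ck].
- move=> z' /=; rewrite in_itv/= => z'ab; apply: aeW => t _.
  by rewrite normrM mulrC ler_wpM2r// kC.
- by rewrite inE/= in_itv.
Qed.

End parametric_integral.

End Rintegral_real_line.

(** * Cauchy's theorem on horizontal lines of the half plane *)

Section holomorphic_pairs.
Context {R : realType}.
Local Notation mu := (@lebesgue_measure R).

(** Real and imaginary parts P, Q of a function holomorphic on the upper half
  plane, with their x-derivatives P', Q'; the decay makes
  their squares integrable along horizontal lines and small far up. *)
Record holomorphic_pair (P Q P' Q' : R -> R -> R) : Prop := HolomorphicPair {
  hol_dPx : forall x y : R, 0 < y -> is_derive x (1:R) (P ^~ y) (P' x y) ;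
  hol_dQx : forall x y : R, 0 < y -> is_derive x (1:R) (Q ^~ y) (Q' x y) ;
  hol_dPy : forall x y : R, 0 < y -> is_derive y (1:R) (P x) (- Q' x y) ;
  hol_dQy : forall x y : R, 0 < y -> is_derive y (1:R) (Q x) (P' x y) ;
  hol_cP' : forall x y : R, 0 < y -> {for x, continuous (P' ^~ y)} ;
  hol_cQ' : forall x y : R, 0 < y -> {for x, continuous (Q' ^~ y)} ;
  hol_decay : forall y0 : R, 0 < y0 -> exists C : R, forall x y : R, y0 <= y ->
    [/\ `|P x y| <= C / wgt x, `|Q x y| <= C / wgt x,
        `|P' x y| <= C / wgt x & `|Q' x y| <= C / wgt x] ;
  hol_decay_y : exists C : R, forall x y : R, 1 <= y ->
    `|P x y| <= C / y /\ `|Q x y| <= C / y }.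

Variables P Q P' Q' : R -> R -> R.
Hypothesis H : holomorphic_pair P Q P' Q'.

Let continuous_of_derive (g : R -> R) (x d : R) : is_derive x (1:R) g d ->
  {for x, continuous g}.
Proof. by move=> [dg _]; exact/differentiable_continuous/derivable1_diffP. Qed.

Let cP (x y : R) : 0 < y -> {for x, continuous (P ^~ y)}.
Proof. by move=> y0; exact: continuous_of_derive (hol_dPx H x y0). Qed.

Let cQ (x y : R) : 0 < y -> {for x, continuous (Q ^~ y)}.
Proof. by move=> y0; exact: continuous_of_derive (hol_dQx H x y0). Qed.

(** The square of a holomorphic function is again holomorphic with decay. Hence
  the theorem below, which speaks of a square, also covers the fourth power. *)
Lemma holomorphic_pair_sqr :
  holomorphic_pair (fun x y => P x y ^+ 2 - Q x y ^+ 2) (fun x y => 2 * (P x y * Q x y))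
    (fun x y => 2 * (P x y * P' x y - Q x y * Q' x y))
    (fun x y => 2 * (P x y * Q' x y + P' x y * Q x y)).
Proof.
have sqr_sub (f g : R -> R) (df dg x : R) : is_derive x (1:R) f df -> is_derive x (1:R) g dg ->
    is_derive x (1:R) (fun z => f z ^+ 2 - g z ^+ 2) (2 * (f x * df - g x * dg)).
  move=> hf hg; apply: is_derive_eq.
  by rewrite -![_ *: _]/(_ * _); ring.
have mul2 (f g : R -> R) (df dg x : R) : is_derive x (1:R) f df -> is_derive x (1:R) g dg ->
    is_derive x (1:R) (fun z => 2 * (f z * g z)) (2 * (f x * dg + df * g x)).
  move=> hf hg; apply: is_derive_eq.
  by rewrite -![_ *: _]/(_ * _); ring.
split.
- by move=> x y y0; exact: (sqr_sub _ _ _ _ _ (hol_dPx H x y0) (hol_dQx H x y0)).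
- by move=> x y y0; exact: (mul2 _ _ _ _ _ (hol_dPx H x y0) (hol_dQx H x y0)).
- move=> x y y0; have := sqr_sub _ _ _ _ _ (hol_dPy H x y0) (hol_dQy H x y0).
  by move=> d; apply: (is_derive_eq d); ring.
- move=> x y y0; have := mul2 _ _ _ _ _ (hol_dPy H x y0) (hol_dQy H x y0).
  by move=> d; apply: (is_derive_eq d); ring.
- move=> x y y0; apply: cvgM; first exact: cvg_cst.
  apply: cvgB; apply: cvgM; [exact: cP|exact: (hol_cP' H)|exact: cQ|exact: (hol_cQ' H)].
- move=> x y y0; apply: cvgM; first exact: cvg_cst.
  apply: cvgD; apply: cvgM; [exact: cP|exact: (hol_cQ' H)|exact: (hol_cP' H)|exact: cQ].
- move=> y0 /(hol_decay H)[C hC]; exists (4 * C * C) => x y /(hC x)[hP hQ hP' hQ'].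
  have w0 : 0 < (wgt x)^-1 by rewrite invr_gt0 wgt_gt0.
  have C0 : 0 <= C by rewrite -(pmulr_lge0 _ w0) (le_trans _ hP).
  have w1 : (wgt x)^-1 <= 1 by rewrite invf_le1 ?wgt_gt0// wgt_ge1.
  have prod a b : `|a| <= C / wgt x -> `|b| <= C / wgt x -> `|a * b| <= C * C / wgt x.
    move=> ha hb; rewrite normrM (le_trans (ler_pM _ _ ha hb))//.
    by rewrite mulrACA ler_wpM2l ?mulr_ge0// ler_piMr// ltW.
  have hPP := prod _ _ hP hP; have hQQ := prod _ _ hQ hQ.
  have hPQ := prod _ _ hP hQ; have hPP' := prod _ _ hP hP'.
  have hQQ' := prod _ _ hQ hQ'; have hPQ' := prod _ _ hP hQ'.
  have hP'Q := prod _ _ hP' hQ.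
  have c4 : 4 * C * C / wgt x = 4 * (C * C / wgt x) by ring.
  have cc : 0 <= C * C / wgt x by rewrite divr_ge0 ?mulr_ge0// ltW// wgt_gt0.
  rewrite c4 !expr2; split.
  + by rewrite (le_trans (ler_normB _ _))// (le_trans (lerD hPP hQQ))//; lra.
  + by rewrite normrM ger0_norm//; lra.
  + rewrite normrM ger0_norm// (_ : 4 = 2 * 2 :> R); last by ring.
    rewrite -mulrA ler_wpM2l// (le_trans (ler_normB _ _))// (le_trans (lerD hPP' hQQ'))//; lra.
  + rewrite normrM ger0_norm// (_ : 4 = 2 * 2 :> R); last by ring.
    rewrite -mulrA ler_wpM2l// (le_trans (ler_normD _ _))// (le_trans (lerD hPQ' hP'Q))//; lra.
- have [C hC] := hol_decay_y H; exists (2 * (C * C)) => x y y1.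
  have [hP hQ] := hC x y y1.
  have w0 : 0 < y^-1 by rewrite invr_gt0 (lt_le_trans ltr01).
  have C0 : 0 <= C by rewrite -(pmulr_lge0 _ w0) (le_trans _ hP).
  have w1 : y^-1 <= 1 by rewrite invf_le1// (lt_le_trans ltr01).
  have prod a b : `|a| <= C / y -> `|b| <= C / y -> `|a * b| <= C * C / y.
    move=> ha hb; rewrite normrM (le_trans (ler_pM _ _ ha hb))//.
    by rewrite mulrACA ler_wpM2l ?mulr_ge0// ler_piMr// ltW.
  have hPP := prod _ _ hP hP; have hQQ := prod _ _ hQ hQ; have hPQ := prod _ _ hP hQ.
  rewrite !expr2 -!mulrA; split.
    by rewrite (le_trans (ler_normB _ _))// (le_trans (lerD hPP hQQ))//; lra.
  by rewrite normrM ger0_norm// ler_wpM2l// mulrA.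
Qed.

Let Phi (x y : R) := P x y ^+ 2 - Q x y ^+ 2.
Let Psi (x y : R) := 2 * (P x y * Q x y).
Let E (x y : R) := 2 * (P x y * Q' x y + P' x y * Q x y).

Let sqr_decay (y0 : R) : 0 < y0 -> exists2 C : R, 0 <= C & forall x y : R, y0 <= y ->
  [/\ `|Phi x y| <= C * wgt x ^- 2, `|Psi x y| <= C * wgt x ^- 2 & `|E x y| <= C * wgt x ^- 2].
Proof.
move=> /(hol_decay H)[C hC]; exists (4 * (C * C)).
  by rewrite mulr_ge0// -expr2 sqr_ge0.
move=> x y /(hC x)[hP hQ hP' hQ'].
have prod a b : `|a| <= C / wgt x -> `|b| <= C / wgt x -> `|a * b| <= C * C * wgt x ^- 2.
  move=> ha hb; rewrite normrM (le_trans (ler_pM _ _ ha hb))//.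
  by rewrite mulrACA -invfM -expr2.
have hPP := prod _ _ hP hP; have hQQ := prod _ _ hQ hQ.
have hPQ := prod _ _ hP hQ; have hPQ' := prod _ _ hP hQ'; have hP'Q := prod _ _ hP' hQ.
have cc : 0 <= C * C * wgt x ^- 2.
  by rewrite mulr_ge0 -?expr2 ?sqr_ge0// invr_ge0 sqr_ge0.
rewrite /Phi /Psi /E -mulrA; set K := C * C * wgt x ^- 2 in hPP hQQ hPQ hPQ' hP'Q cc *.
rewrite !expr2.
split.
+ by rewrite (le_trans (ler_normB _ _))// (le_trans (lerD hPP hQQ))//; lra.
+ by rewrite normrM ger0_norm//; lra.
+ by rewrite normrM ger0_norm//; have := ler_normD (P x y * Q' x y) (P' x y * Q x y); lra.
Qed.

Let mE (y : R) : 0 < y -> measurable_fun setT (E ^~ y).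
Proof.
move=> y0; apply: continuous_measurable_fun => x.
exact: (hol_cQ' holomorphic_pair_sqr y0).
Qed.

Let mPhi (y : R) : 0 < y -> measurable_fun setT (Phi ^~ y).
Proof.
move=> y0; apply: continuous_measurable_fun => x.
exact: continuous_of_derive (hol_dPx holomorphic_pair_sqr x y0).
Qed.

Let wgt2_lty (C : R) : 0 <= C -> (\int[mu]_x (C * wgt x ^- 2)%:E < +oo)%E.
Proof.
move=> C0; rewrite ge0_integralZT//; last by move=> x; rewrite invr_ge0 sqr_ge0.
  have := integral_wgt2 (0 : R); under eq_integral do rewrite subr0.
  by move=> /le_lt_trans h; rewrite lte_mul_pinfty// h// ltry.
by rewrite /wgt; meas.
Qed.

Let mw (C : R) : measurable_fun setT (fun x : R => C * wgt x ^- 2).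
Proof. by rewrite /wgt; meas. Qed.

(** E is the x-derivative of Psi, which vanishes at both ends of the line. *)
Let integral_E (y : R) : 0 < y -> \int[mu]_x E x y = 0.
Proof.
move=> y0; have [C C0 hC] := sqr_decay y0.
pose h (n : nat) (x : R) := if `|x| <= n%:R then E x y else 0.
have h1 : \int[mu]_x h n x @[n --> \oo] --> \int[mu]_x E x y.
  apply: (@Rintegral_dominated _ _ _ (fun x => C * wgt x ^- 2)) => //.
  - by move=> n; have := mE y0; rewrite /h => mEy; meas.
  - move=> x; apply: cvg_near_cst; near=> n; rewrite /h ifT//.
    by near: n; exact: nbhs_infty_ger.
  - exact: wgt2_lty.
  - move=> n x; rewrite /h; have [_ _ hE] := hC x y (lexx y).
    by case: ifP => // _; rewrite normr0 (le_trans _ hE).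
have h2 : \int[mu]_x h n x @[n --> \oo] --> (0 : R).
  have hn n : `|\int[mu]_x h n x| <= 2 * C / n.+1%:R.
    rewrite /Rintegral (_ : (\int[mu]_x (h n x)%:E = (Psi n%:R y - Psi (- n%:R) y)%:E)%E) /=.
      have [_ p1 _] := hC n%:R y (lexx y); have [_ p2 _] := hC (- n%:R) y (lexx y).
      have wn : wgt (n%:R : R) = n.+1%:R by rewrite /wgt ger0_norm// -natr1 addrC.
      have wNn : wgt (- n%:R : R) = n.+1%:R by rewrite /wgt normrN ger0_norm// -natr1 addrC.
      rewrite wn in p1; rewrite wNn in p2.
      have m1 : (1 : R) <= n.+1%:R by rewrite ler1n.
      have : C / n.+1%:R ^+ 2 <= C / n.+1%:R.
        rewrite ler_wpM2l// lef_pV2 ?posrE ?exprn_gt0 ?ltr0n//.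
        by rewrite expr2 ler_peMr// (le_trans _ m1).
      move=> h2; rewrite (le_trans (ler_normB _ _))// (le_trans (lerD p1 p2))//.
      by rewrite -mulrA mulr_natl mulr2n lerD.
    rewrite (eq_integralR (g := fun x => (if `|x - 0| <= n%:R then E x y else 0)%:E)); last first.
      by move=> x _; rewrite subr0.
    rewrite integral_EFin_ifE set_ball_itv sub0r add0r.
    apply: (@FTC_is_derive _ (E ^~ y) (Psi ^~ y)) => [|x _|x _].
    - by rewrite (@le_trans _ _ 0)// oppr_le0.
    - exact: (hol_cQ' holomorphic_pair_sqr y0).
    - exact: (hol_dQx holomorphic_pair_sqr x y0).
  apply/norm_cvg0P; apply: (@squeeze_cvgr _ _ _ _ (fun=> 0) (fun n => 2 * C / n.+1%:R)).
  - by apply: nearW => n; rewrite normr_ge0/=; exact: hn.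
  - exact: cvg_cst.
  - rewrite -[X in _ --> X](mulr0 (2 * C)); apply: cvgM; first exact: cvg_cst.
    exact: cvg_harmonic.
by move: h1 => /cvg_lim <-//; apply/cvg_lim.
Unshelve. all: by end_near. Qed.

(** Cauchy's theorem for the square of a holomorphic function: by the
  Cauchy-Riemann equations the integral over a horizontal line does not depend on
  its height, and it tends to 0 as the height grows. *)
Lemma holomorphic_pair_integral0 (y : R) : 0 < y -> \int[mu]_x (P x y ^+ 2 - Q x y ^+ 2) = 0.
Proof.
move=> y0; pose I (y : R) := \int[mu]_x Phi x y.
have wn0 (x : R) : wgt x ^+ 2 != 0 by rewrite expf_neq0// gt_eqF// wgt_gt0.
have dI (z : R) : 0 < z -> is_derive z (1:R) I 0.
  move=> z0; have z20 : 0 < z / 2 by rewrite divr_gt0.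
  have [C C0 hC] := sqr_decay z20.
  have zab : z / 2 < z < z + 1 by apply/andP; split; lra.
  (* The weight (1 + |x|) ^ 2 is moved from the integrand to the measure, so that the
     kernel to differentiate is bounded. *)
  pose k (y x : R) := if 0 < y then Phi x y * wgt x ^+ 2 else 0.
  pose k' (y x : R) := - E x y * wgt x ^+ 2.
  have w2i : mu.-integrable setT (EFin \o (fun x : R => wgt x ^- 2)).
    apply: (@integrable_of_bound _ _ (fun x : R => 1 * wgt x ^- 2)) => //.
    - by rewrite /wgt; meas.
    - by move=> t; rewrite mul1r ger0_norm// invr_ge0 sqr_ge0.
    - exact: wgt2_lty.
  have mk y' : measurable_fun setT (k y').
    rewrite /k; case: ltP => [y'0|_]; last exact: measurable_cst.
    by have := mPhi y'0; rewrite /wgt => mPhiy; meas.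
  have bnd (a w : R) : 0 < w -> `|a| <= C * w^-1 -> `|a * w| <= C.
    by move=> w0 aw; rewrite normrM (gtr0_norm w0) -ler_pdivlMr.
  have w20 (x : R) : 0 < wgt x ^+ 2 by rewrite exprn_gt0// wgt_gt0.
  have kC (y' x : R) : z / 2 < y' < z + 1 -> `|k y' x| <= C.
    move=> /andP[zy' _]; rewrite /k ifT ?(lt_trans z20)//.
    by apply: bnd => //; have [] := hC x y' (ltW zy').
  have k'C (y' x : R) : z / 2 < y' < z + 1 -> `|k' y' x| <= C.
    move=> /andP[zy' _]; rewrite /k' mulNr normrN.
    by apply: bnd => //; have [] := hC x y' (ltW zy').
  have dk (y' x : R) : z / 2 < y' < z + 1 -> is_derive y' (1:R) (k ^~ x) (k' y' x).
    move=> /andP[zy' _]; have y'0 := lt_trans z20 zy'.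
    have d : is_derive y' (1:R) (fun y => (wgt x ^+ 2) *: Phi x y) (wgt x ^+ 2 *: - E x y').
      exact: (is_deriveZ _ (hol_dPy holomorphic_pair_sqr x y'0)).
    apply: (@near_eq_is_derive _ _ _ (fun y => (wgt x ^+ 2) *: Phi x y)).
    + near=> y''; rewrite /k ifT; first by rewrite mulrC.
      by near: y''; exact: lt_nbhsr.
    + by apply: (is_derive_eq d); rewrite /k' mulrC.
  have := parametric_derive w2i mk kC zab dk k'C.
  rewrite [X in is_derive _ _ _ X](_ : _ = 0); last first.
    have Ei : mu.-integrable setT (EFin \o (E ^~ z)).
      apply: (@integrable_of_bound _ _ (fun x => C * wgt x ^- 2)) => //.
      - exact: mE.
      - by move=> x; have [|] := hC x z; [lra|].
      - exact: wgt2_lty.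
    transitivity (\int[mu]_x (-1 * E x z)).
      by apply: eq_Rintegral => x _; rewrite /k' mulrC mulfK// mulN1r.
    by rewrite RintegralZl// integral_E// mulr0.
  move=> d; apply: (@near_eq_is_derive _ _ _ (fun y' => \int[mu]_x (wgt x ^- 2 * k y' x))) => //.
  near=> y''; rewrite /I; apply: eq_Rintegral => x _.
  rewrite /k ifT; last by near: y''; exact: lt_nbhsr.
  by rewrite mulrC mulfK.
have Icst (a b : R) : 0 < a -> a <= b -> I b = I a.
  move=> a0 ab; have [||c _] := @MVT_segment _ I (fun=> 0) a b ab.
  - by move=> x; rewrite in_itv/= => /andP[ax _]; apply: dI; exact: lt_trans ax.
  - apply: continuous_in_subspaceT => x; rewrite inE/= in_itv/= => /andP[ax _].
    by apply: continuous_of_derive (dI _ _); exact: lt_le_trans ax.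
  - by rewrite mul0r => /eqP; rewrite subr_eq0 => /eqP.
have h1 : \int[mu]_x Phi x n.+1%:R @[n --> \oo] --> \int[mu]_(x in [set: R]) (0 : R).
  have [C C0 hC] := sqr_decay ltr01.
  have [D hD] := hol_decay_y holomorphic_pair_sqr.
  apply: (@Rintegral_dominated _ _ _ (fun x => C * wgt x ^- 2)) => //.
  - by move=> n; exact: mPhi.
  - move=> x; apply/norm_cvg0P; apply: (@squeeze_cvgr _ _ _ _ (fun=> 0) (fun n => D / n.+1%:R)).
    + by apply: nearW => n; rewrite normr_ge0/=; have [] := hD x n.+1%:R; rewrite ?ler1n.
    + exact: cvg_cst.
    + rewrite -[X in _ --> X](mulr0 D); apply: cvgM; first exact: cvg_cst.
      exact: cvg_harmonic.
  - exact: wgt2_lty.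
  - by move=> n x; have [] := hC x n.+1%:R; rewrite ?ler1n.
rewrite Rintegral_cst// mul0r in h1.
have h2 : \int[mu]_x Phi x n.+1%:R @[n --> \oo] --> I y.
  apply: cvg_near_cst; near=> n; apply: Icst => //.
  by rewrite (@le_trans _ _ n%:R) ?ler_nat//; near: n; exact: nbhs_infty_ger.
by move: h1 => /cvg_lim <-//; apply/esym/cvg_lim.
Unshelve. all: by end_near. Qed.

End holomorphic_pairs.

(** * The Cauchy transform of a compactly supported function *)

Section cauchy_transform.
Context {R : realType}.
Local Notation mu := (@lebesgue_measure R).

Lemma is_derive_quot (a b : R -> R) (x da db : R) :
  is_derive x (1:R) a da -> is_derive x (1:R) b db -> b x != 0 ->
  is_derive x (1:R) (fun z => a z / b z) ((da * b x - a x * db) / b x ^+ 2).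
Proof.
move=> ha hb bx0; have hV := is_deriveV bx0 hb.
have := is_deriveM ha hV => h; apply: (is_derive_eq h).
by rewrite -![_ *: _]/(_ * _); field.
Qed.

(** The four kernels are the real and imaginary parts of 1 / (x - t + i y) and of its
  derivative -1 / (x - t + i y) ^ 2. *)
Definition kP (x y t : R) := (x - t) / ((x - t) ^+ 2 + y ^+ 2).
Definition kQ (x y t : R) := - y / ((x - t) ^+ 2 + y ^+ 2).
Definition kP' (x y t : R) := (y ^+ 2 - (x - t) ^+ 2) / ((x - t) ^+ 2 + y ^+ 2) ^+ 2.
Definition kQ' (x y t : R) := (2 * (x - t) * y) / ((x - t) ^+ 2 + y ^+ 2) ^+ 2.

Lemma denom_gt0 (u y : R) : 0 < y -> 0 < u ^+ 2 + y ^+ 2.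
Proof. by move=> y0; rewrite ltr_wpDl ?sqr_ge0// exprn_gt0. Qed.

Let denom_neq0 (u y : R) : 0 < y -> u ^+ 2 + y ^+ 2 != 0.
Proof. by move=> y0; rewrite gt_eqF// denom_gt0. Qed.

Lemma derive_kPx (x y t : R) : 0 < y -> is_derive x (1:R) (fun x => kP x y t) (kP' x y t).
Proof.
move=> y0; have d1 : is_derive x (1:R) (fun x : R => x - t) 1 by apply: is_derive_eq; ring.
have d2 : is_derive x (1:R) (fun x : R => (x - t) ^+ 2 + y ^+ 2) (2 * (x - t)).
  by apply: is_derive_eq; rewrite -![_ *: _]/(_ * _); ring.
apply: (is_derive_eq (is_derive_quot d1 d2 (denom_neq0 _ y0))).
by rewrite /kP'; congr (_ / _); ring.
Qed.

Lemma derive_kQx (x y t : R) : 0 < y -> is_derive x (1:R) (fun x => kQ x y t) (kQ' x y t).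
Proof.
move=> y0; have d1 : is_derive x (1:R) (fun x : R => - y) 0 by apply: is_derive_eq; ring.
have d2 : is_derive x (1:R) (fun x : R => (x - t) ^+ 2 + y ^+ 2) (2 * (x - t)).
  by apply: is_derive_eq; rewrite -![_ *: _]/(_ * _); ring.
apply: (is_derive_eq (is_derive_quot d1 d2 (denom_neq0 _ y0))).
by rewrite /kQ'; congr (_ / _); ring.
Qed.

Lemma derive_kPy (x y t : R) : 0 < y -> is_derive y (1:R) (fun y => kP x y t) (- kQ' x y t).
Proof.
move=> y0; have d1 : is_derive y (1:R) (fun y : R => x - t) 0 by apply: is_derive_eq; ring.
have d2 : is_derive y (1:R) (fun y : R => (x - t) ^+ 2 + y ^+ 2) (2 * y).
  by apply: is_derive_eq; rewrite -![_ *: _]/(_ * _); ring.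
apply: (is_derive_eq (is_derive_quot d1 d2 (denom_neq0 _ y0))).
by rewrite /kQ' -[RHS]mulNr; congr (_ / _); ring.
Qed.

Lemma derive_kQy (x y t : R) : 0 < y -> is_derive y (1:R) (fun y => kQ x y t) (kP' x y t).
Proof.
move=> y0; have d1 : is_derive y (1:R) (fun y : R => - y) (-1) by apply: is_derive_eq; ring.
have d2 : is_derive y (1:R) (fun y : R => (x - t) ^+ 2 + y ^+ 2) (2 * y).
  by apply: is_derive_eq; rewrite -![_ *: _]/(_ * _); ring.
apply: (is_derive_eq (is_derive_quot d1 d2 (denom_neq0 _ y0))).
by rewrite /kP'; congr (_ / _); ring.
Qed.

(** The first group gives boundedness and decay in y, the second, after comparing
  |x - t| with 1 + |x| for t in a bounded set, decay in x. *)
Lemma kernel_bounds (x y t : R) : 0 < y ->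
  [/\ `|kP x y t| <= y^-1, `|kQ x y t| <= y^-1,
      `|kP' x y t| <= y^-1 ^+ 2 & `|kQ' x y t| <= y^-1 ^+ 2] /\
  [/\ `|x - t| * `|kP x y t| <= 1, `|x - t| * `|kQ x y t| <= 1,
      `|x - t| * `|kP' x y t| <= y^-1 & `|x - t| * `|kQ' x y t| <= y^-1].
Proof.
move=> y0; rewrite /kP /kQ /kP' /kQ'; set u := x - t.
have D0 := denom_gt0 u y0; set D := u ^+ 2 + y ^+ 2 in D0 *.
have uE : u ^+ 2 = `|u| ^+ 2 by rewrite real_normK ?num_real.
have v0 : 0 <= `|u| by [].
have uyD : `|u| * y <= D by rewrite /D uE; have := sqr_ge0 (`|u| - y); nra.
have yyD : y * y <= D by rewrite /D -expr2 lerDr sqr_ge0.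
have uuD : `|u| * `|u| <= D by rewrite /D uE -expr2 lerDl sqr_ge0.
have D1 : D^-1 <= y^-1 ^+ 2 by rewrite exprVn lef_pV2 ?posrE ?exprn_gt0.
have p1 : `|(y ^+ 2 - u ^+ 2) / D ^+ 2| <= D^-1.
  rewrite normrM normfV (ger0_norm (sqr_ge0 D)) ler_pdivrMr ?exprn_gt0//.
  rewrite expr2 mulKf ?gt_eqF// ler_norml /D; apply/andP; split; nra.
have q1 : `|2 * u * y / D ^+ 2| <= D^-1.
  rewrite normrM normfV (ger0_norm (sqr_ge0 D)) ler_pdivrMr ?exprn_gt0//.
  rewrite expr2 mulKf ?gt_eqF// !normrM ger0_norm// (gtr0_norm y0) /D uE.
  by have := sqr_ge0 (`|u| - y); nra.
have uD : `|u| * D^-1 <= y^-1.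
  by rewrite ler_pdivrMr// mulrC ler_pdivlMr.
split; split.
- by rewrite normrM normfV (gtr0_norm D0) ler_pdivrMr// mulrC ler_pdivlMr.
- by rewrite normrM normrN normfV (gtr0_norm D0) (gtr0_norm y0) ler_pdivrMr// mulrC ler_pdivlMr.
- exact: le_trans p1 D1.
- exact: le_trans q1 D1.
- by rewrite normrM normfV (gtr0_norm D0) mulrA ler_pdivrMr// mul1r.
- by rewrite normrM normrN normfV (gtr0_norm D0) (gtr0_norm y0) mulrA ler_pdivrMr// mul1r.
- by apply: le_trans uD; rewrite ler_wpM2l.
- by apply: le_trans uD; rewrite ler_wpM2l.
Qed.

Variables (f : R -> R) (r0 : R).
Hypothesis fi : mu.-integrable setT (EFin \o f).
Hypothesis f_supp : forall t, r0 < `|t| -> f t = 0.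

Definition cauchy_re (x y : R) := \int[mu]_t (f t * kP x y t).
Definition cauchy_im (x y : R) := \int[mu]_t (f t * kQ x y t).

Let N : R := fine (\int[mu]_t `|f t|%:E)%E.

Let NE : (\int[mu]_t `|f t|%:E = N%:E)%E.
Proof.
rewrite /N fineK// ge0_fin_numE; last by apply: integralT_ge0.
exact: integrable_abs_lty.
Qed.

Let kernel_le (k : R -> R) (c : R) : measurable_fun setT k ->
  (forall t, `|t| <= r0 -> `|k t| <= c) -> 0 <= c -> `|\int[mu]_t (f t * k t)| <= N * c.
Proof.
move=> mk kc c0; have mf := integrable_meas fi.
have b t : `|f t * k t| <= c * `|f t|.
  have [tr|rt] := leP `|t| r0; last by rewrite f_supp// mul0r normr0 mulr0.
  by rewrite normrM mulrC ler_wpM2r// kc.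
have cN : (\int[mu]_t (c * `|f t|)%:E = (N * c)%:E)%E.
  by rewrite ge0_integralZT//; [rewrite NE -EFinM mulrC|meas].
apply: Rintegral_abs_le.
  apply: (@integrable_of_bound _ _ (fun t => c * `|f t|)) => //; try by meas.
  by rewrite cN ltry.
by rewrite -cN; apply: le_integralT => //; meas.
Qed.

Let m_kP x y : measurable_fun setT (kP x y). Proof. by rewrite /kP; meas. Qed.
Let m_kQ x y : measurable_fun setT (kQ x y). Proof. by rewrite /kQ; meas. Qed.
Let m_kP' x y : measurable_fun setT (kP' x y). Proof. by rewrite /kP'; meas. Qed.
Let m_kQ' x y : measurable_fun setT (kQ' x y). Proof. by rewrite /kQ'; meas. Qed.

Let kernel_bound (x y y0 t : R) : 0 < y0 -> y0 <= y ->
  [/\ `|kP x y t| <= y0^-1 + y0^-1 ^+ 2, `|kQ x y t| <= y0^-1 + y0^-1 ^+ 2,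
      `|kP' x y t| <= y0^-1 + y0^-1 ^+ 2 & `|kQ' x y t| <= y0^-1 + y0^-1 ^+ 2].
Proof.
move=> y00 y0y; have y_gt0 := lt_le_trans y00 y0y.
have v : y^-1 <= y0^-1 by rewrite lef_pV2.
have v0 : 0 <= y^-1 by rewrite invr_ge0 ltW.
have v2 : y^-1 ^+ 2 <= y0^-1 ^+ 2 by rewrite ler_sqr ?nnegrE// (le_trans v0).
have s0 := sqr_ge0 y0^-1; have [[p q p' q'] _] := kernel_bounds x t y_gt0.
by split; lra.
Qed.

Let kernel_decay (x y y0 t : R) : 0 < y0 -> y0 <= y -> `|t| <= r0 ->
  let c := ((1 + `|r0|) * (y0^-1 + y0^-1 ^+ 2) + (1 + y0^-1)) / wgt x in
  [/\ `|kP x y t| <= c, `|kQ x y t| <= c, `|kP' x y t| <= c & `|kQ' x y t| <= c].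
Proof.
move=> y00 y0y tr /=; have y_gt0 := lt_le_trans y00 y0y.
have [b1 b2 b3 b4] := kernel_bound x t y00 y0y.
have v : y^-1 <= y0^-1 by rewrite lef_pV2.
have [_ [p q p' q']] := kernel_bounds x t y_gt0.
have w : wgt x <= 1 + `|r0| + `|x - t|.
  have := ler_normD (x - t) t; rewrite subrK /wgt; have := ler_norm r0; lra.
have y0V : 0 <= y0^-1 by rewrite invr_ge0 ltW.
have gen (k : R) : `|k| <= y0^-1 + y0^-1 ^+ 2 -> `|x - t| * `|k| <= 1 + y0^-1 ->
    `|k| <= ((1 + `|r0|) * (y0^-1 + y0^-1 ^+ 2) + (1 + y0^-1)) / wgt x.
  move=> k1 k2; rewrite ler_pdivlMr ?wgt_gt0// mulrC.
  apply: (@le_trans _ _ ((1 + `|r0| + `|x - t|) * `|k|)); first by rewrite ler_wpM2r.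
  by rewrite mulrDl lerD// ler_wpM2l// addr_ge0.
by split; apply: gen => //; lra.
Qed.

Let sqr_cvg (z t : R) : (x - t) ^+ 2 @[x --> z] --> (z - t) ^+ 2.
Proof. by apply: (cvgM (f := fun x => x - t)); apply: cvgB; [exact: cvg_id|exact: cvg_cst|exact: cvg_id|exact: cvg_cst]. Qed.

Let denom_cvg (z t y : R) : 0 < y ->
  (((x - t) ^+ 2 + y ^+ 2) ^+ 2)^-1 @[x --> z] --> (((z - t) ^+ 2 + y ^+ 2) ^+ 2)^-1.
Proof.
move=> y0; apply: cvgV; first by rewrite expf_neq0// denom_neq0.
have h : ((x - t) ^+ 2 + y ^+ 2) @[x --> z] --> (z - t) ^+ 2 + y ^+ 2.
  by apply: cvgD; [exact: sqr_cvg|exact: cvg_cst].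
exact: (cvgM h h).
Qed.

Lemma cauchy_holomorphic_pair : holomorphic_pair cauchy_re cauchy_im
  (fun x y => \int[mu]_t (f t * kP' x y t)) (fun x y => \int[mu]_t (f t * kQ' x y t)).
Proof.
split.
- move=> x y y0; have xab : x - 1 < x < x + 1 by apply/andP; split; lra.
  have b z t := kernel_bound z t y0 (lexx y).
  exact: (@parametric_derive _ f (fun x => kP x y) (fun x => kP' x y) _ _ _ fi
    (fun z => m_kP z y) (fun z t _ => let: And4 p _ _ _ := b z t in p) x xab
    (fun z t _ => derive_kPx z t y0) (fun z t _ => let: And4 _ _ p _ := b z t in p)).
- move=> x y y0; have xab : x - 1 < x < x + 1 by apply/andP; split; lra.
  have b z t := kernel_bound z t y0 (lexx y).
  exact: (@parametric_derive _ f (fun x => kQ x y) (fun x => kQ' x y) _ _ _ fi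
    (fun z => m_kQ z y) (fun z t _ => let: And4 _ p _ _ := b z t in p) x xab
    (fun z t _ => derive_kQx z t y0) (fun z t _ => let: And4 _ _ _ p := b z t in p)).
- move=> x y y0; have y20 : 0 < y / 2 by rewrite divr_gt0.
  have yab : y / 2 < y < y + 1 by apply/andP; split; lra.
  have b z t (h : y / 2 < z < y + 1) := kernel_bound x t y20 (ltW (proj1 (andP h))).
  have z0 z (h : y / 2 < z < y + 1) := lt_trans y20 (proj1 (andP h)).
  have Nb z t (h : y / 2 < z < y + 1) : `|- kQ' x z t| <= (y / 2)^-1 + (y / 2)^-1 ^+ 2.
    by rewrite normrN; have [] := b z t h.
  have d := @parametric_derive _ f (kP x) (fun z t => - kQ' x z t) _ _ _ fi
    (m_kP x) (fun z t h => let: And4 p _ _ _ := b z t h in p) y yab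
    (fun z t h => derive_kPy x t (z0 z h)) Nb.
  apply: (is_derive_eq d); transitivity (\int[mu]_t (-1 * (f t * kQ' x y t))).
    by apply: eq_Rintegral => t _; rewrite mulrN mulN1r.
  rewrite RintegralZl// ?mulN1r//.
  exact: (@parametric_integrable _ f (kQ' x) _ _ _ fi (m_kQ' x) (fun z t h => let: And4 _ _ _ p := b z t h in p) y yab).
- move=> x y y0; have y20 : 0 < y / 2 by rewrite divr_gt0.
  have yab : y / 2 < y < y + 1 by apply/andP; split; lra.
  have b z t (h : y / 2 < z < y + 1) := kernel_bound x t y20 (ltW (proj1 (andP h))).
  have z0 z (h : y / 2 < z < y + 1) := lt_trans y20 (proj1 (andP h)).
  exact: (@parametric_derive _ f (kQ x) (kP' x) _ _ _ fi
    (m_kQ x) (fun z t h => let: And4 _ p _ _ := b z t h in p) y yab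
    (fun z t h => derive_kQy x t (z0 z h)) (fun z t h => let: And4 _ _ p _ := b z t h in p)).
- move=> x y y0; have xab : x - 1 < x < x + 1 by apply/andP; split; lra.
  have b z t := kernel_bound z t y0 (lexx y).
  apply: (@parametric_continuous _ f (fun x => kP' x y) _ _ _ fi
    (fun z => m_kP' z y) (fun z t _ => let: And4 _ _ p _ := b z t in p) x xab) => z t _.
  apply: cvgM; first by apply: cvgB; [exact: cvg_cst|exact: sqr_cvg].
  exact: denom_cvg.
- move=> x y y0; have xab : x - 1 < x < x + 1 by apply/andP; split; lra.
  have b z t := kernel_bound z t y0 (lexx y).
  apply: (@parametric_continuous _ f (fun x => kQ' x y) _ _ _ fi
    (fun z => m_kQ' z y) (fun z t _ => let: And4 _ _ _ p := b z t in p) x xab) => z t _.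
  apply: cvgM; last exact: denom_cvg.
  apply: cvgM; last exact: cvg_cst.
  by apply: cvgM; [exact: cvg_cst|apply: cvgB; [exact: cvg_id|exact: cvg_cst]].
- move=> y0 y00; exists (N * ((1 + `|r0|) * (y0^-1 + y0^-1 ^+ 2) + (1 + y0^-1))) => x y y0y.
  have c0 : 0 <= ((1 + `|r0|) * (y0^-1 + y0^-1 ^+ 2) + (1 + y0^-1)) / wgt x.
    have y0V : 0 <= y0^-1 by rewrite invr_ge0 ltW.
    by rewrite divr_ge0 ?(ltW (wgt_gt0 _))// !addr_ge0// mulr_ge0 ?addr_ge0 ?sqr_ge0.
  rewrite -!mulrA.
  by split; apply: kernel_le => // t tr; have [] := kernel_decay x y00 y0y tr.
- exists N => x y y1; have y0 := lt_le_trans ltr01 y1.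
  have yV : 0 <= y^-1 by rewrite invr_ge0 ltW.
  by split; apply: kernel_le => // t _; have [[]] := kernel_bounds x t y0.
Qed.

Let H := cauchy_holomorphic_pair.

Let int_pow (g : R -> R -> R) (y : R) (n : nat) : (forall x, {for x, continuous (g^~ y)}) ->
  (exists C, forall x, `|g x y| <= C / wgt x) -> (2 <= n)%N ->
  mu.-integrable setT (EFin \o (fun x => g x y ^+ n)).
Proof.
move=> cg [C gC] n2; have mg : measurable_fun setT (g ^~ y) by exact: continuous_measurable_fun.
have C0 : 0 <= C.
  by rewrite -(pmulr_lge0 _ (_ : 0 < (wgt 0)^-1)) ?invr_gt0 ?wgt_gt0// (le_trans _ (gC 0)).
apply: (@integrable_of_bound _ _ (fun x => C ^+ n * wgt x ^- 2)).
- exact: measurable_funX.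
- by rewrite /wgt; meas.
- move=> x; rewrite normrX (le_trans (lerXn2r n _ _ (gC x))) ?nnegrE//.
    by rewrite divr_ge0// ltW// wgt_gt0.
  rewrite expr_div_n ler_wpM2l ?exprn_ge0// lef_pV2 ?posrE ?exprn_gt0 ?wgt_gt0//.
  by rewrite ler_weXn2l// wgt_ge1.
- rewrite ge0_integralZT ?exprn_ge0//; [|by rewrite /wgt; meas|by move=> x; rewrite invr_ge0 sqr_ge0].
  have := integral_wgt2 (0 : R); under eq_integral do rewrite subr0.
  by move=> /le_lt_trans h; rewrite lte_mul_pinfty ?lee_fin ?exprn_ge0// h// ltry.
Qed.

Let cont_re (x y : R) : 0 < y -> {for x, continuous (cauchy_re ^~ y)}.
Proof. by move=> y0; have [d _] := hol_dPx H x y0; exact/differentiable_continuous/derivable1_diffP. Qed.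

Let cont_im (x y : R) : 0 < y -> {for x, continuous (cauchy_im ^~ y)}.
Proof. by move=> y0; have [d _] := hol_dQx H x y0; exact/differentiable_continuous/derivable1_diffP. Qed.

Let int_re n (y : R) : 0 < y -> (2 <= n)%N -> mu.-integrable setT (EFin \o (fun x => cauchy_re x y ^+ n)).
Proof.
move=> y0; apply: int_pow => [x|]; first exact: cont_re.
by have [C hC] := hol_decay H y0; exists C => x; have [] := hC x y (lexx y).
Qed.

Let int_im n (y : R) : 0 < y -> (2 <= n)%N -> mu.-integrable setT (EFin \o (fun x => cauchy_im x y ^+ n)).
Proof.
move=> y0; apply: int_pow => [x|]; first exact: cont_im.
by have [C hC] := hol_decay H y0; exists C => x; have [] := hC x y (lexx y).
Qed.

Lemma measurable_cauchy_re (y : R) : 0 < y -> measurable_fun setT (cauchy_re ^~ y).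
Proof. by move=> y0; apply: continuous_measurable_fun => x; exact: cont_re. Qed.

Lemma measurable_cauchy_im (y : R) : 0 < y -> measurable_fun setT (cauchy_im ^~ y).
Proof. by move=> y0; apply: continuous_measurable_fun => x; exact: cont_im. Qed.

(** The integral of the real part a ^ 2 - b ^ 2 of F ^ 2 = (a + i b) ^ 2 vanishes. *)
Lemma cauchy_re_L2 (y : R) : 0 < y ->
  (\int[mu]_x (cauchy_re x y ^+ 2)%:E <= \int[mu]_x (cauchy_im x y ^+ 2)%:E)%E.
Proof.
move=> y0; have h := holomorphic_pair_integral0 H y0.
have ire := int_re y0 (isT : (2 <= 2)%N); have iim := int_im y0 (isT : (2 <= 2)%N).
rewrite RintegralB// in h; rewrite -!Rintegral_EFin// lee_fin.
by move/eqP: h; rewrite subr_eq0 => /eqP ->.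
Qed.

(** The integral of Re (F ^ 4) = a ^ 4 - 6 a ^ 2 b ^ 2 + b ^ 4 vanishes, and
  2 Re (F ^ 4) + 34 b ^ 4 - a ^ 4 = (a ^ 2 - 6 b ^ 2) ^ 2 is nonnegative. *)
Lemma cauchy_re_L4 (y : R) : 0 < y ->
  (\int[mu]_x (cauchy_re x y ^+ 4)%:E <= 34%:E * \int[mu]_x (cauchy_im x y ^+ 4)%:E)%E.
Proof.
move=> y0; have h := holomorphic_pair_integral0 (holomorphic_pair_sqr H) y0.
have mre := measurable_cauchy_re y0; have mim := measurable_cauchy_im y0.
have ire := int_re y0 (isT : (2 <= 4)%N); have iim := int_im y0 (isT : (2 <= 4)%N).
pose G (x : R) := (cauchy_re x y ^+ 2 - cauchy_im x y ^+ 2) ^+ 2 - (2 * (cauchy_re x y * cauchy_im x y)) ^+ 2.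
have Gle x : cauchy_re x y ^+ 4 <= 2 * G x + 34 * cauchy_im x y ^+ 4.
  rewrite /G; set a := cauchy_re x y; set b := cauchy_im x y.
  have := sqr_ge0 (a ^+ 2 - 6 * b ^+ 2).
  rewrite -subr_ge0 => h0.
  rewrite -subr_ge0 (_ : _ - _ = (a ^+ 2 - 6 * b ^+ 2) ^+ 2 + 0 * b ^+ 4); last by ring.
  by rewrite mul0r addr0 sqr_ge0.
have iG : mu.-integrable setT (EFin \o G).
  have i3 := integrableD measurableT (integrableZl measurableT 7 ire) (integrableZl measurableT 7 iim).
  apply: (@integrable_of_bound _ _ (fun x => 7 * cauchy_re x y ^+ 4 + 7 * cauchy_im x y ^+ 4)).
  - by rewrite /G; meas.
  - by meas.
  - move=> x; rewrite /G; set a := cauchy_re x y; set b := cauchy_im x y.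
    have a4 : 0 <= a ^+ 4 by rewrite (exprM a 2 2) sqr_ge0.
    have b4 : 0 <= b ^+ 4 by rewrite (exprM b 2 2) sqr_ge0.
    have := sqr_ge0 (a ^+ 2 - b ^+ 2); have := sqr_ge0 (a ^+ 2 + b ^+ 2).
    by rewrite ler_norml => h1 h2; apply/andP; split; nra.
  - have /integrable_lty := i3; rewrite /= => /(_ measurableT).
    by under eq_integral do rewrite -!EFinM -EFinD.
have i2 : mu.-integrable setT (EFin \o (fun x => 2 * G x)).
  exact: (integrableZl measurableT 2 iG).
have i34 : mu.-integrable setT (EFin \o (fun x => 34 * cauchy_im x y ^+ 4)).
  exact: (integrableZl measurableT 34 iim).
rewrite -!Rintegral_EFin// -EFinM lee_fin.
apply: (@le_trans _ _ (\int[mu]_x (2 * G x + 34 * cauchy_im x y ^+ 4))).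
  apply: le_Rintegral => //.
  exact: (integrableD measurableT i2 i34).
by rewrite RintegralD// RintegralZl// RintegralZl// h mulr0 add0r.
Qed.

End cauchy_transform.

(** * Truncated Hilbert transforms of compactly supported functions *)

Section parametrized_integrals.
Context {R : realType}.
Local Notation mu := (@lebesgue_measure R).

Lemma measurable_integral_param (F : R -> R -> R) :
  measurable_fun setT (fun z : R * R => F z.1 z.2) -> (forall x t, 0 <= F x t) ->
  measurable_fun setT (fun x => \int[mu]_t (F x t)%:E)%E.
Proof.
move=> mF F0; apply: (@measurable_fun_fubini_tonelli_F _ _ _ _ _ mu (fun z : R * R => (F z.1 z.2)%:E)).
- exact: measurable_EFin.
- by move=> z; rewrite lee_fin.
Qed.

Lemma measurable_Rintegral_param (F : R -> R -> R) :
  measurable_fun setT (fun z : R * R => F z.1 z.2) ->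
  measurable_fun setT (fun x => \int[mu]_t F x t).
Proof.
move=> mF; rewrite /Rintegral.
apply: (measurableT_comp (fine_measurable measurableT)).
rewrite (_ : (fun x => _) = (fun x => (\int[mu]_t (Num.max (F x t) 0)%:E - \int[mu]_t (Num.max (- F x t) 0)%:E)%E)); last first.
  apply/funext => x; rewrite integralE; congr (_ - _)%E.
  - by apply: eq_integralR => t _; rewrite funeposE EFin_max.
  - by apply: eq_integralR => t _; rewrite funenegE -EFinN EFin_max.
apply: emeasurable_funB.
- apply: measurable_integral_param; first by meas.
  by move=> x t; rewrite le_max lexx orbT.
- apply: measurable_integral_param; first by meas.
  by move=> x t; rewrite le_max lexx orbT.
Qed.

(** After the exchange of integrals the kernel is integrated in the variable where
  its mass is bounded. *)
Lemma tonelli_le (k : R -> R -> R) (g b : R -> R) :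
  measurable_fun setT (fun z : R * R => k z.1 z.2) -> measurable_fun setT g ->
  measurable_fun setT b ->
  (forall x t, 0 <= k x t) -> (forall t, 0 <= g t) ->
  (forall t, (\int[mu]_x (k x t)%:E <= (b t)%:E)%E) ->
  (\int[mu]_x \int[mu]_t (k x t * g t)%:E <= \int[mu]_t (b t * g t)%:E)%E.
Proof.
move=> mk mg mb k0 g0 kb.
have b0 t : 0 <= b t by rewrite -lee_fin (le_trans _ (kb t))// integralT_ge0.
have mkt t : measurable_fun setT (fun x => k x t).
  exact: (measurableT_comp mk (pair2_measurable t)).
rewrite (@fubini_tonelli _ _ _ _ _ mu mu (fun z : R * R => (k z.1 z.2 * g z.2)%:E))/=.
- apply: ge0_le_integralT.
  + apply: (@measurable_fun_fubini_tonelli_G _ _ _ _ _ mu (fun z : R * R => (k z.1 z.2 * g z.2)%:E)).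
    * by meas.
    * by move=> z; rewrite lee_fin mulr_ge0.
  + by meas.
  + by move=> t; apply: integralT_ge0 => x; rewrite mulr_ge0.
  + move=> t; under eq_integral do rewrite mulrC.
    by rewrite ge0_integralZT// EFinM muleC lee_wpmul2r// lee_fin.
- by meas.
- by move=> z; rewrite lee_fin mulr_ge0.
Qed.

End parametrized_integrals.

Section truncated_hilbert_transform.
Context {R : realType}.
Local Notation mu := (@lebesgue_measure R).
Implicit Types (f g : R -> R).

Definition pkernel (y x t : R) : R := y / ((t - x) ^+ 2 + y ^+ 2).

Definition tkernel (e u : R) : R := if e < `|u| then u^-1 else 0.

Definition trunc_hilbert (e : R) f (x : R) : R := \int[mu]_t (f t * tkernel e (t - x)).

Lemma measurable_trunc_hilbert e f : measurable_fun setT f ->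
  measurable_fun setT (trunc_hilbert e f).
Proof.
move=> mf; apply: measurable_Rintegral_param; rewrite /tkernel; meas.
Qed.

Lemma pkernel_ge0 (y x t : R) : 0 < y -> 0 <= pkernel y x t.
Proof. by move=> y0; rewrite /pkernel divr_ge0// ltW// denom_gt0. Qed.

Lemma pkernelC (y x t : R) : pkernel y x t = pkernel y t x.
Proof. by rewrite /pkernel -sqrrN opprB. Qed.

Lemma measurable_pkernel (y x : R) : measurable_fun setT (pkernel y x).
Proof. by rewrite /pkernel; meas. Qed.

Lemma integral_pkernel (y x : R) : 0 < y -> (\int[mu]_t (pkernel y x t)%:E <= 10%:E)%E.
Proof. exact: poisson_kernel_mass. Qed.

Definition poisson (y : R) f (x : R) : \bar R := (\int[mu]_t (pkernel y x t * `|f t|)%:E)%E.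

Lemma poisson_ge0 (y x : R) f : 0 < y -> (0 <= poisson y f x)%E.
Proof. by move=> y0; apply: integralT_ge0 => t; rewrite mulr_ge0// pkernel_ge0. Qed.

Let mk (y : R) : measurable_fun setT (fun z : R * R => pkernel y z.1 z.2).
Proof. by rewrite /pkernel; meas. Qed.

Lemma measurable_poisson (y : R) f : 0 < y -> measurable_fun setT f ->
  measurable_fun setT (poisson y f).
Proof.
move=> y0 mf; apply: measurable_integral_param; first by have := mk y => mky; meas.
by move=> x t; rewrite mulr_ge0// pkernel_ge0.
Qed.

Let measurable_ereal_sqr (F : R -> \bar R) : measurable_fun setT F ->
  measurable_fun setT (fun x => F x ^+ 2)%E.
Proof. by move=> mF; exact: emeasurable_funM. Qed.

Let integral_poisson (y : R) g : 0 < y -> measurable_fun setT g -> (forall t, 0 <= g t) ->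
  (\int[mu]_x \int[mu]_t (pkernel y x t * g t)%:E <= 10%:E * \int[mu]_t (g t)%:E)%E.
Proof.
move=> y0 mg g0; rewrite -ge0_integralZT//.
apply: (@tonelli_le _ _ _ (fun=> 10)) => //.
- by move=> x t; exact: pkernel_ge0.
- by move=> t; under eq_integral do rewrite pkernelC; exact: integral_pkernel.
Qed.

Let esqr_le (a b : \bar R) : (0 <= a)%E -> (a <= b)%E -> (a ^+ 2 <= b ^+ 2)%E.
Proof. by move=> a0 ab; rewrite !expe2 lee_pmul. Qed.

Lemma poisson_sqr_le (y x : R) f : 0 < y -> measurable_fun setT f ->
  ((poisson y f x) ^+ 2 <= 10%:E * poisson y (fun t => f t ^+ 2)%R x)%E.
Proof.
move=> y0 mf.
have := @cauchy_schwarz _ (pkernel y x) (fun t => `|f t|) 10 (measurable_pkernel y x)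
  (measurableT_comp (@normr_measurable _ _) mf) (fun t => pkernel_ge0 x t y0)
  (fun t => normr_ge0 _) (ltr0Sn _ _) (integral_pkernel x y0).
rewrite /poisson; congr (is_true (_ <= _ * _)%E).
by apply: eq_integralR => t _; rewrite normrX.
Qed.

(** The kernel has mass at most 10 in each variable; one factor comes from
  Cauchy-Schwarz, the other from exchanging the integrals. *)
Lemma poisson_L2 (y : R) f : 0 < y -> measurable_fun setT f ->
  (\int[mu]_x (poisson y f x) ^+ 2 <= 100%:E * \int[mu]_x (f x ^+ 2)%:E)%E.
Proof.
move=> y0 mf; have mf2 : measurable_fun setT (fun x => f x ^+ 2) by meas.
apply: (@le_trans _ _ (\int[mu]_x (10%:E * poisson y (fun t => f t ^+ 2)%R x))%E).
  apply: ge0_le_integralT.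
  - by apply: measurable_ereal_sqr; exact: measurable_poisson.
  - by apply: measurable_funeM; exact: measurable_poisson.
  - by move=> x; rewrite expe_ge0// poisson_ge0.
  - by move=> x; exact: poisson_sqr_le.
rewrite ge0_integralZl//.
- rewrite (_ : 100%:E = 10%:E * 10%:E)%E; last by rewrite -EFinM; congr EFin; ring.
  rewrite -muleA lee_wpmul2l//.
  under [X in (_ <= _ * X)%E]eq_integral do rewrite -(ger0_norm (sqr_ge0 _)).
  by apply: integral_poisson => //; exact: measurableT_comp.
- exact: measurable_poisson.
- by move=> x _; exact: poisson_ge0.
Qed.

(** Apply the L^2 bound to f ^ 2, whose Poisson integral bounds the square. *)
Lemma poisson_L4 (y : R) f : 0 < y -> measurable_fun setT f ->
  (\int[mu]_x (poisson y f x) ^+ 4 <= (100 * 100)%:E * \int[mu]_x (f x ^+ 4)%:E)%E.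
Proof.
move=> y0 mf; have mf2 : measurable_fun setT (fun x => f x ^+ 2) by meas.
have p0 g x : (0 <= poisson y g x)%E by exact: poisson_ge0.
have p4 x : (poisson y f x ^+ 4 = (poisson y f x ^+ 2) ^+ 2)%E.
  by rewrite !expeS !expe0 !mule1 -!muleA.
apply: (@le_trans _ _ (\int[mu]_x (100%:E * poisson y (fun t => f t ^+ 2)%R x ^+ 2))%E).
  apply: ge0_le_integralT.
  - under eq_fun do rewrite p4.
    by do 2 apply: measurable_ereal_sqr; exact: measurable_poisson.
  - by apply: measurable_funeM; apply: measurable_ereal_sqr; exact: measurable_poisson.
  - by move=> x; rewrite expe_ge0.
  - move=> x; rewrite p4.
    apply: (@le_trans _ _ ((10%:E * poisson y (fun t => f t ^+ 2)%R x) ^+ 2)%E).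
      have h := poisson_sqr_le x y0 mf.
      by apply: esqr_le => //; rewrite expe_ge0.
    rewrite !expe2 muleACA -EFinM (_ : 10 * 10 = 100 :> R)//; ring.
rewrite ge0_integralZl//.
- rewrite EFinM -muleA lee_wpmul2l//.
  apply: le_trans (poisson_L2 y0 mf2) _.
  rewrite le_eqVlt; apply/orP; left; apply/eqP; congr (_ * _)%E.
  by apply: eq_integralR => t _; rewrite -exprM.
- by apply: measurable_ereal_sqr; exact: measurable_poisson.
- by move=> x _; rewrite expe_ge0.
Qed.

Section compact_support.
Variables (f : R -> R) (r0 e : R).
Hypothesis fi : mu.-integrable setT (EFin \o f).
Hypothesis f_supp : forall t, r0 < `|t| -> f t = 0.
Hypothesis e0 : 0 < e.

Let mf : measurable_fun setT f := integrable_meas fi.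

(** Beyond distance e, 1 / u differs from u / (u ^ 2 + e ^ 2) by
  (e / u) e / (u ^ 2 + e ^ 2); below e the conjugate kernel itself is smaller than
  the Poisson kernel. The sum appears because kP has x - t where the truncated
  kernel has t - x. *)
Let tkernel_conjugate (x t : R) : `|tkernel e (t - x) + kP x e t| <= pkernel e x t.
Proof.
have D0 := denom_gt0 (t - x) e0.
rewrite /tkernel /kP /pkernel -(opprB t x) sqrrN; set u := t - x in D0 *.
set D := u ^+ 2 + e ^+ 2 in D0 *.
case: ltP => eu.
  have u0 : u != 0 by rewrite -normr_gt0 (lt_trans e0).
  have -> : u^-1 + - u / D = (e / u) * (e / D) by rewrite /D; field; rewrite u0 -/D gt_eqF.
  rewrite normrM (ger0_norm (divr_ge0 (ltW e0) (ltW D0))) ler_piMl ?divr_ge0 ?(ltW e0) ?(ltW D0)//.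
  by rewrite normrM normfV (gtr0_norm e0) ler_pdivrMr ?normr_gt0// mul1r ltW.
rewrite add0r normrM normrN normfV (gtr0_norm D0) ler_wpM2r// invr_ge0 ltW//.
Qed.

Let bounded_kernel_integrable (k : R -> R) (c : R) : measurable_fun setT k ->
  (forall t, `|k t| <= c) -> mu.-integrable setT (EFin \o (fun t => f t * k t)).
Proof.
move=> mk' kc; have c0 : 0 <= c by exact: le_trans (kc 0).
apply: (@integrable_of_bound _ _ (fun t => c * `|f t|)); try by meas.
  by move=> t; rewrite normrM mulrC ler_wpM2r.
rewrite ge0_integralZT//; last by meas.
by rewrite lte_mul_pinfty// integrable_abs_lty.
Qed.

Let int_tk x : mu.-integrable setT (EFin \o (fun t => f t * tkernel e (t - x))).
Proof.
apply: (@bounded_kernel_integrable _ e^-1) => [|t]; first by rewrite /tkernel; meas.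
rewrite /tkernel; case: ltP => h; last by rewrite normr0 invr_ge0 ltW.
by rewrite normfV lef_pV2 ?posrE//; [exact: ltW|exact: lt_trans h].
Qed.

Let int_kP x : mu.-integrable setT (EFin \o (fun t => f t * kP x e t)).
Proof.
apply: (@bounded_kernel_integrable _ e^-1) => [|t]; first by rewrite /kP; meas.
by have [[]] := kernel_bounds x t e0.
Qed.

Let trunc_cauchy_le x : (`|trunc_hilbert e f x + cauchy_re f x e|%:E <= poisson e f x)%E.
Proof.
rewrite /trunc_hilbert /cauchy_re -RintegralD//.
rewrite EFin_normr_Rintegral//; last exact: (integrableD measurableT (int_tk x) (int_kP x)).
apply: (le_trans (le_abse_integral _ _ _)) => //.
  by apply: measurable_EFin; rewrite /tkernel /kP; meas.
apply: le_integralT => [| |t|t].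
- by rewrite /tkernel /kP; meas.
- by rewrite /pkernel; meas.
- by [].
- by rewrite -mulrDr normrM mulrC ler_wpM2r.
Qed.

Let cauchy_im_le x : (`|cauchy_im f x e|%:E <= poisson e f x)%E.
Proof.
have b t : `|kQ x e t| <= e^-1 by have [[]] := kernel_bounds x t e0.
rewrite /cauchy_im EFin_normr_Rintegral//; last first.
  by apply: (@bounded_kernel_integrable _ e^-1) => //; rewrite /kQ; meas.
apply: (le_trans (le_abse_integral _ _ _)) => //.
  by apply: measurable_EFin; rewrite /kQ; meas.
apply: le_integralT => [| |t|t].
- by rewrite /kQ; meas.
- by rewrite /pkernel; meas.
- by [].
- rewrite normrM mulrC ler_wpM2r// /kQ /pkernel -(opprB t x) sqrrN.
  rewrite normrM normrN normfV (gtr0_norm e0) gtr0_norm// denom_gt0//.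
Qed.

Let mre := measurable_cauchy_re fi f_supp e0.
Let mim := measurable_cauchy_im fi f_supp e0.

Lemma trunc_hilbert_compact_L2 :
  (\int[mu]_x (trunc_hilbert e f x ^+ 2)%:E <= 400%:E * \int[mu]_x (f x ^+ 2)%:E)%E.
Proof.
have mT := measurable_trunc_hilbert e mf.
pose S x := trunc_hilbert e f x + cauchy_re f x e.
have mS : measurable_fun setT S by rewrite /S; meas.
have sqr_le (g : R -> R) : measurable_fun setT g -> (forall x, (`|g x|%:E <= poisson e f x)%E) ->
    (\int[mu]_x (g x ^+ 2)%:E <= 100%:E * \int[mu]_x (f x ^+ 2)%:E)%E.
  move=> mg gp; apply: le_trans (poisson_L2 e0 mf).
  apply: ge0_le_integralT; first by meas.
  - by apply: measurable_ereal_sqr; exact: measurable_poisson.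
  - by move=> x; rewrite lee_fin sqr_ge0.
  - move=> x; by rewrite -(real_normK (num_real (g x))) EFin_expe; apply: esqr_le.
apply: (@le_trans _ _ (\int[mu]_x (2 * S x ^+ 2 + 2 * cauchy_re f x e ^+ 2)%:E)%E).
  apply: le_integralT => [| |x|x]; try by meas.
    by rewrite sqr_ge0.
  rewrite -subr_ge0 /S; set a := trunc_hilbert e f x; set b := cauchy_re f x e.
  rewrite (_ : _ - _ = (a + 2 * b) ^+ 2) ?sqr_ge0//; ring.
rewrite ge0_integralDT; try by meas.
- rewrite !ge0_integralZT//; try by meas.
  + apply: (@le_trans _ _ (2%:E * (100%:E * \int[mu]_x (f x ^+ 2)%:E) + 2%:E * (100%:E * \int[mu]_x (f x ^+ 2)%:E))%E).
      apply: leeD; rewrite lee_wpmul2l//; first exact: sqr_le.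
      exact: le_trans (cauchy_re_L2 fi f_supp e0) (sqr_le _ mim cauchy_im_le).
    rewrite !muleA -ge0_muleDl -?EFinM ?lee_fin//.
    by rewrite -EFinD (_ : 2 * 100 + 2 * 100 = 400 :> R)//; ring.
  + by move=> x; rewrite sqr_ge0.
  + by move=> x; rewrite sqr_ge0.
- by move=> x; rewrite mulr_ge0// sqr_ge0.
- by move=> x; rewrite mulr_ge0// sqr_ge0.
Qed.

Lemma trunc_hilbert_compact_L4 :
  (\int[mu]_x (trunc_hilbert e f x ^+ 4)%:E <= (8 * (100 * 100) + 8 * (34 * (100 * 100)))%:E * \int[mu]_x (f x ^+ 4)%:E)%E.
Proof.
have mT := measurable_trunc_hilbert e mf.
have pow4_ge0 (a : R) : 0 <= a ^+ 4 by rewrite (exprM a 2 2) sqr_ge0.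
pose S x := trunc_hilbert e f x + cauchy_re f x e.
have mS : measurable_fun setT S by rewrite /S; meas.
have pow_le (g : R -> R) : measurable_fun setT g -> (forall x, (`|g x|%:E <= poisson e f x)%E) ->
    (\int[mu]_x (g x ^+ 4)%:E <= (100 * 100)%:E * \int[mu]_x (f x ^+ 4)%:E)%E.
  move=> mg gp; apply: le_trans (poisson_L4 e0 mf).
  have p4 (z : \bar R) : (z ^+ 4 = (z ^+ 2) ^+ 2)%E.
    by rewrite !expeS !expe0 !mule1 -!muleA.
  apply: ge0_le_integralT; first by meas.
  - under eq_fun do rewrite p4.
    by do 2 apply: measurable_ereal_sqr; exact: measurable_poisson.
  - by move=> x; rewrite lee_fin.
  - move=> x; rewrite (exprM _ 2 2) -(real_normK (num_real (g x))) -exprM EFin_expe !p4.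
    by apply: esqr_le; [rewrite expe_ge0|apply: esqr_le].
apply: (@le_trans _ _ (\int[mu]_x (8 * S x ^+ 4 + 8 * cauchy_re f x e ^+ 4)%:E)%E).
  apply: le_integralT => [| |x|x]; try by meas.
  rewrite -subr_ge0 /S; set a := trunc_hilbert e f x; set b := cauchy_re f x e.
  have -> : 8 * (a + b) ^+ 4 + 8 * b ^+ 4 - a ^+ 4 =
     (a + 2 * b) ^+ 2 * (7 * a ^+ 2 + 4 * a * b + 4 * b ^+ 2) by ring.
  rewrite mulr_ge0 ?sqr_ge0//.
  have -> : 7 * a ^+ 2 + 4 * a * b + 4 * b ^+ 2 = 6 * a ^+ 2 + (a + 2 * b) ^+ 2 by ring.
  by rewrite addr_ge0 ?sqr_ge0// mulr_ge0// sqr_ge0.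
rewrite ge0_integralDT; try by meas.
- rewrite !ge0_integralZT//; try by meas.
  apply: (@le_trans _ _ (8%:E * ((100 * 100)%:E * \int[mu]_x (f x ^+ 4)%:E) + 8%:E * (34%:E * ((100 * 100)%:E * \int[mu]_x (f x ^+ 4)%:E)))%E).
    apply: leeD; rewrite lee_wpmul2l//; first exact: pow_le.
    apply: le_trans (cauchy_re_L4 fi f_supp e0) _.
    by rewrite lee_wpmul2l// pow_le.
  rewrite !muleA -ge0_muleDl -?EFinM ?lee_fin//.
  by rewrite -EFinD -(mulrA 8 34).
- by move=> x; rewrite mulr_ge0.
- by move=> x; rewrite mulr_ge0.
Qed.

End compact_support.

End truncated_hilbert_transform.

(** * Truncated Hilbert transforms in L^2 and L^4 *)

Section integrability_away_from_the_diagonal.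
Context {R : realType}.
Local Notation mu := (@lebesgue_measure R).
Implicit Types (f g : R -> R).

(** Young's inequality; the exponent conjugate to p lies between 4 / 3 and 2. *)
Lemma young_uniform (v c p : R) : 0 <= v -> 0 < c -> 2 <= p <= 4 ->
  v * c <= v `^ p + (c `^ (4 / 3) + c ^+ 2).
Proof.
move=> v0 c0 /andP[p2 p4].
have p1 : 0 < p - 1 by lra.
have vp : 0 <= v `^ p by exact: powR_ge0.
have cp : 0 <= c `^ (4 / 3) by exact: powR_ge0.
have c2 : 0 <= c ^+ 2 by exact: sqr_ge0.
move: v0; rewrite le_eqVlt => /predU1P[<-|v0]; first by rewrite mul0r !addr_ge0// powR_ge0.
have [cv|vc] := leP c (v `^ (p - 1)).
  have : v * c <= v * v `^ (p - 1) by rewrite ler_wpM2l// ltW.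
  rewrite -{2}(powRr1 (ltW v0)) -powRD; last by rewrite (gt_eqF v0) implybT.
  by rewrite addrC subrK; lra.
have : v <= c `^ (p - 1)^-1.
  rewrite -[leLHS](powRr1 (ltW v0)) -[X in v `^ X](@mulfV _ (p - 1)) ?gt_eqF//.
  by rewrite powRrM ge0_ler_powR ?nnegrE ?powR_ge0 ?invr_ge0 ?(ltW p1) ?(ltW vc) ?(ltW c0).
move=> vc2.
have : v * c <= c `^ ((p - 1)^-1 + 1).
  rewrite powRD; last by rewrite (gt_eqF c0) implybT.
  by rewrite powRr1 ?ler_wpM2r ?(ltW c0).
set q := _ + 1.
have qle : q <= 2.
  have : (p - 1)^-1 <= 1 by rewrite invf_le1//; lra.
  by rewrite /q; lra.
have qge : 4 / 3 <= q.
  have : 3^-1 <= (p - 1)^-1 by rewrite lef_pV2 ?posrE//; lra.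
  by rewrite /q; lra.
have [c1|c1] := leP c 1.
  have : c `^ q <= c `^ (4 / 3) by rewrite ger_powR// c0 c1.
  by lra.
have : c `^ q <= c `^ 2 by rewrite ler_powR// ltW.
by rewrite powR_mulrn ?(ltW c0)//; lra.
Qed.

Lemma inv_norm_le_wgt (d u : R) : 0 < d -> d <= 1 -> d < `|u| -> `|u|^-1 <= 2 / d * (wgt u)^-1.
Proof.
move=> d0 d1 du; have u0 : 0 < `|u| by exact: lt_trans du.
rewrite ler_pdivlMr ?wgt_gt0// mulrC ler_pdivrMr// /wgt mulrAC ler_pdivlMr// mulrDl mul1r.
have : `|u| * d <= `|u| by rewrite ler_piMr.
lra.
Qed.

(** The right-hand side of Young's inequality for c = 1 / |u|. *)
Definition far_majorant (e u : R) : R :=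
  if e < `|u| then `|u|^-1 `^ (4 / 3) + `|u|^-1 ^+ 2 else 0.

Lemma measurable_far_majorant e x : measurable_fun setT (fun t : R => far_majorant e (t - x)).
Proof. by rewrite /far_majorant; meas. Qed.

Lemma far_majorant_ge0 e u : 0 <= far_majorant e u.
Proof. by rewrite /far_majorant; case: ifP => // _; rewrite addr_ge0 ?powR_ge0 ?sqr_ge0. Qed.

Lemma integral_far_majorant (d e x : R) : 0 < d -> d <= 1 -> d <= e ->
  (\int[mu]_t (far_majorant e (t - x))%:E <= (32 / d ^+ 2)%:E)%E.
Proof.
move=> d0 d1 de.
pose A t := (if 1 < wgt (t - x) then wgt (t - x) `^ (- (1 + 3^-1)) else 0).
have A0 t : 0 <= A t by rewrite /A; case: ifP => // _; exact: powR_ge0.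
have B0 t : 0 <= wgt (t - x) ^- 2 by rewrite invr_ge0 sqr_ge0.
have c0 : 0 <= 4 / d ^+ 2 by rewrite divr_ge0// sqr_ge0.
apply: (@le_trans _ _ (\int[mu]_t (4 / d ^+ 2 * (A t + wgt (t - x) ^- 2))%:E)%E).
  apply: le_integralT.
  - exact: measurable_far_majorant.
  - by rewrite /A /wgt; meas.
  - by move=> t; exact: far_majorant_ge0.
  - move=> t; rewrite /far_majorant; case: ltP => et; last first.
      by rewrite mulr_ge0// addr_ge0.
    have du := le_lt_trans de et; have u0 := lt_trans d0 du.
    have h := inv_norm_le_wgt d0 d1 du.
    have w0 : 0 < (wgt (t - x))^-1 by rewrite invr_gt0 wgt_gt0.
    have d20 : 0 <= 2 / d by rewrite divr_ge0// ltW.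
    have dw0 : 0 <= 2 / d / wgt (t - x) by rewrite mulr_ge0// ltW.
    have q0 : 0 <= 4 / 3 :> R by rewrite divr_ge0.
    rewrite /A ifT; last by rewrite /wgt ltrDl.
    rewrite mulrDr lerD//.
    + apply: (@le_trans _ _ ((2 / d * (wgt (t - x))^-1) `^ (4 / 3))).
        by rewrite ge0_ler_powR ?nnegrE ?dw0 ?q0 ?invr_ge0.
      rewrite powRM ?(ltW w0)//.
      apply: ler_pM; rewrite ?powR_ge0//.
      * apply: (@le_trans _ _ ((2 / d) `^ 2)).
          by rewrite ler_powR ?ler_pdivlMr//; lra.
        rewrite powR_mulrn// expr_div_n.
        by rewrite (_ : 2 ^+ 2 = 4)//; ring.
      * rewrite -[(wgt _)^-1]powR_inv1 ?(ltW (wgt_gt0 _))// -powRrM.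
        by rewrite (_ : -1 * (4 / 3) = - (1 + 3^-1))//; field.
    + apply: (@le_trans _ _ ((2 / d * (wgt (t - x))^-1) ^+ 2)).
        by rewrite ler_sqr ?nnegrE ?dw0 ?invr_ge0.
      by rewrite exprMn expr_div_n exprVn (_ : 2 ^+ 2 = 4)//; ring.
have mA : measurable_fun setT A by rewrite /A /wgt; meas.
have mB : measurable_fun setT (fun t : R => wgt (t - x) ^- 2) by rewrite /wgt; meas.
rewrite ge0_integralZT//; [|by meas|by move=> t; rewrite addr_ge0].
rewrite ge0_integralDT//.
apply: (@le_trans _ _ ((4 / d ^+ 2)%:E * (6%:E + 2%:E))%E).
  rewrite lee_wpmul2l ?lee_fin// leeD//; last exact: integral_wgt2.
  have t0 : (0 : R) < 3^-1 by rewrite invr_gt0.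
  apply: (le_trans (integral_wgt_outside x t0 (lexx 1))).
  by rewrite powR1 mulr1 invrK lee_fin; lra.
by rewrite -EFinD -EFinM lee_fin le_eqVlt; apply/orP; left; apply/eqP; field; rewrite gt_eqF.
Qed.

Section variable_exponent_modular.
Variables (f p : R -> R).
Hypotheses (mf : measurable_fun setT f) (mp : measurable_fun setT p).
Hypothesis p24 : forall t, 2 <= p t <= 4.

Lemma norm_tkernel (e u : R) : 0 < e -> `|tkernel e u| = if e < `|u| then `|u|^-1 else 0.
Proof. by move=> e0; rewrite /tkernel; case: ifP => _; rewrite ?normr0// normfV. Qed.

(** Away from the diagonal the transform converges absolutely, for every f of finite
  modular and uniformly in the exponent. *)
Lemma integral_far_le (d e x : R) : 0 < d -> d <= 1 -> d <= e ->
  (\int[mu]_t `|f t * tkernel e (t - x)|%:E <=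
   \int[mu]_t (`|f t| `^ p t)%:E + (32 / d ^+ 2)%:E)%E.
Proof.
move=> d0 d1 de; have e0 := lt_le_trans d0 de.
apply: (@le_trans _ _ (\int[mu]_t (`|f t| `^ p t + far_majorant e (t - x))%:E)%E).
  apply: le_integralT => [| |t|t].
  - by rewrite /tkernel; meas.
  - by have mfar := measurable_far_majorant e x; meas.
  - by [].
  - rewrite normrM norm_tkernel// /far_majorant; case: ltP => et.
      by apply: young_uniform => //; rewrite invr_gt0 (lt_trans e0).
    by rewrite mulr0 addr0 powR_ge0.
rewrite ge0_integralDT.
- by rewrite leeD2l//; exact: integral_far_majorant.
- by meas.
- exact: measurable_far_majorant.
- by move=> t; exact: powR_ge0.
- by move=> t; exact: far_majorant_ge0.
Qed.

Lemma integrable_far (e x : R) : 0 < e -> (\int[mu]_t (`|f t| `^ p t)%:E < +oo)%E ->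
  mu.-integrable setT (EFin \o (fun t => f t * tkernel e (t - x))).
Proof.
move=> e0 foo; apply: (@integrable_of_bound _ _ (fun t => `|f t * tkernel e (t - x)|)).
- by rewrite /tkernel; meas.
- by rewrite /tkernel; meas.
- by [].
pose d := Num.min e 1; have d0 : 0 < d by rewrite lt_min e0/=.
apply: (le_lt_trans (@integral_far_le d e x d0 _ _)).
- by rewrite ge_min lexx orbT.
- by rewrite ge_min lexx.
- by rewrite lte_add_pinfty// ltry.
Qed.

End variable_exponent_modular.

Lemma fatou_bound (h : nat -> R -> R) (l : R -> R) (B : \bar R) :
  (forall n, measurable_fun setT (h n)) -> (forall n x, 0 <= h n x) ->
  (forall x, h n x @[n --> \oo] --> l x) ->
  (forall n, (\int[mu]_x (h n x)%:E <= B)%E) -> (\int[mu]_x (l x)%:E <= B)%E.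
Proof.
move=> mh h0 hl hB.
have F := @fatou _ _ R mu setT measurableT (fun n x => (h n x)%:E) (fun n => measurable_EFin (mh n))
   (fun n x _ => _ : (0 <= (h n x)%:E)%E).
apply: (@le_trans _ _ (\int[mu]_x limn_einf (fun n => (h n x)%:E))%E).
  rewrite le_eqVlt; apply/orP; left; apply/eqP; apply: eq_integralR => x _.
  apply/esym; have : (h n x)%:E @[n --> \oo] --> (l x)%:E.
    by apply: cvg_EFin; [exact: nearW|exact: hl].
  by move=> c; rewrite is_cvg_limn_einfE ?(cvg_lim _ c)//; apply/cvg_ex; exists (l x)%:E.
apply: le_trans (F _) _; first by move=> n x; rewrite lee_fin.
rewrite limn_einf_lim; apply: lime_le; first exact: is_cvg_einfs.
apply: nearW => n; apply: le_trans (hB n); apply: ereal_inf_lbound.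
by exists n => /=.
Qed.

End integrability_away_from_the_diagonal.

Section Lr_bounds.
Context {R : realType}.
Local Notation mu := (@lebesgue_measure R).
Implicit Types (f g : R -> R).

Lemma cvgnX (u : nat -> R) (l : R) r : u n @[n --> \oo] --> l ->
  u n ^+ r @[n --> \oo] --> l ^+ r.
Proof.
move=> ul; elim: r => [|r ih]; first by rewrite expr0; under eq_fun do rewrite expr0; exact: cvg_cst.
by rewrite exprS; under eq_fun do rewrite exprS; exact: cvgM.
Qed.

(** The functions f cut off in size and in space have bounded support and converge
  to f; their transforms converge pointwise by domination, and Fatou's lemma
  passes the bound to the limit. *)
Lemma trunc_hilbert_extension (r : nat) (K e : R) : ~~ odd r -> (2 <= r <= 4)%N ->
  0 < K -> 0 < e ->
  (forall f (r0 : R), mu.-integrable setT (EFin \o f) -> (forall t, r0 < `|t| -> f t = 0) ->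
    (\int[mu]_x (trunc_hilbert e f x ^+ r)%:E <= K%:E * \int[mu]_x (f x ^+ r)%:E)%E) ->
  forall f, measurable_fun setT f ->
    (\int[mu]_x (trunc_hilbert e f x ^+ r)%:E <= K%:E * \int[mu]_x (f x ^+ r)%:E)%E.
Proof.
move=> r_even r24 K0 e0 Hc f mf.
have pow0 (a : R) : 0 <= a ^+ r by rewrite exprn_even_ge0.
have powE (a : R) : `|a| `^ r%:R = a ^+ r.
  by rewrite powR_mulrn// -normrX ger0_norm.
have [foo|] := boolP (\int[mu]_x (f x ^+ r)%:E == +oo)%E.
  by rewrite (eqP foo) gt0_muley ?lte_fin// leey.
rewrite -ltey => foo.
pose h (n : nat) t := if (`|t| <= n%:R) && (`|f t| <= n%:R) then f t else 0.
have mh n : measurable_fun setT (h n).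
  by rewrite /h; apply: measurable_fun_ifT => //; apply: measurable_and; meas.
have hle n t : `|h n t| <= `|f t| by rewrite /h; case: ifP => //; rewrite normr0.
have hi n : mu.-integrable setT (EFin \o h n).
  apply: (@integrable_of_bound _ _ (fun t => if `|t - 0| <= n%:R then n%:R else 0)) => //.
  - by meas.
  - move=> t; rewrite subr0 /h; case: ifPn => /= [/andP[-> ]//|_].
    by rewrite normr0; case: ifP.
  - by rewrite integral_ball_cst// ltry.
have fi x : mu.-integrable setT (EFin \o (fun t => f t * tkernel e (t - x))).
  apply: (@integrable_far _ f (fun=> r%:R)) => //.
  - by move=> _; case/andP: r24 => r2 r4; rewrite !ler_nat r2 r4.
  - by under eq_integral do rewrite powE.
apply: (@fatou_bound _ (fun n x => trunc_hilbert e (h n) x ^+ r)).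
- by move=> n; apply: measurable_funX; exact: measurable_trunc_hilbert.
- by move=> n x.
- move=> x; have : trunc_hilbert e (h n) x @[n --> \oo] --> trunc_hilbert e f x.
    apply: (@Rintegral_dominated _ _ _ (fun t => `|f t * tkernel e (t - x)|)).
    + by move=> n; have := mh n => mhn; rewrite /tkernel; meas.
    + by rewrite /tkernel; meas.
    + move=> t; apply: cvg_near_cst; near=> n; rewrite /h ifT//.
      apply/andP; split; first by near: n; exact: nbhs_infty_ger.
      by near: n; exact: nbhs_infty_ger.
    + exact: integrable_abs_lty.
    + by move=> n t; rewrite !normrM ler_wpM2r.
  exact: cvgnX.
- move=> n; apply: (le_trans (Hc (h n) n%:R _ _)) => //.
    by move=> t nt; rewrite /h leNgt nt.
  rewrite lee_wpmul2l ?lee_fin ?(ltW K0)//.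
  apply: le_integralT; [exact: measurable_funX|exact: measurable_funX|by []|].
  by move=> t; rewrite -2!powE ge0_ler_powR ?nnegrE.
Unshelve. all: by end_near. Qed.

Lemma trunc_hilbert_L2 : exists2 K : R, 0 <= K & forall (e : R) f,
  0 < e -> measurable_fun setT f ->
  (\int[mu]_x (trunc_hilbert e f x ^+ 2)%:E <= K%:E * \int[mu]_x (f x ^+ 2)%:E)%E.
Proof.
exists 400 => [|e f e0 mf]; first by rewrite ler0n.
apply: (@trunc_hilbert_extension 2 400 e isT isT (ltr0Sn _ _) e0 _ f mf).
by move=> {mf}f r0 fi fs; exact: trunc_hilbert_compact_L2 fi fs e0.
Qed.

Lemma trunc_hilbert_L4 : exists2 K : R, 0 <= K & forall (e : R) f,
  0 < e -> measurable_fun setT f ->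
  (\int[mu]_x (trunc_hilbert e f x ^+ 4)%:E <= K%:E * \int[mu]_x (f x ^+ 4)%:E)%E.
Proof.
have K0 : 0 < 8 * (100 * 100) + 8 * (34 * (100 * 100)) :> R.
  by rewrite !addr_gt0// !mulr_gt0.
exists (8 * (100 * 100) + 8 * (34 * (100 * 100))) => [|e f e0 mf]; first exact: ltW K0.
apply: (@trunc_hilbert_extension 4 _ e isT isT K0 e0 _ f mf).
by move=> {mf}f r0 fi fs; exact: trunc_hilbert_compact_L4 fi fs e0.
Qed.

End Lr_bounds.

(** * Slowly varying weights *)

Section weighted_bounds.
Context {R : realType}.
Local Notation mu := (@lebesgue_measure R).
Implicit Types (f g : R -> R).

Definition wmax (x t : R) : R := Num.max (wgt x) (wgt t).
Definition wratio (x t : R) : R := wmax x t / Num.min (wgt x) (wgt t).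

(** Homogeneous of degree -1 in 1 + |x| and 1 + |t|; it dominates the commutator of
  the Hilbert transform with a slowly varying weight. *)
Definition hkernel (x t : R) : R := wratio x t `^ 8^-1 / wmax x t.

Lemma wmaxC (x t : R) : wmax x t = wmax t x. Proof. by rewrite /wmax maxC. Qed.
Lemma wratioC (x t : R) : wratio x t = wratio t x.
Proof. by rewrite /wratio wmaxC minC. Qed.
Lemma hkernelC (x t : R) : hkernel x t = hkernel t x.
Proof. by rewrite /hkernel wratioC wmaxC. Qed.

Lemma wmax_gt0 (x t : R) : 0 < wmax x t. Proof. by rewrite lt_max wgt_gt0. Qed.
Lemma wmin_gt0 (x t : R) : 0 < Num.min (wgt x) (wgt t). Proof. by rewrite lt_min !wgt_gt0. Qed.
Lemma wratio_ge1 (x t : R) : 1 <= wratio x t.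
Proof. by rewrite ler_pdivlMr ?wmin_gt0// mul1r ge_min le_max lexx. Qed.
Lemma wratio_gt0 (x t : R) : 0 < wratio x t. Proof. exact: lt_le_trans ltr01 (wratio_ge1 x t). Qed.
Lemma hkernel_ge0 (x t : R) : 0 <= hkernel x t.
Proof. by rewrite divr_ge0 ?powR_ge0// ltW// wmax_gt0. Qed.

Lemma measurable_hkernel : measurable_fun setT (fun z : R * R => hkernel z.1 z.2).
Proof. by rewrite /hkernel /wratio /wmax /wgt; meas. Qed.

Lemma measurable_hkernel1 (x : R) : measurable_fun setT (hkernel x).
Proof. by rewrite /hkernel /wratio /wmax /wgt; meas. Qed.

Lemma measurable_wgtp (s : R) : measurable_fun setT (fun t : R => wgt t `^ s).
Proof. by rewrite /wgt; meas. Qed.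

(** The test function is (1 + |t|) ^ (- s). The kernel is
  (1 + |x|) ^ (1 / 8 - 1) (1 + |t|) ^ (- 1 / 8) inside and
  (1 + |x|) ^ (- 1 / 8) (1 + |t|) ^ (1 / 8 - 1) outside the ball |t| <= |x|, so both
  integrals converge when 1 / 8 < s < 7 / 8. *)
Lemma schur_test (s : R) : 4^-1 <= s -> s <= 3 / 4 -> forall x : R,
  (\int[mu]_t (hkernel x t * wgt t `^ (- s))%:E <= (32 * wgt x `^ (- s))%:E)%E.
Proof.
move=> s1 s2 x; have wx0 := wgt_gt0 x; have wx1 := wgt_ge1 x.
have p0 (a : R) : 0 <= wgt x `^ a by exact: powR_ge0.
pose A t := if wgt (t - 0) <= wgt x then wgt (t - 0) `^ (- (8^-1 + s)) else 0.
pose B t := if wgt x < wgt (t - 0) then wgt (t - 0) `^ (- (1 + (s - 8^-1))) else 0.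
have A0 t : 0 <= A t by rewrite /A; case: ifP => // _; exact: powR_ge0.
have B0 t : 0 <= B t by rewrite /B; case: ifP => // _; exact: powR_ge0.
have mA : measurable_fun setT A by rewrite /A /wgt; meas.
have mB : measurable_fun setT B by rewrite /B /wgt; meas.
have divp (a b c : R) : 0 < a -> 0 < b -> (a / b) `^ c = a `^ c * b `^ (- c).
  move=> a0 b0; rewrite powRM ?invr_ge0 ?(ltW a0) ?(ltW b0)//.
  by rewrite -powR_inv1 ?(ltW b0)// -powRrM mulN1r.
have pD (a b c : R) : 0 < a -> a `^ b * a `^ c = a `^ (b + c).
  by move=> a0; rewrite powRD// (gt_eqF a0) implybT.
apply: (@le_trans _ _ (\int[mu]_t (wgt x `^ (8^-1 - 1) * A t + wgt x `^ (- 8^-1) * B t)%:E)%E).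
  apply: le_integralT.
  - have := measurable_hkernel1 x => mh; have := measurable_wgtp (- s) => mws; meas.
  - by meas.
  - by move=> t; rewrite mulr_ge0 ?hkernel_ge0// powR_ge0.
  - move=> t; have wt0 := wgt_gt0 t.
    rewrite /A /B subr0 /hkernel /wratio /wmax le_eqVlt; apply/orP; left; apply/eqP.
    case: leP => h.
      rewrite mulr0 addr0 divp//.
      rewrite -[(wgt x)^-1]powR_inv1 ?(ltW wx0)//.
      rewrite -mulrA mulrACA pD// mulrA.
      by rewrite -mulrA pD// opprD.
    rewrite mulr0 add0r divp//.
    rewrite -[(wgt t)^-1]powR_inv1 ?(ltW wt0)//.
    transitivity (wgt x `^ (- 8^-1) * (wgt t `^ 8^-1 * wgt t `^ (-1) * wgt t `^ (- s))); first by ring.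
    by rewrite !pD//; congr (_ * _ `^ _); ring.
rewrite ge0_integralDT; try by meas.
- rewrite !ge0_integralZT//.
  have h1 : (0:R) < 8^-1 + s by lra.
  have h2 : 8^-1 + s < (1:R) by lra.
  have h3 : (0:R) < s - 8^-1 by lra.
  have I1 := integral_wgt_inside 0 h1 h2 wx1.
  have I2 := integral_wgt_outside 0 h3 wx1.
  apply: (@le_trans _ _ ((wgt x `^ (8^-1 - 1))%:E * (2 / (1 - (8^-1 + s)) * wgt x `^ (1 - (8^-1 + s)))%:E +
     (wgt x `^ (- 8^-1))%:E * (2 / (s - 8^-1) * wgt x `^ (- (s - 8^-1)))%:E)%E).
    by apply: leeD; rewrite lee_wpmul2l ?lee_fin.
  rewrite -!EFinM -EFinD lee_fin mulrCA pD// [X in _ + X]mulrCA pD//.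
  rewrite (_ : 8^-1 - 1 + _ = - s); last by ring.
  rewrite (_ : - 8^-1 + _ = - s); last by ring.
  rewrite -mulrDl ler_wpM2r//.
  have : 2 / (1 - (8^-1 + s)) <= 16 by rewrite ler_pdivrMr; lra.
  have : 2 / (s - 8^-1) <= 16 by rewrite ler_pdivrMr; lra.
  lra.
- by move=> t; rewrite mulr_ge0.
- by move=> t; rewrite mulr_ge0.
Qed.

Definition happly g (x : R) : \bar R := (\int[mu]_t (hkernel x t * `|g t|)%:E)%E.

Lemma measurable_happly g : measurable_fun setT g -> measurable_fun setT (happly g).
Proof.
move=> mg; apply: measurable_integral_param; last by move=> x t; rewrite mulr_ge0 ?hkernel_ge0.
by have := measurable_hkernel => mh; meas.
Qed.

Lemma happly_ge0 g x : (0 <= happly g x)%E.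
Proof. by apply: integralT_ge0 => t; rewrite mulr_ge0 ?hkernel_ge0. Qed.

(** Cauchy-Schwarz after inserting the Schur weight (1 + |t|) ^ (- s) and its
  inverse. *)
Lemma happly_sqr_le (s : R) g x : 4^-1 <= s -> s <= 3 / 4 -> measurable_fun setT g ->
  ((happly g x) ^+ 2 <= (32 * wgt x `^ (- s))%:E * happly (fun t => g t ^+ 2 * wgt t `^ s)%R x)%E.
Proof.
move=> s1 s2 mg; have mws := measurable_wgtp (- s); have mws' := measurable_wgtp s.
have mh := measurable_hkernel1 x.
have W0 t : 0 < wgt t `^ s :> R by rewrite powR_gt0// wgt_gt0.
have WN t : wgt t `^ (- s) * wgt t `^ s = 1 :> R.
  by rewrite -powRD ?(gt_eqF (wgt_gt0 _)) ?implybT// addNr powRr0.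
have A0 : 0 < 32 * wgt x `^ (- s) by rewrite mulr_gt0// powR_gt0// wgt_gt0.
have m1 : measurable_fun setT (fun t => hkernel x t * wgt t `^ (- s)) by meas.
have m2 : measurable_fun setT (fun t => `|g t| * wgt t `^ s) by meas.
have := @cauchy_schwarz _ (fun t => hkernel x t * wgt t `^ (- s)) (fun t => `|g t| * wgt t `^ s) _ m1 m2
  (fun t => mulr_ge0 (hkernel_ge0 x t) (powR_ge0 _ _)) (fun t => mulr_ge0 (normr_ge0 _) (powR_ge0 _ _)) A0 (schur_test s1 s2 x).
rewrite /happly; congr (is_true (_ ^+ 2 <= _ * _)%E); apply: eq_integralR => t _; congr EFin.
  by rewrite -mulrA; congr (_ * _); rewrite mulrCA WN mulr1.
rewrite -mulrA; congr (_ * _); rewrite exprMn normrM (ger0_norm (ltW (W0 t))) normrX.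
by rewrite mulrCA expr2 (mulrA (wgt t `^ (- s))) WN mul1r.
Qed.

Let integral_happly (s : R) g : 4^-1 <= s -> s <= 3 / 4 -> measurable_fun setT g -> (forall t, 0 <= g t) ->
  (\int[mu]_x ((wgt x `^ (- s))%:E * happly (fun t => g t * wgt t `^ s)%R x) <= 32%:E * \int[mu]_t (g t)%:E)%E.
Proof.
move=> s1 s2 mg g0; have mws := measurable_wgtp (- s); have mws' := measurable_wgtp s.
have mh := measurable_hkernel.
have gw0 t : 0 <= g t * wgt t `^ s by rewrite mulr_ge0// powR_ge0.
have WN t : wgt t `^ (- s) * wgt t `^ s = 1 :> R.
  by rewrite -powRD ?(gt_eqF (wgt_gt0 _)) ?implybT// addNr powRr0.
rewrite (@eq_integralR _ _ _ (fun x => \int[mu]_t (hkernel x t * wgt x `^ (- s) * (g t * wgt t `^ s))%:E)%E); last first.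
  move=> x _; rewrite /happly -ge0_integralZT ?powR_ge0//.
  - by apply: eq_integralR => t _; congr EFin; rewrite (ger0_norm (gw0 t)); ring.
  - by have := measurable_hkernel1 x => mhx; meas.
  - by move=> t; rewrite mulr_ge0 ?hkernel_ge0.
apply: le_trans (tonelli_le (k := fun x t => hkernel x t * wgt x `^ (- s)) (g := fun t => g t * wgt t `^ s)
   (b := fun t => 32 * wgt t `^ (- s)) _ _ _ _ _ _) _.
- by apply: measurable_funM => //; rewrite /wgt; meas.
- by meas.
- by meas.
- by move=> x t; rewrite mulr_ge0 ?hkernel_ge0// powR_ge0.
- by [].
- by move=> t; under eq_integral do rewrite hkernelC; exact: schur_test.
- rewrite -ge0_integralZT//; rewrite le_eqVlt; apply/orP; left; apply/eqP.
  by apply: eq_integralR => t _; congr EFin; rewrite -mulrA; congr (_ * _); rewrite mulrCA WN mulr1.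
Qed.

Let esqr_le (a b : \bar R) : (0 <= a)%E -> (a <= b)%E -> (a ^+ 2 <= b ^+ 2)%E.
Proof. by move=> a0 ab; rewrite !expe2 lee_pmul. Qed.

Let measurable_ereal_sqr (F : R -> \bar R) : measurable_fun setT F ->
  measurable_fun setT (fun x => F x ^+ 2)%E.
Proof. by move=> mF; exact: emeasurable_funM. Qed.

Lemma happly_L2 : exists2 K : R, 0 <= K & forall g, measurable_fun setT g ->
  (\int[mu]_x (happly g x) ^+ 2 <= K%:E * \int[mu]_t (g t ^+ 2)%:E)%E.
Proof.
exists (32 * 32) => [|g mg]; first by rewrite mulr_ge0.
 have s1 : 4^-1 <= (2^-1 : R) by lra.
have s2 : (2^-1 : R) <= 3 / 4 by lra.
have mws := measurable_wgtp (- 2^-1); have mws' := measurable_wgtp 2^-1.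
have mg2 : measurable_fun setT (fun t => g t ^+ 2 * wgt t `^ 2^-1) by meas.
apply: (@le_trans _ _ (\int[mu]_x (32%:E * ((wgt x `^ (- 2^-1))%:E * happly (fun t => g t ^+ 2 * wgt t `^ 2^-1)%R x)))%E).
  apply: ge0_le_integralT.
  - by apply: measurable_ereal_sqr; exact: measurable_happly.
  - apply: measurable_funeM; apply: emeasurable_funM; first by meas.
    exact: measurable_happly.
  - by move=> x; rewrite expe_ge0// happly_ge0.
  - by move=> x; rewrite muleA -EFinM; exact: happly_sqr_le.
rewrite ge0_integralZl//.
- rewrite EFinM -muleA lee_wpmul2l//.
  apply: integral_happly => //; first by meas.
  by move=> t; rewrite sqr_ge0.
- apply: emeasurable_funM; first by meas.
  exact: measurable_happly.
- by move=> x _; rewrite mule_ge0 ?happly_ge0// lee_fin powR_ge0.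
Qed.

Lemma happly_L4 : exists2 K : R, 0 <= K & forall g, measurable_fun setT g ->
  (\int[mu]_x (happly g x) ^+ 4 <= K%:E * \int[mu]_t (g t ^+ 4)%:E)%E.
Proof.
exists (32 ^+ 3 * 32) => [|g mg]; first by rewrite mulr_ge0// exprn_ge0.
 have s1 : 4^-1 <= (4^-1 : R) by lra.
have s2 : (4^-1 : R) <= 3 / 4 by lra.
have s3 : 4^-1 <= (3 / 4 : R) by lra.
have mw (s : R) := measurable_wgtp s.
have mw1 := mw (- (3 / 4)); have mw2 := mw (3 / 4); have mw3 := mw 4^-1.
pose g1 t := g t ^+ 2 * wgt t `^ 4^-1.
have mg1 : measurable_fun setT g1 by rewrite /g1; meas.
pose g2 t := g t ^+ 4 * wgt t `^ (3 / 4).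
have mg2 : measurable_fun setT g2 by rewrite /g2; meas.
have p4 (z : \bar R) : (z ^+ 4 = (z ^+ 2) ^+ 2)%E.
  by rewrite !expeS !expe0 !mule1 -!muleA.
have pD (a b c : R) : 0 < a -> a `^ b * a `^ c = a `^ (b + c).
  by move=> a0; rewrite powRD// (gt_eqF a0) implybT.
have g12 : (fun t => g1 t ^+ 2 * wgt t `^ 4^-1) = g2.
  apply/funext => t; rewrite /g1 /g2 exprMn -exprM -mulrA; congr (_ * _).
  by rewrite expr2 !pD ?wgt_gt0//; congr (_ `^ _); field.
apply: (@le_trans _ _ (\int[mu]_x ((32 ^+ 3)%:E * ((wgt x `^ (- (3 / 4)))%:E * happly g2 x)))%E).
  apply: ge0_le_integralT.
  - under eq_fun do rewrite p4.
    by do 2 apply: measurable_ereal_sqr; exact: measurable_happly.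
  - apply: measurable_funeM; apply: emeasurable_funM; first by meas.
    exact: measurable_happly.
  - by move=> x; rewrite expe_ge0// happly_ge0.
  - move=> x; rewrite p4.
    have h1 := happly_sqr_le x s1 s2 mg; rewrite -/g1 in h1.
    have h2 := happly_sqr_le x s1 s2 mg1; rewrite g12 in h2.
    have c0 : 0 <= 32 * wgt x `^ (- 4^-1) :> R by rewrite mulr_ge0// powR_ge0.
    apply: (@le_trans _ _ (((32 * wgt x `^ (- 4^-1))%:E * happly g1 x) ^+ 2)%E).
      by apply: esqr_le h1; rewrite expe_ge0// happly_ge0.
    rewrite expe2 muleACA -expe2 -(expe2 (happly g1 x)).
    apply: (@le_trans _ _ ((32 * wgt x `^ (- 4^-1))%:E ^+ 2 * ((32 * wgt x `^ (- 4^-1))%:E * happly g2 x))%E).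
      by rewrite lee_wpmul2l// expe_ge0// lee_fin.
    rewrite muleA -EFin_expe -EFinM muleA -EFinM le_eqVlt; apply/orP; left; apply/eqP.
    congr (_%:E * _)%E; rewrite -exprSr exprMn; congr (_ * _).
    by rewrite exprS expr2 !pD ?wgt_gt0//; congr (_ `^ _); field.
rewrite ge0_integralZl//.
- rewrite (EFinM (32 ^+ 3) 32) -muleA lee_wpmul2l ?lee_fin ?exprn_ge0//.
  apply: integral_happly => //; first by meas.
  by move=> t; rewrite (exprM _ 2 2) sqr_ge0.
- apply: emeasurable_funM; first by meas.
  exact: measurable_happly.
- by move=> x _; rewrite mule_ge0 ?happly_ge0// lee_fin powR_ge0.
Qed.

(** A change of 1 + |x| by a factor rho changes phi by a factor at most
  rho ^ (1 / 8). The exponent 1 / 8 matches the amplitude of the exponent p. *)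
Definition slow_weight (phi : R -> R) := forall x t, phi x <= phi t * wratio x t `^ 8^-1.

(** Where 1 + |x| and 1 + |t| are comparable, phi x - phi t gains a factor
  1 - 1 / rho, and |t - x| is at least max (1 + |x|, 1 + |t|) (1 - 1 / rho): the
  singularity on the diagonal cancels. *)
Lemma commutator_kernel (phi : R -> R) (e x t : R) : (forall x, 0 < phi x) -> slow_weight phi ->
  0 < e -> `|(phi x - phi t) * tkernel e (t - x)| <= 3 * phi t * hkernel x t.
Proof.
move=> phi0 slow e0.
have rh0 : 0 <= 3 * phi t * hkernel x t by exact: mulr_ge0 (mulr_ge0 (ler0n _ 3) (ltW (phi0 t))) (hkernel_ge0 x t).
rewrite normrM norm_tkernel//; case: ltP => et; last by rewrite mulr0.
have tx0 : 0 < `|t - x| by exact: lt_trans et.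
rewrite ler_pdivrMr// /hkernel.
set rho := wratio x t; have r1 : 1 <= rho by exact: wratio_ge1.
have r0 : 0 < rho by exact: wratio_gt0.
have rb1 : 1 <= rho `^ 8^-1 by rewrite -[leLHS](powRr0 rho) ler_powR// invr_ge0.
have rb0 : 0 < rho `^ 8^-1 by exact: lt_le_trans rb1.
have rbr : rho `^ 8^-1 <= rho.
  by rewrite -[leRHS](powRr1 (ltW r0)) ler_powR//; lra.
have diff : `|phi x - phi t| <= phi t * (rho `^ 8^-1 - 1).
  have h1 := slow x t; have h2 := slow t x; rewrite wratioC -/rho in h2.
  have := phi0 t; have := phi0 x => px pt.
  rewrite ler_norml; apply/andP; split; last by rewrite mulrBr mulr1 lerB.
  rewrite -/rho in h1.
  have : (phi t - phi x) * rho `^ 8^-1 <= phi t * (rho `^ 8^-1 - 1) * rho `^ 8^-1.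
    have : phi t * (rho `^ 8^-1 - 1) <= phi t * (rho `^ 8^-1 - 1) * rho `^ 8^-1.
      by rewrite ler_peMr// mulr_ge0 ?(ltW pt)// subr_ge0.
    lra.
  by rewrite ler_pM2r//; lra.
have dist : wmax x t * (1 - rho^-1) <= `|t - x|.
  have M0 := wmax_gt0 x t; have m0 := wmin_gt0 x t.
  have -> : wmax x t * (1 - rho^-1) = wmax x t - Num.min (wgt x) (wgt t).
    by rewrite /rho /wratio; field; rewrite !gt_eqF.
  have d1 := ler_dist_dist t x; have d2 := ler_norm (`|t| - `|x|); have d3 := ler_norm (`|x| - `|t|).
  rewrite distrC in d3; rewrite /wmax /wgt.
  by case: (leP (1 + `|x|) (1 + `|t|)) => _; lra.
(* For rho <= 3 / 2 use rho ^ (1 / 8) <= rho; otherwise 1 - 1 / rho >= 1 / 3, which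
   is where the factor 3 comes from. *)
have core : rho `^ 8^-1 - 1 <= 3 * rho `^ 8^-1 * (1 - rho^-1).
  have ri : 0 < rho^-1 by rewrite invr_gt0.
  have ri1 : rho^-1 <= 1 by rewrite invf_le1.
  have [r32|r32] := leP rho (3 / 2).
    have : rho `^ 8^-1 - 1 <= rho * (1 - rho^-1) by rewrite mulrBr mulr1 divff ?gt_eqF//; lra.
    have : rho * (1 - rho^-1) <= 3 * rho `^ 8^-1 * (1 - rho^-1) by rewrite ler_wpM2r; lra.
    lra.
  have : rho^-1 <= 2 / 3 by rewrite -(ler_pM2r r0) mulVf ?gt_eqF//; lra.
  move=> r23; have : 3 * rho `^ 8^-1 * (1 / 3) <= 3 * rho `^ 8^-1 * (1 - rho^-1).
    by rewrite ler_wpM2l ?mulr_ge0 ?(ltW rb0)//; lra.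
  lra.
apply: (le_trans diff).
apply: (@le_trans _ _ (phi t * (3 * rho `^ 8^-1 * (1 - rho^-1)))).
  by rewrite ler_wpM2l// ltW.
have -> : 3 * phi t * (rho `^ 8^-1 / wmax x t) * `|t - x| =
   phi t * (3 * rho `^ 8^-1 * (`|t - x| / wmax x t)) by ring.
rewrite ler_wpM2l ?(ltW (phi0 t))// ler_wpM2l ?mulr_ge0 ?(ltW rb0)//.
by rewrite ler_pdivlMr ?wmax_gt0// mulrC.
Qed.

Section commutator.
Variables (phi f : R -> R) (r : nat) (e B : R).
Hypotheses (mphi : measurable_fun setT phi) (mf : measurable_fun setT f).
Hypotheses (phi0 : forall x, 0 < phi x) (phiB : forall x, phi x <= B).
Hypotheses (slow : slow_weight phi) (e0 : 0 < e).
Hypotheses (r_even : ~~ odd r) (r24 : (2 <= r <= 4)%N).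
Hypothesis foo : (\int[mu]_t (f t ^+ r)%:E < +oo)%E.

Let g t := phi t * f t.

Let mg : measurable_fun setT g.
Proof. by rewrite /g; meas. Qed.

Let pow0 (a : R) : 0 <= a ^+ r. Proof. by rewrite exprn_even_ge0. Qed.

Let powE (a : R) : `|a| `^ r%:R = a ^+ r.
Proof. by rewrite powR_mulrn// -normrX ger0_norm. Qed.

Let r24R (t : R) : 2 <= (r%:R : R) <= 4.
Proof. by case/andP: r24 => r2 r4; rewrite !ler_nat r2 r4. Qed.

Let B0 : 0 < B. Proof. exact: lt_le_trans (phi0 0) (phiB 0). Qed.

Let fi x : mu.-integrable setT (EFin \o (fun t => f t * tkernel e (t - x))).
Proof.
apply: (@integrable_far _ f (fun=> r%:R)) => //.
by under eq_integral do rewrite powE.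
Qed.

Let gi x : mu.-integrable setT (EFin \o (fun t => g t * tkernel e (t - x))).
Proof.
apply: (@integrable_far _ g (fun=> r%:R)) => //.
under eq_integral do rewrite powE.
apply: (@le_lt_trans _ _ (\int[mu]_t (B ^+ r * f t ^+ r)%:E)%E).
  apply: le_integralT => [| |t|t]; [exact: measurable_funX|by meas|by []|].
  rewrite /g exprMn ler_wpM2r// lerXn2r// nnegrE ltW//.
rewrite ge0_integralZT//; last by meas.
by apply: lte_mul_pinfty; rewrite ?lee_fin ?exprn_ge0 ?(ltW B0).
Qed.

Lemma commutator_le x :
  (`|phi x * trunc_hilbert e f x - trunc_hilbert e g x|%:E <= 3%:E * happly g x)%E.
Proof.
have fi' : mu.-integrable setT (EFin \o (fun t => phi x * (f t * tkernel e (t - x)))).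
  exact: (integrableZl measurableT (phi x) (fi x)).
rewrite /trunc_hilbert -RintegralZl// -RintegralB//.
rewrite EFin_normr_Rintegral//; last exact: (integrableB measurableT fi' (gi x)).
apply: (le_trans (le_abse_integral _ _ _)) => //.
  by apply: measurable_EFin; rewrite /tkernel; meas.
have mh := measurable_hkernel1 x.
rewrite -ge0_integralZT//; [|by meas|by move=> t; rewrite mulr_ge0 ?hkernel_ge0].
apply: le_integralT => [| |t|t].
- by rewrite /tkernel; meas.
- by meas.
- by [].
- rewrite (_ : _ - _ = (phi x - phi t) * tkernel e (t - x) * f t); last by rewrite /g; ring.
  rewrite normrM (le_trans (ler_wpM2r (normr_ge0 _) (commutator_kernel x t phi0 slow e0)))//.
  rewrite /g normrM (gtr0_norm (phi0 t)).
  by rewrite le_eqVlt; apply/orP; left; apply/eqP; ring.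
Qed.

End commutator.

(** The weighted transform of f is the transform of phi f plus the commutator. The
  bound B on phi makes phi f a function of the space. *)
Lemma weighted_trunc_hilbert_L2 : exists2 K : R, 0 <= K & forall (phi f : R -> R) (e B : R),
  measurable_fun setT phi -> measurable_fun setT f ->
  (forall x, 0 < phi x) -> (forall x, phi x <= B) -> slow_weight phi -> 0 < e ->
  (\int[mu]_t (f t ^+ 2)%:E < +oo)%E ->
  (\int[mu]_x ((phi x * trunc_hilbert e f x) ^+ 2)%:E <=
   K%:E * \int[mu]_t ((phi t * f t) ^+ 2)%:E)%E.
Proof.
have [K K0 happly_le] := happly_L2.
have [A A0 trunc_le] := @trunc_hilbert_L2 R.
exists (2 * A + 2 * (9 * K)) => [|phi f e B].
  by rewrite addr_ge0// !mulr_ge0.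
move=> mphi mf phi0 phiB slow e0 foo.
pose g t := phi t * f t; have mg : measurable_fun setT g by rewrite /g; meas.
have mT := measurable_trunc_hilbert e mf; have mTg := measurable_trunc_hilbert e mg.
pose S x := phi x * trunc_hilbert e f x - trunc_hilbert e g x.
have mS : measurable_fun setT S by rewrite /S; meas.
have hS : (\int[mu]_x (S x ^+ 2)%:E <= (9 * K)%:E * \int[mu]_t (g t ^+ 2)%:E)%E.
  apply: (@le_trans _ _ (\int[mu]_x (9%:E * happly g x ^+ 2))%E).
    apply: ge0_le_integralT; first by meas.
    - apply: measurable_funeM; apply: measurable_ereal_sqr; exact: measurable_happly.
    - by move=> x; rewrite lee_fin sqr_ge0.
    - move=> x; rewrite -(real_normK (num_real (S x))) EFin_expe.
      have h := commutator_le mphi mf phi0 phiB slow e0 (isT : ~~ odd 2) isT foo x.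
      apply: (@le_trans _ _ ((3%:E * happly g x) ^+ 2)%E); first exact: esqr_le.
      by rewrite !expe2 muleACA -EFinM (_ : 3 * 3 = 9 :> R)//; ring.
  rewrite ge0_integralZl//.
  - rewrite EFinM -muleA lee_wpmul2l// happly_le//.
  - by apply: measurable_ereal_sqr; exact: measurable_happly.
  - by move=> x _; rewrite expe_ge0// happly_ge0.
apply: (@le_trans _ _ (\int[mu]_x (2 * trunc_hilbert e g x ^+ 2 + 2 * S x ^+ 2)%:E)%E).
  apply: le_integralT; [by meas|by meas|by move=> x; rewrite sqr_ge0|move=> x].
  rewrite /S; set a := _ * trunc_hilbert e f x; set b := trunc_hilbert e g x.
  by rewrite -subr_ge0 (_ : _ - _ = (a - 2 * b) ^+ 2) ?sqr_ge0//; ring.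
have s0 (F : R -> R) x : 0 <= F x ^+ 2 by rewrite sqr_ge0.
rewrite ge0_integralDT; [|by meas|by meas|by move=> x; rewrite mulr_ge0|by move=> x; rewrite mulr_ge0].
rewrite ge0_integralZT; [|by meas|by []|by []]; rewrite ge0_integralZT; [|by meas|by []|by []].
apply: (@le_trans _ _ (2%:E * (A%:E * \int[mu]_t (g t ^+ 2)%:E) + 2%:E * ((9 * K)%:E * \int[mu]_t (g t ^+ 2)%:E))%E).
  by apply: leeD; rewrite lee_wpmul2l// trunc_le.
have k0 : (0 <= (9 * K)) by rewrite !mulr_ge0.
by rewrite !muleA -ge0_muleDl -?EFinM ?lee_fin ?mulr_ge0// -EFinD.
Qed.

Lemma weighted_trunc_hilbert_L4 : exists2 K : R, 0 <= K & forall (phi f : R -> R) (e B : R),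
  measurable_fun setT phi -> measurable_fun setT f ->
  (forall x, 0 < phi x) -> (forall x, phi x <= B) -> slow_weight phi -> 0 < e ->
  (\int[mu]_t (f t ^+ 4)%:E < +oo)%E ->
  (\int[mu]_x ((phi x * trunc_hilbert e f x) ^+ 4)%:E <=
   K%:E * \int[mu]_t ((phi t * f t) ^+ 4)%:E)%E.
Proof.
have [K K0 happly_le] := happly_L4.
have [A A0 trunc_le] := @trunc_hilbert_L4 R.
exists (8 * A + 8 * (3 * 3 * (3 * 3) * K)) => [|phi f e B].
  by rewrite addr_ge0// !mulr_ge0.
move=> mphi mf phi0 phiB slow e0 foo.
have pow4_ge0 (a : R) : 0 <= a ^+ 4 by rewrite (exprM a 2 2) sqr_ge0.
have p4 (z : \bar R) : (z ^+ 4 = (z ^+ 2) ^+ 2)%E.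
  by rewrite !expeS !expe0 !mule1 -!muleA.
have c2 (c : R) (z : \bar R) : ((c%:E * z) ^+ 2 = (c * c)%:E * z ^+ 2)%E.
  by rewrite !expe2 muleACA -EFinM.
have c4 (c : R) (z : \bar R) : (((c%:E * z) ^+ 2) ^+ 2 = (c * c * (c * c))%:E * ((z ^+ 2) ^+ 2))%E.
  by rewrite c2 c2.
pose g t := phi t * f t; have mg : measurable_fun setT g by rewrite /g; meas.
have mT := measurable_trunc_hilbert e mf; have mTg := measurable_trunc_hilbert e mg.
pose S x := phi x * trunc_hilbert e f x - trunc_hilbert e g x.
have mS : measurable_fun setT S by rewrite /S; meas.
have mh4 : measurable_fun setT (fun x => happly g x ^+ 4)%E.
  by under eq_fun do rewrite p4; do 2 apply: measurable_ereal_sqr; exact: measurable_happly.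
have hS : (\int[mu]_x (S x ^+ 4)%:E <= (3 * 3 * (3 * 3) * K)%:E * \int[mu]_t (g t ^+ 4)%:E)%E.
  apply: (@le_trans _ _ (\int[mu]_x ((3 * 3 * (3 * 3))%:E * happly g x ^+ 4))%E).
    apply: ge0_le_integralT; first by meas.
    - exact: measurable_funeM.
    - by move=> x; rewrite lee_fin.
    - move=> x; rewrite (exprM _ 2 2) -(real_normK (num_real (S x))) -exprM EFin_expe !p4.
      have h := commutator_le mphi mf phi0 phiB slow e0 (isT : ~~ odd 4) isT foo x.
      apply: (@le_trans _ _ (((3%:E * happly g x) ^+ 2) ^+ 2)%E).
        by apply: esqr_le; [rewrite expe_ge0|apply: esqr_le h].
      by rewrite c4.
  rewrite ge0_integralZl//.
  - by rewrite (EFinM (3 * 3 * (3 * 3)) K) -muleA lee_wpmul2l// happly_le.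
  - by move=> x _; rewrite expe_ge0// happly_ge0.
apply: (@le_trans _ _ (\int[mu]_x (8 * trunc_hilbert e g x ^+ 4 + 8 * S x ^+ 4)%:E)%E).
  apply: le_integralT; [by meas|by meas|by []|move=> x].
  rewrite /S; set a := _ * trunc_hilbert e f x; set b := trunc_hilbert e g x.
  rewrite -subr_ge0.
  have -> : 8 * b ^+ 4 + 8 * (a - b) ^+ 4 - a ^+ 4 =
     (a - 2 * b) ^+ 2 * (6 * a ^+ 2 + (a - 2 * b) ^+ 2) by ring.
  by rewrite mulr_ge0 ?sqr_ge0// addr_ge0 ?sqr_ge0// mulr_ge0// sqr_ge0.
rewrite ge0_integralDT; [|by meas|by meas|by move=> x; rewrite mulr_ge0|by move=> x; rewrite mulr_ge0].
rewrite ge0_integralZT; [|by meas|by []|by []]; rewrite ge0_integralZT; [|by meas|by []|by []].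
have k0 : (0 <= (3 * 3 * (3 * 3) * K)) by rewrite !mulr_ge0.
apply: (@le_trans _ _ (8%:E * (A%:E * \int[mu]_t (g t ^+ 4)%:E) + 8%:E * ((3 * 3 * (3 * 3) * K)%:E * \int[mu]_t (g t ^+ 4)%:E))%E).
  by apply: leeD; rewrite lee_wpmul2l// trunc_le.
by rewrite !muleA -ge0_muleDl -?EFinM ?lee_fin ?mulr_ge0// -EFinD.
Qed.

End weighted_bounds.

(** * Maximal truncations *)

Section maximal_truncation.
Context {R : realType}.
Local Notation mu := (@lebesgue_measure R).
Implicit Types (f g : R -> R).

Definition far_integrable (e : R) f := forall x, mu.-integrable setT (EFin \o (fun t : R => f t * tkernel e (t - x))).

Lemma L2_far_integrable (e : R) f : 0 < e -> measurable_fun setT f ->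
  (\int[mu]_t (f t ^+ 2)%:E < +oo)%E -> far_integrable e f.
Proof.
move=> e0 mf foo x; apply: (@integrable_far _ f (fun=> 2)) => //.
  by move=> _; rewrite lexx; lra.
by under eq_integral do rewrite powR_mulrn// real_normK ?num_real//.
Qed.

Lemma trunc_hilbertD (e : R) f g x : far_integrable e f -> far_integrable e g ->
  trunc_hilbert e (fun t => f t + g t) x = trunc_hilbert e f x + trunc_hilbert e g x.
Proof.
move=> fi gi; rewrite /trunc_hilbert -RintegralD//.
by apply: eq_Rintegral => t _; rewrite mulrDl.
Qed.

Section cotlar.
Variables (f : R -> R) (e h x k : R).
Hypotheses (mf : measurable_fun setT f) (foo : (\int[mu]_t (f t ^+ 2)%:E < +oo)%E).
Hypotheses (h0 : 0 < h) (he : 2 * h <= e) (k0 : 0 < k).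
Hypothesis avg : forall r : R, 0 < r ->
  (\int[mu]_t (if `|t - x| <= r then f t ^+ 2 else 0)%:E <= (k * r)%:E)%E.

Let e0 : 0 < e. Proof. by have := h0; have := he; lra. Qed.

Let near t := if `|t - x| <= e then f t else 0.

Let mnear : measurable_fun setT near. Proof. by rewrite /near; meas. Qed.

Let near_L2 : (\int[mu]_t (near t ^+ 2)%:E <= (k * e)%:E)%E.
Proof.
rewrite (le_trans _ (avg e0))//; apply: le_integralT; [by meas|by meas|by move=> t; rewrite sqr_ge0|].
by move=> t; rewrite /near; case: ifP => // _; rewrite expr0n.
Qed.

Let s := Num.sqrt k.

Let s0 : 0 < s. Proof. by rewrite sqrtr_gt0. Qed.

Let ss : s ^+ 2 = k. Proof. by rewrite sqr_sqrtr// ltW. Qed.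

(** From 2 s |f| <= f ^ 2 + s ^ 2 with s ^ 2 = k, the averages of |f| are at most
  3 / 2 s per unit radius. *)
Let tail_f : (\int[mu]_t (if e < `|t - x| then `|f t| * (e / (t - x) ^+ 2) else 0)%:E <= (4 * (3 / 2 * s))%:E)%E.
Proof.
apply: tail_le_averages => //; [by meas|by rewrite mulr_ge0 ?(ltW s0)|].
move=> r r0.
apply: (@le_trans _ _ (\int[mu]_t ((2 * s)^-1 * (if `|t - x| <= r then f t ^+ 2 else 0) +
   (if `|t - x| <= r then s / 2 else 0))%:E)%E).
  apply: le_integralT; [by meas|by meas|by move=> t; case: ifP|move=> t].
  case: ifP => _; last by rewrite mulr0 addr0.
  rewrite -subr_ge0 (_ : _ - _ = (`|f t| - s) ^+ 2 / (2 * s)); last first.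
    by rewrite -(real_normK (num_real (f t))); field; rewrite gt_eqF.
  by rewrite divr_ge0 ?sqr_ge0// mulr_ge0// ltW.
have i0 : 0 <= (2 * s)^-1 by rewrite invr_ge0 mulr_ge0// ltW.
rewrite ge0_integralDT; [|by meas|by meas| |]; last 2 first.
- by move=> t; rewrite mulr_ge0//; case: ifP => // _; rewrite sqr_ge0.
- by move=> t; case: ifP => // _; rewrite divr_ge0// ltW.
rewrite ge0_integralZT//; [|by meas|by move=> t; case: ifP => // _; rewrite sqr_ge0].
rewrite integral_ball_cst ?(ltW r0)//.
apply: (@le_trans _ _ ((2 * s)^-1%:E * (k * r)%:E + (s / 2 * (2 * r))%:E)%E).
  by rewrite leeD2r// lee_wpmul2l// avg.
rewrite -EFinM -EFinD lee_fin -ss le_eqVlt; apply/orP; left; apply/eqP.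
by field; rewrite gt_eqF.
Qed.

(** At a point z near x the kernel at distance h, applied to the far part of f,
  differs from the kernel at x by a smooth tail, bounded by the averages of |f|;
  the far part at z is the transform of f minus that of its near part. *)
Lemma cotlar_pointwise (z : R) : `|z - x| <= e / 4 ->
  `|trunc_hilbert e f x| <= 2 * s + `|trunc_hilbert h f z| + `|trunc_hilbert h near z|.
Proof.
move=> zx.
have di := L2_far_integrable e0 mf foo x.
have ai := L2_far_integrable h0 mf foo z.
have bi := L2_far_integrable h0 mnear (le_lt_trans near_L2 (ltry _)) z.
set D := trunc_hilbert e f x; set A := trunc_hilbert h f z; set B := trunc_hilbert h near z.
suff : `|D - A + B| <= 2 * s.
  move=> H; have -> : D = (D - A + B) + A - B by ring.
  by rewrite (le_trans (ler_normB _ _))// lerD2r (le_trans (ler_normD _ _))// lerD2r.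
have dai := integrableB measurableT di ai.
rewrite /D /A /B /trunc_hilbert -RintegralB// -RintegralD//.
apply: Rintegral_abs_le; first exact: (integrableD measurableT dai bi).
apply: (@le_trans _ _ (\int[mu]_t (3^-1 * (if e < `|t - x| then `|f t| * (e / (t - x) ^+ 2) else 0))%:E)%E).
  apply: le_integralT; [by rewrite /tkernel; meas|by meas|by []|move=> t].
  rewrite /near /tkernel; case: ltP => et; last by rewrite !mulr0 sub0r addNr normr0.
  have u0 : 0 < `|t - x| by exact: lt_trans et.
  have vu : 3 / 4 * `|t - x| <= `|t - z|.
    have := ler_distD z t x; rewrite (distrC z x) => h1.
    have := distrC x z; move: zx; lra.
  have hz : h < `|t - z| by have := he; have := h0; lra.
  have v0 : 0 < `|t - z| by exact: lt_trans hz.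
  rewrite hz mul0r addr0 -mulrBr normrM mulrCA ler_wpM2l//.
  have -> : (t - x)^-1 - (t - z)^-1 = (x - z) / ((t - x) * (t - z)).
    by field; rewrite -!normr_gt0 v0.
  rewrite normrM normfV normrM distrC ler_pdivrMr ?mulr_gt0//.
  rewrite -(real_normK (num_real (t - x))).
  apply: (@le_trans _ _ (e / 4)) => //.
  apply: (@le_trans _ _ (3^-1 * (e / `|t - x| ^+ 2) * (`|t - x| * (3 / 4 * `|t - x|)))); last first.
    by rewrite !ler_wpM2l// mulr_ge0// divr_ge0 ?sqr_ge0// ltW.
  by rewrite le_eqVlt; apply/orP; left; apply/eqP; field; rewrite gt_eqF.
rewrite ge0_integralZT; [|by meas| |by []]; last first.
  by move=> t; case: ifP => // _; rewrite mulr_ge0// divr_ge0 ?sqr_ge0// ltW.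
apply: (@le_trans _ _ (3^-1%:E * (4 * (3 / 2 * s))%:E)%E); first by rewrite lee_wpmul2l.
by rewrite -EFinM lee_fin le_eqVlt; apply/orP; left; apply/eqP; field.
Qed.

(** Cotlar's inequality. The pointwise bound is squared and averaged over the ball
  |z - x| <= e / 4: the average of the finer transform is bounded by hypothesis,
  and that of the local one by its L^2 norm. *)
Lemma cotlar (K : R) :
  (\int[mu]_z (trunc_hilbert h near z ^+ 2)%:E <= K%:E * \int[mu]_t (near t ^+ 2)%:E)%E ->
  0 <= K ->
  (forall r : R, 0 < r ->
    (\int[mu]_t (if `|t - x| <= r then trunc_hilbert h f t ^+ 2 else 0)%:E <= (k * r)%:E)%E) ->
  trunc_hilbert e f x ^+ 2 <= (27 / 2 + 6 * K) * k.
Proof.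
move=> hK K0 avgT.
have mTf := measurable_trunc_hilbert h mf; have mTn := measurable_trunc_hilbert h mnear.
set T := trunc_hilbert e f x; have e40 : 0 < e / 4 by rewrite divr_gt0.
have ineq : (\int[mu]_z (if `|z - x| <= e / 4 then T ^+ 2 else 0)%:E <=
  \int[mu]_z (3 * ((if `|z - x| <= e / 4 then 4 * k else 0) +
    ((if `|z - x| <= e / 4 then trunc_hilbert h f z ^+ 2 else 0) + trunc_hilbert h near z ^+ 2)))%:E)%E.
  apply: le_integralT; [by meas|by meas|by move=> z; case: ifP => // _; rewrite sqr_ge0|move=> z].
  case: ifP => zx; last by rewrite !add0r mulr_ge0// sqr_ge0.
  have := cotlar_pointwise zx; rewrite -/T => TT.
  rewrite -ss -(real_normK (num_real T)) -(real_normK (num_real (trunc_hilbert h f z))).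
  rewrite -(real_normK (num_real (trunc_hilbert h near z))).
  set a := `|trunc_hilbert h f z| in TT *; set b := `|trunc_hilbert h near z| in TT *.
  apply: (@le_trans _ _ ((2 * s + a + b) ^+ 2)).
    by rewrite ler_sqr ?nnegrE// (le_trans _ TT).
  rewrite -subr_ge0 (_ : _ - _ = (2 * s - a) ^+ 2 + (2 * s - b) ^+ 2 + (a - b) ^+ 2); last by ring.
  by rewrite !addr_ge0// sqr_ge0.
have i1 : forall z : R, 0 <= (if `|z - x| <= e / 4 then trunc_hilbert h f z ^+ 2 else 0).
  by move=> z; case: ifP => // _; rewrite sqr_ge0.
have i2 : forall z : R, 0 <= (if `|z - x| <= e / 4 then 4 * k else 0).
  by move=> z; case: ifP => // _; rewrite mulr_ge0// ltW.
move: ineq; rewrite integral_ball_cst ?(ltW e40)//.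
rewrite ge0_integralZT; [|by meas| |by []]; last first.
  by move=> z; rewrite !addr_ge0 ?sqr_ge0.
rewrite ge0_integralDT; [|by meas|by meas|by []|by move=> z; rewrite addr_ge0 ?sqr_ge0].
rewrite ge0_integralDT; [|by meas|by meas|by []|by move=> z; rewrite sqr_ge0].
rewrite integral_ball_cst ?(ltW e40)//.
move=> ineq; have := avgT _ e40 => hT.
have := le_trans hK (lee_wpmul2l _ near_L2); rewrite lee_fin => /(_ K0) hN.
have {ineq}ineq := le_trans ineq (lee_wpmul2l _ (leeD2l _ (leeD hT hN))).
have {}ineq : T ^+ 2 * (2 * (e / 4)) <= 3 * (4 * k * (2 * (e / 4)) + (k * (e / 4) + K * (k * e))).
  by rewrite -lee_fin; apply: ineq; rewrite lee_fin.
have : T ^+ 2 * (2 * (e / 4)) <= (27 / 2 + 6 * K) * k * (2 * (e / 4)).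
  by apply: (le_trans ineq); rewrite le_eqVlt; apply/orP; left; apply/eqP; field.
by rewrite ler_pM2r// mulr_gt0.
Qed.

End cotlar.

Lemma HL_maximal_ball g (c x : R) : locally_integrable setT g -> (forall t, 0 <= g t) ->
  (HL_maximal g x <= c%:E)%E -> forall r : R, 0 < r ->
  (\int[mu]_t (if `|t - x| <= r then g t else 0)%:E <= (4 * c * r)%:E)%E.
Proof.
move=> lg g0 hc r r0; have mg : measurable_fun setT g by case: lg.
have r20 : 0 < 2 * r by rewrite mulr_gt0.
have : (iavg g (ball x (2 * r)) <= c%:E)%E.
  apply: le_trans hc; apply: ereal_sup_ubound; exists (2 * r) => //=.
  by rewrite in_itv/= r20.
rewrite /iavg lebesgue_measure_ball ?(ltW r20)// inver gt_eqF ?mulrn_wgt0//.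
rewrite lee_pdivrMl ?mulrn_wgt0// => h.
apply: (@le_trans _ _ (\int[mu]_(t in ball x (2 * r)) `|(g t)%:E|)%E).
  rewrite integral_EFin_ifE (eq_integralR (g := fun t => `|(g t)%:E|%E)); last first.
    by move=> t _; rewrite /= ger0_norm.
  apply: ge0_subset_integral => //.
  - by rewrite set_ball_itv.
  - exact: measurable_ball.
  - by apply: measurable_funTS; apply: measurableT_comp => //; exact: measurable_EFin.
  - by move=> t /= tx; rewrite /ball/= distrC; lra.
by apply: (le_trans h); rewrite -EFinM lee_fin -[_ *+ 2]mulr_natl; lra.
Qed.

Lemma sqr_locally_integrable f : measurable_fun setT f -> (\int[mu]_t (f t ^+ 2)%:E < +oo)%E ->
  locally_integrable setT (fun t => f t ^+ 2).
Proof.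
move=> mf foo; apply: open_integrable_locally; first exact: openT.
apply: (@integrable_of_bound _ _ (fun t => f t ^+ 2)); [by meas|by meas| |by []].
by move=> t; rewrite ger0_norm// sqr_ge0.
Qed.

(** Cotlar's inequality compares the truncation at e with a finer one at scale
  1 / (n + 1). For each n the exceptional set is where the maximal function of f ^ 2
  or of the square of the finer transform is large; the bound has to hold for all
  e, hence for large n, and the lower limit of these sets has no more measure than the
  common bound. *)
Lemma weak_type_maximal : exists2 K : R, 0 <= K & forall f (c : R),
  measurable_fun setT f -> (\int[mu]_t (f t ^+ 2)%:E < +oo)%E -> 0 < c ->
  exists E : set R, [/\ measurable E, (mu E <= (K / c)%:E * \int[mu]_t (f t ^+ 2)%:E)%E &
    forall x, ~ E x -> forall e : R, 0 < e -> trunc_hilbert e f x ^+ 2 <= c].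
Proof.
have [K K0 trunc_le] := @trunc_hilbert_L2 R.
pose C := (27 / 2 + 6 * K) * 4.
have C0 : 0 < C by rewrite /C; lra.
exists (3 * C * (1 + K)) => [|f c mf foo c0]; first by rewrite !mulr_ge0 ?(ltW C0)//; lra.
pose T n := trunc_hilbert (n.+1%:R^-1) f.
have n0 n : 0 < (n.+1%:R^-1 : R) by rewrite invr_gt0.
have mT n : measurable_fun setT (T n) by exact: measurable_trunc_hilbert.
have Too n : (\int[mu]_t (T n t ^+ 2)%:E < +oo)%E.
  by rewrite (le_lt_trans (trunc_le _ _ (n0 n) mf))// lte_mul_pinfty.
have c'0 : 0 < c / C by rewrite divr_gt0.
have lf := sqr_locally_integrable mf foo.
have lT n := sqr_locally_integrable (mT n) (Too n).
pose bad g := [set x | ((c / C)%:E < HL_maximal (fun t => g t ^+ 2)%R x)%E].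
have mbad g : locally_integrable setT (fun t => g t ^+ 2) -> measurable (bad g).
  move=> lg; rewrite -[X in measurable X]setTI; apply: emeasurable_fun_o_infty => //.
  exact: measurable_HL_maximal.
have bad_le g : locally_integrable setT (fun t => g t ^+ 2) ->
    (mu (bad g) <= (3 * C / c)%:E * \int[mu]_t (g t ^+ 2)%:E)%E.
  move=> lg; apply: (le_trans (maximal_inequality lg c'0)).
  rewrite le_eqVlt; apply/orP; left; apply/eqP; congr (_ * _)%E.
    by congr EFin; field; rewrite !gt_eqF.
  by apply: eq_integralR => t _; rewrite /= ger0_norm// sqr_ge0.
pose G n := bad f `|` bad (T n).
have mG n : measurable (G n) by apply: measurableU; exact: mbad.
have G_le n : (mu (G n) <= (3 * C * (1 + K) / c)%:E * \int[mu]_t (f t ^+ 2)%:E)%E.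
  have hU : (mu (G n) <= mu (bad f) + mu (bad (T n)))%E by apply: measureU2; exact: mbad.
  apply: (le_trans hU).
  have k0 : (0 <= (3 * C / c)%:E)%E by rewrite lee_fin divr_ge0 ?(ltW c0)// mulr_ge0// (ltW C0).
  have hT := le_trans (bad_le _ (lT n)) (lee_wpmul2l k0 (trunc_le _ _ (n0 n) mf)).
  apply: (le_trans (leeD (bad_le _ lf) hT)).
  rewrite muleA -EFinM -ge0_muleDl; [|by []|by rewrite EFinM mule_ge0].
  rewrite -EFinD le_eqVlt; apply/orP; left; apply/eqP; congr (_%:E * _)%E.
  by field; rewrite gt_eqF.
pose F N := \bigcap_(n in [set n | (N <= n)%N]) G n.
have mF N : measurable (F N) by apply: bigcap_measurableType => n _; exact: mG.
have mE : measurable (\bigcup_N F N) by exact: bigcup_measurable.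
exists (\bigcup_N F N); split => //.
  have ndF : nondecreasing_seq F.
    move=> m n mn; apply/subsetPset => x Fx k /= nk; apply: Fx => /=; exact: leq_trans nk.
  have cv : mu (F n) @[n --> \oo] --> mu (\bigcup_N F N) by exact: nondecreasing_cvg_mu.
  rewrite -(cvg_lim _ cv)//; apply: lime_le; first by apply/cvg_ex; eexists; exact: cv.
  apply: nearW => n /=; apply: le_trans (G_le n); apply: le_measure; rewrite ?inE; [exact: mF|exact: mG|].
  by move=> x /(_ n); apply => /=.
move=> x xE e e0.
pose N := Num.truncn (2 / e).
have [n Nn xG] : exists2 n, (N <= n)%N & ~ G n x.
  apply/not_exists2P => H; apply: xE; exists N => // n /= Nn.
  by have [|/contrapT] := H n.
have [xf xT] : ~ bad f x /\ ~ bad (T n) x by split => h; apply: xG; [left|right].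
move/negP : xf; rewrite -leNgt => xf; move/negP : xT; rewrite -leNgt => xT.
have hn : 2 * n.+1%:R^-1 <= e.
  rewrite ler_pdivrMr// -ler_pdivrMl// mulrC.
  by rewrite (le_trans (ltW (truncnS_gt _)))// ler_nat.
have k0 : 0 < 4 * (c / C) by rewrite mulr_gt0.
have s0 g t : 0 <= g t ^+ 2 :> R by rewrite sqr_ge0.
have := @cotlar f e (n.+1%:R^-1) x (4 * (c / C)) mf foo (n0 n) hn k0
  (HL_maximal_ball lf (s0 _) xf) K (trunc_le _ _ (n0 n) _) K0 (HL_maximal_ball (lT n) (s0 _) xT).
move=> H; apply: (le_trans (H _)); first by meas.
have {2}-> : c = C * (c / C) by rewrite mulrC divfK// gt_eqF.
by move: (c / C) => q; rewrite /C [leLHS]mulrA.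
Qed.

Definition annulus_kernel (a b u : R) : R := tkernel a u - tkernel b u.

Lemma annulus_kernelE (a b u : R) : a <= b ->
  annulus_kernel a b u = if a < `|u| then if `|u| <= b then u^-1 else 0 else 0.
Proof.
move=> ab; rewrite /annulus_kernel /tkernel; case: ltP => au.
  by case: ltP => bu; rewrite ?subrr ?subr0.
by rewrite ifN ?subrr// -leNgt (le_trans au).
Qed.

Lemma norm_annulus_kernel (a b u : R) : 0 < a -> a <= b ->
  `|annulus_kernel a b u| <= if `|u| <= b then a^-1 else 0.
Proof.
move=> a0 ab; rewrite annulus_kernelE//; case: ltP => au.
  case: ifP => _; rewrite ?normr0// normfV lef_pV2 ?posrE ?(ltW au)//.
  exact: lt_trans au.
by rewrite normr0; case: ifP => // _; rewrite invr_ge0 ltW.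
Qed.

(** The kernel is odd; the two halves integrate to opposite logarithms. *)
Lemma integral_annulus_kernel (x a b : R) : 0 < a -> a <= b ->
  mu.-integrable setT (EFin \o (fun t : R => annulus_kernel a b (t - x))) /\
  \int[mu]_t annulus_kernel a b (t - x) = 0.
Proof.
move=> a0 ab; have b0 := lt_le_trans a0 ab.
pose kR (t : R) : R := if a < t - x <= b then (t - x)^-1 else 0.
pose kL (t : R) : R := if - b <= t - x < - a then (t - x)^-1 else 0.
have bound_le (k : R -> R) : measurable_fun setT k ->
    (forall t, `|k t| <= if `|t - x| <= b then a^-1 else 0) -> mu.-integrable setT (EFin \o k).
  move=> mk kb; apply: (integrable_of_bound mk _ kb); first by meas.
  by rewrite integral_ball_cst ?ltry// ltW.
have ki : mu.-integrable setT (EFin \o (fun t : R => annulus_kernel a b (t - x))).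
  apply: bound_le; first by rewrite /annulus_kernel /tkernel; meas.
  by move=> t; exact: norm_annulus_kernel.
split => //.
have mR : measurable_fun setT kR.
  by rewrite /kR; meas.
have mL : measurable_fun setT kL.
  by rewrite /kL; meas.
have kLR t : annulus_kernel a b (t - x) = kR t + kL t.
  rewrite annulus_kernelE// /kR /kL.
  have [tx|tx] := leP 0 (t - x).
    rewrite ger0_norm//.
    have -> : (- b <= t - x < - a) = false by apply/negbTE; rewrite negb_and -!ltNge -!leNgt; apply/orP; right; lra.
    by rewrite addr0; case: (a < t - x).
  rewrite ltr0_norm//.
  have -> : (a < t - x <= b) = false by apply/negbTE; rewrite negb_and -!ltNge -!leNgt; apply/orP; left; lra.
  by rewrite add0r ltrNr lerNl andbC; case: (t - x < - a).
have kRi : mu.-integrable setT (EFin \o kR).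
  apply: bound_le => // t; apply: le_trans (norm_annulus_kernel (t - x) a0 ab).
  rewrite kLR /kL /kR; case: ifP => [/andP[h1 h2]|_]; last by rewrite normr0.
  by rewrite ifN ?addr0// negb_and -!ltNge -!leNgt; apply/orP; right; lra.
have kLi : mu.-integrable setT (EFin \o kL).
  apply: bound_le => // t; apply: le_trans (norm_annulus_kernel (t - x) a0 ab).
  rewrite kLR /kL /kR; case: ifP => [/andP[h1 h2]|_]; last by rewrite normr0.
  by rewrite ifN ?add0r// negb_and -!ltNge -!leNgt; apply/orP; left; lra.
have cont (t : R) : t - x != 0 -> {for t, continuous (fun t : R => (t - x)^-1)}.
  by move=> tx; apply: cvgV => //; apply: cvgB => //; exact: cvg_cst.
have IR : (\int[mu]_t (kR t)%:E = (ln b - ln a)%:E)%E.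
  rewrite integral_EFin_ifE (_ : [set t | a < t - x <= b] = `]x + a, x + b]%classic); last first.
    by apply/seteqP; split => t /=; rewrite in_itv/= ltrBrDl lerBlDl.
  rewrite integral_itv_obnd_cbnd; last by apply: measurable_funTS; meas.
  apply: (eq_trans (@FTC_is_derive _ (fun t : R => (t - x)^-1) (fun t : R => ln (t - x)) (x + a) (x + b) _ _ _)).
  - by rewrite lerD2l.
  - by move=> t /andP[h1 h2]; apply: cont; rewrite gt_eqF//; lra.
  - move=> t /andP[h1 h2]; have tx : 0 < t - x by lra.
    have d1 : is_derive t (1:R) (fun t : R => t - x) 1.
      by apply: is_derive_eq; rewrite subr0.
    have := @is_derive1_comp _ (@ln R) (fun t : R => t - x) t _ _ (is_derive1_ln tx) d1.
    by rewrite mulr1.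
  - by rewrite ![x + _ - x]addrAC !subrr !add0r.
have IL : (\int[mu]_t (kL t)%:E = (ln a - ln b)%:E)%E.
  rewrite integral_EFin_ifE (_ : [set t | - b <= t - x < - a] = `[x - b, x - a[%classic); last first.
    by apply/seteqP; split => t /=; rewrite in_itv/= ltrBlDl lerBrDl.
  rewrite integral_itv_bndo_bndc; last by apply: measurable_funTS; meas.
  apply: (eq_trans (@FTC_is_derive _ (fun t : R => (t - x)^-1) (fun t : R => ln (x - t)) (x - b) (x - a) _ _ _)).
  - by rewrite lerD2l lerN2.
  - by move=> t /andP[h1 h2]; apply: cont; rewrite lt_eqF//; lra.
  - move=> t /andP[h1 h2]; have tx : 0 < x - t by lra.
    have d1 : is_derive t (1:R) (fun t : R => x - t) (-1).
      by rewrite -[X in is_derive _ _ _ X]sub0r; exact: is_deriveB.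
    have := @is_derive1_comp _ (@ln R) (fun t : R => x - t) t _ _ (is_derive1_ln tx) d1.
    by rewrite mulrN1 -invrN opprB.
  - by rewrite !subKr.
under eq_Rintegral do rewrite kLR.
rewrite RintegralD//; apply: EFin_inj; rewrite EFinD !Rintegral_EFin// IR IL -EFinD.
by congr EFin; ring.
Qed.

(** As the annulus kernel has integral 0, g may be replaced by g - g x, which
  the Lipschitz condition bounds by L |t - x| on the annulus. *)
Lemma lipschitz_oscillation g (L x a b : R) : measurable_fun setT g ->
  (\int[mu]_t (g t ^+ 2)%:E < +oo)%E -> 0 <= L ->
  (forall s t, `|g s - g t| <= L * `|s - t|) -> 0 < a -> a <= b ->
  `|trunc_hilbert a g x - trunc_hilbert b g x| <= 2 * L * b.
Proof.
move=> mg goo L0 lip a0 ab; have b0 := lt_le_trans a0 ab.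
have ai := L2_far_integrable a0 mg goo x; have bi := L2_far_integrable b0 mg goo x.
have [ki k0] := integral_annulus_kernel x a0 ab.
have gki : mu.-integrable setT (EFin \o (fun t : R => g x * annulus_kernel a b (t - x))).
  exact: (integrableZl measurableT (g x) ki).
have -> : trunc_hilbert a g x - trunc_hilbert b g x =
   \int[mu]_t (g t * tkernel a (t - x) - g t * tkernel b (t - x) - g x * annulus_kernel a b (t - x)).
  rewrite RintegralB//; last exact: (integrableB measurableT ai bi).
  by rewrite RintegralB// RintegralZl// k0 mulr0 subr0.
apply: Rintegral_abs_le.
  exact: (integrableB measurableT (integrableB measurableT ai bi) gki).
apply: (@le_trans _ _ (\int[mu]_t (if `|t - x| <= b then L else 0)%:E)%E); last first.
  by rewrite integral_ball_cst ?(ltW b0)// lee_fin; lra.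
apply: le_integralT; [by rewrite /annulus_kernel /tkernel; meas|by meas|by []|move=> t].
rewrite -mulrBr -/(annulus_kernel a b (t - x)) -mulrBl normrM annulus_kernelE//.
case: ltP => at_; last by rewrite normr0 mulr0; case: ifP.
case: ifP => _; last by rewrite normr0 mulr0.
have u0 : 0 < `|t - x| by exact: lt_trans at_.
by rewrite normfV ler_pdivrMr.
Qed.

End maximal_truncation.

(** * Almost everywhere existence of principal values *)

Section lipschitz_functions_are_dense.
Context {R : realType}.
Local Notation mu := (@lebesgue_measure R).
Implicit Types (f g : R -> R).

Lemma ae_imply (P Q : R -> Prop) : (forall x, P x -> Q x) ->
  {ae mu, forall x, P x} -> {ae mu, forall x, Q x}.
Proof.
move=> PQ [N [mN N0 PN]]; exists N; split => // x nQ; apply: PN => Px.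
by apply: nQ; exact: PQ.
Qed.

Lemma ae_forall_nat (P : nat -> R -> Prop) : (forall n, {ae mu, forall x, P n x}) ->
  {ae mu, forall x, forall n, P n x}.
Proof.
move=> aeP; apply: (@negligibleS _ _ _ mu (\bigcup_n ~` [set x | P n x])).
  by move=> x /existsNP[n nP]; exists n.
by apply: negligible_bigcup => n; exact: aeP.
Qed.

Definition lipschitz_cst (L : R) g := forall s t : R, `|g s - g t| <= L * `|s - t|.

Lemma lipschitz_measurable (L : R) g : 0 <= L -> lipschitz_cst L g -> measurable_fun setT g.
Proof.
move=> L0 lip; apply: continuous_measurable_fun => x; apply/cvgrPdist_lt => e e0.
have L10 : 0 < L + 1 by lra.
near=> t; apply: (le_lt_trans (lip x t)).
apply: (@le_lt_trans _ _ ((L + 1) * `|x - t|)); first by rewrite ler_wpM2r//; lra.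
rewrite mulrC -ltr_pdivlMr//; near: t.
by apply: cvgr_dist_lt; rewrite ?divr_gt0.
Unshelve. all: by end_near. Qed.

Section difference_quotients.
Variables (h : R -> R) (M r : R).
Hypotheses (mh : measurable_fun setT h) (hM : forall t, `|h t| <= M).
Hypotheses (r0 : 0 <= r) (hr : forall t, r < `|t| -> h t = 0).

Let M0 : 0 <= M. Proof. exact: le_trans (normr_ge0 _) (hM 0). Qed.

Let hi : mu.-integrable setT (EFin \o h).
Proof.
apply: (@integrable_of_bound _ _ (fun t => if `|t - 0| <= r then M else 0)) => //.
- by meas.
- move=> t; rewrite subr0; case: (leP `|t| r) => rt //.
  by rewrite hr// normr0.
- by rewrite integral_ball_cst// ltry.
Qed.

Let hiD (D : set R) : measurable D -> mu.-integrable D (EFin \o h).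
Proof. by move=> mD; apply: integrableS hi. Qed.

Definition primitive (x : R) : R := \int[mu]_(t in [set` `]-oo, x]]) h t.

Let Phi := primitive.

Let PhiB (x y : R) : x <= y -> Phi y - Phi x = \int[mu]_(t in [set` `]x, y]]) h t.
Proof. by move=> xy; rewrite /Phi /primitive Rintegral_itvB// ?bnd_simp//; exact: hiD. Qed.

Let Phi_le (x y : R) : x <= y -> `|Phi y - Phi x| <= M * (y - x).
Proof.
move=> xy; rewrite PhiB//; apply: le_trans (le_normr_Rintegral _ (hiD _)) _ => //.
have ci : mu.-integrable [set` `]x, y]] (EFin \o (fun _ : R => M)).
  apply/integrableP; split; first exact: measurable_cst.
  rewrite /= integral_cst//= lebesgue_measure_itv/=.
  by case: ifP => _; rewrite ?mule0 ?ltry// -EFinB -EFinM ltry.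
apply: le_trans (@le_Rintegral _ _ _ mu _ _ (fun=> M) _ _ ci _) _ => //.
- by apply: integrable_norm; exact: hiD.
- rewrite Rintegral_cst//= lebesgue_measure_itv/= lte_fin.
  move: xy; rewrite le_eqVlt => /predU1P[->|xy]; first by rewrite ltxx subrr.
  by rewrite xy.
Qed.

Let Phi_lip : lipschitz_cst M Phi.
Proof.
move=> x y; have [xy|/ltW xy] := leP y x.
  by rewrite (ger0_norm (_ : 0 <= x - y)) ?subr_ge0// Phi_le.
by rewrite distrC (distrC x) (ger0_norm (_ : 0 <= y - x)) ?subr_ge0// Phi_le.
Qed.

Definition quotient (k : nat) (x : R) : R := k.+1%:R * (Phi (x + k.+1%:R^-1) - Phi x).

Let k0 (k : nat) : 0 < (k.+1%:R^-1 : R). Proof. by rewrite invr_gt0. Qed.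

Lemma quotient_lipschitz k : lipschitz_cst (k.+1%:R * (2 * M)) (quotient k).
Proof.
move=> x y; rewrite /quotient -mulrBr normrM ger0_norm// -mulrA ler_wpM2l//.
have := Phi_lip (x + k.+1%:R^-1) (y + k.+1%:R^-1).
rewrite (_ : x + _ - _ = x - y); last by ring.
have := Phi_lip x y.
set a := Phi (x + _); set b := Phi (y + _); set c := Phi x; set d := Phi y => h1 h2.
rewrite (_ : a - c - (b - d) = (a - b) - (c - d)); last by ring.
by apply: (le_trans (ler_normB _ _)); lra.
Qed.

Lemma quotient_bound k x : `|quotient k x| <= M.
Proof.
rewrite /quotient normrM ger0_norm// mulrC -ler_pdivlMr//.
apply: le_trans (Phi_le _) _; first by rewrite lerDl ltW.
by rewrite addrAC subrr add0r.
Qed.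

Lemma quotient_support k x : r + 1 < `|x| -> quotient k x = 0.
Proof.
move=> rx; rewrite /quotient PhiB; last by rewrite lerDl ltW.
rewrite (@eq_Rintegral _ _ _ _ _ (fun=> 0)).
  by rewrite Rintegral_cst// mul0r mulr0.
move=> t; rewrite inE/= in_itv/= => /andP[xt tx]; apply: hr.
have k1 : k.+1%:R^-1 <= 1 :> R by rewrite invf_le1// ler1n.
have [x0|x0] := leP 0 x; move: rx; [rewrite ger0_norm//|rewrite ltr0_norm//] => rx.
  by rewrite (lt_le_trans _ (ler_norm t))//; have := r0; lra.
move: tx k1; move: (k.+1%:R^-1 : R) (t : R) xt => i s xs sx i1.
by rewrite -normrN (lt_le_trans _ (ler_norm (- s)))//; have := r0; lra.
Qed.

(** Lebesgue differentiation of the primitive. *)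
Lemma quotient_cvg : {ae mu, forall x, quotient k x @[k --> \oo] --> h x}.
Proof.
have loc : locally_integrable setT h by apply: open_integrable_locally => //; exact: openT.
have := FTC1Ny (fun y => hiD (measurable_itv _)) loc.
apply: ae_imply => x [dF Fx]; rewrite -Fx derive1E.
have k_cvg : (k.+1%:R^-1 : R) @[k --> \oo] --> (0 : R)^'.
  move=> A; rewrite /dnbhs /within/= => -[e e0 eA].
  change (\forall k \near \oo, A (k.+1%:R^-1 : R)).
  near=> k; have kk := k0 k; apply: eA; last exact: lt0r_neq0 kk.
  rewrite /ball/= sub0r normrN gtr0_norm//.
  by near: k; exact: near_infty_natSinv_lt (PosNum e0).
have := cvg_comp _ _ k_cvg dF.
apply: cvg_trans; apply: near_eq_cvg; apply: nearW => k.
rewrite /= /quotient /Phi /primitive invrK -[_ *: _]/(_ * _).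
have -> : k.+1%:R^-1 *: (1 : R) = k.+1%:R^-1 by exact: mulr1.
by rewrite (addrC x).
Unshelve. all: by end_near. Qed.

Lemma quotient_L2 (d : R) : 0 < d -> exists k, (\int[mu]_x ((h x - quotient k x) ^+ 2)%:E <= d%:E)%E.
Proof.
move=> d0.
have mq k : measurable_fun setT (quotient k).
  by apply: lipschitz_measurable (quotient_lipschitz k); rewrite !mulr_ge0.
pose G (x : R) : R := if `|x - 0| <= r + 1 then (2 * M) ^+ 2 else 0.
have r10 : 0 <= r + 1 by have := r0; lra.
have mG : measurable_fun setT G by rewrite /G; meas.
have Gi : mu.-integrable setT (EFin \o G).
  apply: (integrable_of_bound mG mG); last by rewrite integral_ball_cst// ltry.
  by move=> t; rewrite ger0_norm// /G; case: ifP => // _; rewrite sqr_ge0.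
have le k x : (h x - quotient k x) ^+ 2 <= G x.
  rewrite /G subr0; case: (leP `|x| (r + 1)) => rx.
    rewrite -(real_normK (num_real (_ - _))) ler_sqr ?nnegrE ?mulr_ge0//.
    apply: (le_trans (ler_normB _ _)).
    by have := hM x; have := quotient_bound k x; lra.
  by rewrite quotient_support// hr ?subrr ?expr0n//; lra.
have [||||_ _] := @dominated_convergence _ _ _ mu setT measurableT
  (fun k x => ((h x - quotient k x) ^+ 2)%:E) (cst 0)%E (EFin \o G) _ _ _ Gi _.
- by move=> k; have := mq k => mqk; meas.
- exact: measurable_cst.
- apply: ae_imply quotient_cvg => x qx _ /=; apply: cvg_EFin; first exact: nearW.
  have c : h x - quotient k x @[k --> \oo] --> h x - h x by apply: cvgB => //; exact: cvg_cst.
  by have := @cvgnX _ _ _ 2 c; rewrite subrr expr0n.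
- by apply: aeW => x k _ /=; rewrite lee_fin ger0_norm ?sqr_ge0.
rewrite integral0 => cv.
have : \forall k \near \oo, (\int[mu]_x ((h x - quotient k x) ^+ 2)%:E < d%:E)%E.
  apply: (cv [set y | (y < d%:E)%E]); apply: open_nbhs_nbhs.
  by split; [exact: open_ereal_lt_ereal|rewrite /= lte_fin].
by move=> [k _ /(_ k (leqnn k)) /= hk]; exists k; exact: ltW.
Qed.

End difference_quotients.

Lemma L2_truncation f (d : R) : measurable_fun setT f -> (\int[mu]_t (f t ^+ 2)%:E < +oo)%E ->
  0 < d -> exists n : nat,
  (\int[mu]_t ((f t - if (`|t| <= n%:R) && (`|f t| <= n%:R) then f t else 0) ^+ 2)%:E <= d%:E)%E.
Proof.
move=> mf foo d0.
pose h (n : nat) (t : R) : R := if (`|t| <= n%:R) && (`|f t| <= n%:R) then f t else 0.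
have mh n : measurable_fun setT (h n).
  by rewrite /h; apply: measurable_fun_ifT => //; apply: measurable_and; meas.
have mu2 n : measurable_fun setT (fun t => (f t - h n t) ^+ 2).
  by have := mh n => mhn; meas.
have le n t : `|(f t - h n t) ^+ 2| <= f t ^+ 2.
  rewrite ger0_norm ?sqr_ge0// /h; case: ifP => _; last by rewrite subr0.
  by rewrite subrr expr0n sqr_ge0.
have cv : \int[mu]_t (f t - h n t) ^+ 2 @[n --> \oo] --> \int[mu]_t (0 : R).
  apply: (@Rintegral_dominated _ _ _ (fun t => f t ^+ 2)) => //; first by meas.
  move=> t; apply: cvg_near_cst; near=> n; rewrite /h ifT ?subrr ?expr0n//.
  apply/andP; split; first by near: n; exact: nbhs_infty_ger.
  by near: n; exact: nbhs_infty_ger.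
have z : \int[mu]_t (0 : R) = 0 by rewrite /Rintegral integral0.
rewrite z in cv.
have : \forall n \near \oo, \int[mu]_t (f t - h n t) ^+ 2 < d.
  exact: cvgr_lt cv _ d0.
move=> [n _ /(_ n (leqnn n)) /= hn]; exists n.
rewrite -/(h n) -Rintegral_EFin ?lee_fin ?(ltW hn)//.
have mf2 : measurable_fun setT (fun t => f t ^+ 2) by meas.
exact: (integrable_of_bound (mu2 n) mf2 (le n)).
Unshelve. all: by end_near. Qed.

(** A bounded function of bounded support is the L^2 limit of the difference
  quotients of its primitive, which are Lipschitz. *)
Lemma L2_lipschitz_approx f (d : R) : measurable_fun setT f -> (\int[mu]_t (f t ^+ 2)%:E < +oo)%E ->
  0 < d -> exists g, exists L : R, [/\ 0 <= L, lipschitz_cst L g, measurable_fun setT g,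
   (\int[mu]_t (g t ^+ 2)%:E < +oo)%E & (\int[mu]_t ((f t - g t) ^+ 2)%:E <= d%:E)%E].
Proof.
move=> mf foo d0; have d40 : 0 < d / 4 by rewrite divr_gt0.
have [n fn] := L2_truncation mf foo d40.
pose h (t : R) : R := if (`|t| <= n%:R) && (`|f t| <= n%:R) then f t else 0.
have mh : measurable_fun setT h.
  by rewrite /h; apply: measurable_fun_ifT => //; apply: measurable_and; meas.
have hM t : `|h t| <= n%:R by rewrite /h; case: ifP => [/andP[]//|]; rewrite normr0.
have hr t : n%:R < `|t| -> h t = 0 by move=> nt; rewrite /h leNgt nt.
have n0 : 0 <= n%:R :> R by [].
have [k hk] := quotient_L2 mh hM n0 hr d40.
have lip := quotient_lipschitz mh hM n0 hr k.
have L0 : 0 <= k.+1%:R * (2 * n%:R) :> R by rewrite !mulr_ge0.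
have mq := lipschitz_measurable L0 lip.
have s0 (u : R -> R) t : 0 <= u t ^+ 2 by rewrite sqr_ge0.
have fg : (\int[mu]_t ((f t - quotient h k t) ^+ 2)%:E <= d%:E)%E.
  apply: (@le_trans _ _ (\int[mu]_t (2 * (f t - h t) ^+ 2 + 2 * (h t - quotient h k t) ^+ 2)%:E)%E).
    apply: le_integralT; [by meas|by meas|by move=> t; rewrite sqr_ge0|move=> t].
    rewrite -subr_ge0; set a := f t; set b := h t; set c := quotient h k t.
    by rewrite (_ : _ - _ = (a - 2 * b + c) ^+ 2) ?sqr_ge0//; ring.
  rewrite ge0_integralDT; [|by meas|by meas| |]; last 2 first.
  - by move=> t; rewrite mulr_ge0// sqr_ge0.
  - by move=> t; rewrite mulr_ge0// sqr_ge0.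
  rewrite ge0_integralZT; [|by meas|by move=> t; rewrite sqr_ge0|by []].
  rewrite ge0_integralZT; [|by meas|by move=> t; rewrite sqr_ge0|by []].
  apply: (@le_trans _ _ (2%:E * (d / 4)%:E + 2%:E * (d / 4)%:E)%E).
    by apply: leeD; rewrite lee_wpmul2l.
  by rewrite -!EFinM -EFinD lee_fin; lra.
exists (quotient h k), (k.+1%:R * (2 * n%:R)); split => //.
apply: (@le_lt_trans _ _ (\int[mu]_t (2 * f t ^+ 2 + 2 * (f t - quotient h k t) ^+ 2)%:E)%E).
  apply: le_integralT; [by meas|by meas|by move=> t; rewrite sqr_ge0|move=> t].
  rewrite -subr_ge0; set a := f t; set c := quotient h k t.
  by rewrite (_ : _ - _ = (2 * a - c) ^+ 2) ?sqr_ge0//; ring.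
rewrite ge0_integralDT; [|by meas|by meas| |]; last 2 first.
- by move=> t; rewrite mulr_ge0// sqr_ge0.
- by move=> t; rewrite mulr_ge0// sqr_ge0.
rewrite ge0_integralZT; [|by meas|by move=> t; rewrite sqr_ge0|by []].
rewrite ge0_integralZT; [|by meas|by move=> t; rewrite sqr_ge0|by []].
rewrite lte_add_pinfty//; apply: lte_mul_pinfty => //.
exact: le_lt_trans fg (ltry _).
Qed.

End lipschitz_functions_are_dense.

Section almost_everywhere_convergence.
Context {R : realType}.
Local Notation mu := (@lebesgue_measure R).
Implicit Types (f g : R -> R).

Lemma norm_le_of_sqr (a b : R) : 0 <= b -> a ^+ 2 <= b ^+ 2 -> `|a| <= b.
Proof. by move=> b0; rewrite -(real_normK (num_real a)) ler_sqr ?nnegrE. Qed.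

(** Split f into a Lipschitz function, whose transforms oscillate little, and a
  remainder small in L^2, whose maximal truncation is at most d / 2 outside a set of
  small measure. The exceptional set depends on the approximation, and the points
  common to all of them form a null set. *)
Lemma small_oscillation f (d : R) : measurable_fun setT f ->
  (\int[mu]_t (f t ^+ 2)%:E < +oo)%E -> 0 < d ->
  {ae mu, forall x, exists2 L : R, 0 <= L & forall a b : R, 0 < a -> a <= b ->
    `|trunc_hilbert a f x - trunc_hilbert b f x| <= d + 2 * L * b}.
Proof.
move=> mf foo d0; have [K K0 weak] := @weak_type_maximal R.
have d20 : 0 < d / 2 by rewrite divr_gt0.
have k0 k : 0 < (k.+1%:R^-1 : R) by rewrite invr_gt0.
have c0 : 0 < (d / 2) ^+ 2 by rewrite exprn_gt0.
have approx k := L2_lipschitz_approx mf foo (k0 k).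
pose g k := sval (cid (approx k)).
have gP k : exists L : R, [/\ 0 <= L, lipschitz_cst L (g k), measurable_fun setT (g k),
   (\int[mu]_t (g k t ^+ 2)%:E < +oo)%E & (\int[mu]_t ((f t - g k t) ^+ 2)%:E <= (k.+1%:R^-1)%:E)%E].
  by rewrite /g; case: cid.
have badP k : exists E : set R, [/\ measurable E, (mu E <= (K / (d / 2) ^+ 2 / k.+1%:R)%:E)%E &
    forall x, ~ E x -> forall e : R, 0 < e -> trunc_hilbert e (fun t => f t - g k t) x ^+ 2 <= (d / 2) ^+ 2].
  have [L [_ _ mg goo fg]] := gP k.
  have mfg : measurable_fun setT (fun t => f t - g k t) by meas.
  have [E [mE muE hE]] := weak _ _ mfg (le_lt_trans fg (ltry _)) c0.
  exists E; split => //; apply: (le_trans muE).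
  rewrite (EFinM (K / (d / 2) ^+ 2) k.+1%:R^-1) lee_wpmul2l// lee_fin.
  by rewrite divr_ge0// (ltW c0).
pose E k := sval (cid (badP k)).
have EP k : [/\ measurable (E k), (mu (E k) <= (K / (d / 2) ^+ 2 / k.+1%:R)%:E)%E &
    forall x, ~ E k x -> forall e : R, 0 < e -> trunc_hilbert e (fun t => f t - g k t) x ^+ 2 <= (d / 2) ^+ 2].
  by rewrite /E; case: cid.
have mN : measurable (\bigcap_k E k) by apply: bigcap_measurableType => k _; case: (EP k).
exists (\bigcap_k E k); split => //.
  apply/eqP; rewrite eq_le measure_ge0 andbT; apply/lee_addgt0Pr => e e0; rewrite add0e.
  pose C := K / (d / 2) ^+ 2; pose k := Num.truncn (C / e).
  have [mE muE _] := EP k.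
  apply: (@le_trans _ _ (mu (E k))).
    by apply: le_measure; rewrite ?inE// => x; apply.
  apply: (le_trans muE); rewrite lee_fin -/C ler_pdivrMr// mulrC -ler_pdivrMr//.
  exact: ltW (truncnS_gt _).
move=> x; apply: contra_notP => /existsNP[k xk]; have xE : ~ E k x by move=> h; apply: xk.
have [_ _ hE] := EP k; have [L [L0 lip mg goo fg]] := gP k.
have foog : (\int[mu]_t ((f t - g k t) ^+ 2)%:E < +oo)%E by exact: le_lt_trans fg (ltry _).
have mfg : measurable_fun setT (fun t => f t - g k t) by meas.
exists L => // a b a0 ab; have b0 := lt_le_trans a0 ab.
have split_ e : 0 < e -> trunc_hilbert e f x =
    trunc_hilbert e (fun t => f t - g k t) x + trunc_hilbert e (g k) x.
  move=> e0; rewrite -trunc_hilbertD; [|exact: L2_far_integrable|exact: L2_far_integrable].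
  by congr trunc_hilbert; apply/funext => t; rewrite subrK.
rewrite (split_ a)// (split_ b)// opprD addrACA (le_trans (ler_normD _ _))// lerD//.
  apply: (le_trans (ler_normB _ _)).
  have h1 := norm_le_of_sqr (ltW d20) (hE _ xE _ a0).
  have h2 := norm_le_of_sqr (ltW d20) (hE _ xE _ b0).
  by lra.
exact: lipschitz_oscillation.
Qed.

Lemma pv_ae_L2 f : measurable_fun setT f -> (\int[mu]_t (f t ^+ 2)%:E < +oo)%E ->
  {ae mu, forall x, cvg (trunc_hilbert e f x @[e --> (0 : R)^'+])}.
Proof.
move=> mf foo.
have m0 (m : nat) : 0 < (m.+1%:R^-1 : R) by rewrite invr_gt0.
apply: ae_imply (ae_forall_nat (fun m => small_oscillation mf foo (m0 m))) => x H.
apply: cauchy_cvg; apply: cauchy_exP => e e0.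
have [L L0 osc] := H (Num.truncn (2 / e)).
set m := Num.truncn _ in osc.
have me : m.+1%:R^-1 < e / 2.
  rewrite -[e / 2]invf_div ltf_pV2 ?posrE ?divr_gt0//; exact: truncnS_gt.
pose b := e / (4 * (L + 1)).
have L10 : 0 < 4 * (L + 1) by rewrite mulr_gt0//; lra.
have b0 : 0 < b by rewrite divr_gt0.
have Lb : 2 * L * b <= e / 2.
  rewrite /b mulrA ler_pdivrMr//.
  have : 2 * L * e <= 2 * (L + 1) * e by rewrite ler_wpM2r ?(ltW e0)//; lra.
  lra.
exists (trunc_hilbert b f x).
change (\forall a \near (0 : R)^'+, ball (trunc_hilbert b f x) e (trunc_hilbert a f x)).
near=> a; rewrite /ball/= distrC.
apply: (@le_lt_trans _ _ (m.+1%:R^-1 + 2 * L * b)).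
  apply: osc; first by near: a; exact: nbhs_right_gt.
  by near: a; exact: nbhs_right_le.
move: me Lb; set i := (m.+1%:R^-1); lra.
Unshelve. all: by end_near. Qed.

(** On a ball f is in L^2 because |f| ^ 2 <= 1 + |f| ^ p; at points well inside the
  ball the rest of f contributes a term independent of e < 1. *)
Lemma pv_ae f (p : R -> R) : measurable_fun setT f -> measurable_fun setT p ->
  (forall t, 2 <= p t <= 4) -> (\int[mu]_t (`|f t| `^ p t)%:E < +oo)%E ->
  {ae mu, forall x, cvg (trunc_hilbert e f x @[e --> (0 : R)^'+])}.
Proof.
move=> mf mp p24 foo.
pose f1 (n : nat) (t : R) : R := if `|t| <= n.+1%:R then f t else 0.
pose f2 (n : nat) (t : R) : R := if `|t| <= n.+1%:R then 0 else f t.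
have m1 n : measurable_fun setT (f1 n) by rewrite /f1; meas.
have m2 n : measurable_fun setT (f2 n) by rewrite /f2; meas.
have p0 t : 0 <= `|f t| `^ p t by exact: powR_ge0.
have f1oo n : (\int[mu]_t (f1 n t ^+ 2)%:E < +oo)%E.
  apply: (@le_lt_trans _ _ (\int[mu]_t ((if `|t - 0| <= n.+1%:R then 1 else 0) + `|f t| `^ p t)%:E)%E).
    have := m1 n => m1n; apply: le_integralT; [by meas|by meas|by move=> t; rewrite sqr_ge0|move=> t].
    rewrite subr0 /f1; case: ifP => _; last by rewrite expr0n add0r.
    have [ft1|ft1] := leP `|f t| 1.
      have : `|f t| ^+ 2 <= 1 by rewrite expr_le1.
      by rewrite real_normK ?num_real//; have := p0 t; lra.
    have : `|f t| `^ 2 <= `|f t| `^ p t by rewrite ler_powR ?(ltW ft1)//; case/andP: (p24 t).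
    by rewrite powR_mulrn// real_normK ?num_real//; lra.
  rewrite ge0_integralDT; [|by meas|by meas|by move=> t; case: ifP|by []].
  by rewrite integral_ball_cst// lte_add_pinfty// ltry.
have f2oo n : (\int[mu]_t (`|f2 n t| `^ p t)%:E < +oo)%E.
  have := m2 n => m2n; apply: le_lt_trans foo.
  apply: le_integralT; [by meas|by meas|by move=> t; exact: powR_ge0|move=> t].
  rewrite /f2; case: ifP => // _; rewrite normr0 powR0//.
  by rewrite gt_eqF//; case/andP: (p24 t) => + _; lra.
apply: ae_imply (ae_forall_nat (fun n => pv_ae_L2 (m1 n) (f1oo n))) => x H.
pose n := Num.truncn `|x|.
have xn : `|x| < n.+1%:R by exact: truncnS_gt.
have := H n.+1; set N := n.+1 => cv1.
have cv : cvg (trunc_hilbert e (f1 N) x + trunc_hilbert 1 (f2 N) x @[e --> (0 : R)^'+]).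
  exact: (is_cvgD cv1 (is_cvg_cst _)).
case/cvg_ex : cv => l cl; apply/cvg_ex; exists l; apply: cvg_trans cl.
apply: near_eq_cvg; near=> e.
have e0 : 0 < e by near: e; exact: nbhs_right_gt.
have e1 : e < 1 by near: e; exact: nbhs_right_lt.
have fi : far_integrable e (f1 N) by exact: L2_far_integrable (m1 N) (f1oo N).
have gi : far_integrable e (f2 N) by move=> y; exact: (integrable_far (m2 N) mp p24 y e0 (f2oo N)).
have -> : trunc_hilbert e f x = trunc_hilbert e (f1 N) x + trunc_hilbert e (f2 N) x.
  rewrite -trunc_hilbertD//; congr trunc_hilbert; apply/funext => t.
  by rewrite /f1 /f2; case: ifP => _; rewrite ?addr0 ?add0r.
congr (_ + _); apply: eq_Rintegral => t _; rewrite /f2 /tkernel.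
case: (leP `|t| N.+1%:R) => tN; first by rewrite !mul0r.
have : 1 < `|t - x|.
  have h1 := lerB_dist t x; have h2 : N.+1%:R = n.+1%:R + 1 :> R by rewrite -natr1.
  move: h1 tN xn; rewrite h2; move: (n.+1%:R : R) => k; lra.
by move=> tx; rewrite tx (lt_trans e1 tx).
Unshelve. all: by end_near. Qed.

End almost_everywhere_convergence.

(** * The oscillating exponent and the decomposition into levels *)

Section oscillating_exponent.
Context {R : realType}.
Local Notation mu := (@lebesgue_measure R).

Lemma sin_lipschitz (x y : R) : `|sin x - sin y| <= `|x - y|.
Proof.
wlog xy : x y / y <= x.
  move=> H; have [/H//|/ltW/H] := leP y x.
  by rewrite distrC (distrC y).
have [c _ ->] : exists2 c : R, c \in `[y, x]%R & sin x - sin y = cos c * (x - y).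
  apply: MVT_segment => //.
  by apply: continuous_subspaceT => t; exact: continuous_sin.
by rewrite normrM ler_piMl// cos_max.
Qed.

(** A function of w = 1 + |x|. The amplitude 1 / 8 keeps p away from 2 and from 4 and
  matches the exponent allowed for slowly varying weights. *)
Definition expo (w : R) : R := 3 + 8^-1 * sin (ln (1 + ln w)).
Definition pexp (x : R) : R := expo (wgt x).

Lemma expo_bounds w : 3 - 8^-1 <= expo w <= 3 + 8^-1.
Proof.
have h1 := sin_geN1 (ln (1 + ln w)); have h2 := sin_le1 (ln (1 + ln w)).
by rewrite /expo; apply/andP; split; lra.
Qed.

Lemma ln_ln_le (u v : R) : 0 <= u -> u <= v -> 0 <= ln (1 + v) - ln (1 + u) <= (v - u) / (1 + u).
Proof.
move=> u0 uv; have u1 : 0 < 1 + u by lra.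
have v1 : 0 < 1 + v by lra.
rewrite -ln_div ?posrE//; apply/andP; split.
  by apply: ln_ge0; rewrite ler_pdivlMr//; lra.
rewrite (_ : (1 + v) / (1 + u) = 1 + (v - u) / (1 + u)); last by field; rewrite gt_eqF.
apply: le_ln1Dx; apply: (@lt_le_trans _ _ 0); first by lra.
by rewrite divr_ge0 ?(ltW u1)//; lra.
Qed.

(** The key regularity: in the variable ln w the exponent has slope at most
  1 / (8 (1 + ln w)). *)
Lemma expo_slow (w1 w2 : R) : 1 <= w1 -> w1 <= w2 ->
  `|expo w2 - expo w1| <= 8^-1 * ((ln w2 - ln w1) / (1 + ln w1)).
Proof.
move=> w11 w12; have w10 : 0 < w1 by lra.
have w20 : 0 < w2 by lra.
have l0 := ln_ge0 w11.
have l12 : ln w1 <= ln w2 by rewrite ler_ln ?posrE.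
have /andP[h1 h2] := ln_ln_le l0 l12.
rewrite /expo opprD addrACA subrr add0r -mulrBr normrM ger0_norm; last by rewrite invr_ge0.
rewrite ler_wpM2l ?invr_ge0//; apply: (le_trans (sin_lipschitz _ _)).
by rewrite ger0_norm.
Qed.

Lemma pexp_lipschitz (x t : R) : `|pexp x - pexp t| <= 8^-1 * `|x - t|.
Proof.
wlog xt : x t / wgt t <= wgt x.
  move=> H; have [/H//|/ltW/H] := leP (wgt t) (wgt x).
  by rewrite distrC (distrC t).
apply: (le_trans (expo_slow (wgt_ge1 t) xt)).
rewrite ler_wpM2l ?invr_ge0//.
have t0 := wgt_gt0 t; have x0 := wgt_gt0 x; have l0 := ln_ge0 (wgt_ge1 t).
have l1 : ln (wgt t) <= ln (wgt x) by rewrite ler_ln ?posrE.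
rewrite ler_pdivrMr; last by lra.
apply: (@le_trans _ _ (wgt x - wgt t)).
  rewrite -ln_div ?posrE//.
  rewrite (_ : wgt x / wgt t = 1 + (wgt x - wgt t) / wgt t); last by field; rewrite gt_eqF.
  have h0 : 0 <= (wgt x - wgt t) / wgt t by rewrite divr_ge0 ?subr_ge0// ltW.
  apply: (le_trans (le_ln1Dx _)); first by lra.
  by rewrite ler_pdivrMr// ler_peMr ?subr_ge0// wgt_ge1.
have : `|x| - `|t| <= `|x - t| by exact: lerB_dist.
have : `|x - t| <= `|x - t| * (1 + ln (wgt t)) by rewrite ler_peMr//; lra.
by rewrite /wgt; lra.
Qed.

Lemma pexp_bounds x : 2 <= pexp x <= 4.
Proof. by have := expo_bounds (wgt x); rewrite -/(pexp x) => /andP[h1 h2]; apply/andP; split; lra. Qed.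

Lemma measurable_expo (g : R -> R) : measurable_fun setT g -> measurable_fun setT (fun x => expo (g x)).
Proof.
move=> mg; have msin : measurable_fun setT (@sin R) := continuous_measurable_fun (@continuous_sin R).
have mln : measurable_fun setT (fun x => ln (1 + ln (g x))).
  by apply: (measurableT_comp (@measurable_ln R)); apply: measurable_funD => //; exact: (measurableT_comp (@measurable_ln R) mg).
have ms := measurableT_comp msin mln; rewrite /expo; apply: measurable_funD => //; exact: measurable_funM.
Qed.

Lemma measurable_pexp : measurable_fun setT pexp.
Proof. by apply: measurable_expo; rewrite /wgt; meas. Qed.

End oscillating_exponent.

Section level_sums.
Context {R : realType}.
Local Notation mu := (@lebesgue_measure R).

(** The cost of one level is min (s ^ 2, s ^ 4): the part of f above the level is
  treated in L^2, the part below in L^4. *)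
Definition psi (s : R) : R := if 1 < s then s ^+ 2 else s ^+ 4.

Lemma psi_ge0 s : 0 <= psi s.
Proof. by rewrite /psi; case: ifP => _; rewrite exprn_even_ge0. Qed.

Lemma measurable_psi : measurable_fun setT psi.
Proof.
rewrite (_ : psi = fun s : R => if 0 < s - 1 then s ^+ 2 else s ^+ 4); first by meas.
by apply/funext => s; rewrite subr_gt0.
Qed.

(** psi (exp u) is exp (2 u) for u > 0 and exp (4 u) for u <= 0, and q lies between
  2 + 7 / 8 and 4 - 7 / 8. *)
Lemma psi_expR (u q : R) : 3 - 8^-1 <= q <= 3 + 8^-1 ->
  psi (expR u) <= expR (q * u - 7 / 8 * `|u|).
Proof.
move=> /andP[q1 q2]; rewrite /psi -[X in X < _]expR0 ltr_expR.
case: ltP => u0; rewrite -expRM_natr ler_expR.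
  rewrite gtr0_norm// -mulrBl mulrC ler_wpM2r ?(ltW u0)//; lra.
rewrite ler0_norm// mulrN opprK -mulrDl mulrC; apply: ler_wnM2r => //; lra.
Qed.

Lemma powR_expR_ln (v p : R) : 0 < v -> v `^ p = expR (p * ln v).
Proof. by move=> v0; rewrite /powR gt_eqF. Qed.

Lemma psi0 : psi 0 = 0.
Proof. by rewrite /psi ltr10 expr0n. Qed.

(** Summing over n, the right-hand side is a two-sided geometric series around
  n = ln v. *)
Lemma high_level_term (n : nat) (v p : R) : 0 <= v -> 3 - 8^-1 <= p <= 3 + 8^-1 ->
  expR (n%:R * p) * psi (v * expR (- n%:R)) <= v `^ p * expR (- (3 / 4 * `|ln v - n%:R|)).
Proof.
move=> v0 pb; move: v0; rewrite le_eqVlt => /predU1P[<-|v0].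
  by rewrite mul0r psi0 mulr0 mulr_ge0 ?powR_ge0// expR_ge0.
rewrite powR_expR_ln// -{1}(lnK (_ : v \in Num.pos)) ?posrE// -!expRD.
apply: (@le_trans _ _ (expR (n%:R * p) * expR (p * (ln v - n%:R) - 7 / 8 * `|ln v - n%:R|))).
  by rewrite ler_wpM2l ?expR_ge0// psi_expR.
by rewrite -expRD ler_expR; have := normr_ge0 (ln v - n%:R); lra.
Qed.

(** The weight exp (- N p) of the level exp (- N), with p frozen at its value for
  1 + |x| = exp N wherever 1 + |x| < exp N. Without the freezing it would vary too
  fast near the origin: its logarithm is N p, and p varies like
  (ln rho) / (1 + ln (1 + |x|)), which balances N only when ln (1 + |x|) >= N. *)
Definition low_weight (N : nat) (x : R) : R := expR (- (N%:R * expo (Num.max (wgt x) (expR N%:R)))).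

Lemma measurable_low_weight N : measurable_fun setT (low_weight N).
Proof.
have mN : measurable_fun setT (fun x : R => expo (Num.max (wgt x) (expR N%:R))).
  by apply: measurable_expo; rewrite /wgt; meas.
by rewrite /low_weight; meas.
Qed.

(** Put v = exp (- nu) and 1 + |x| = exp M. Where N <= M the weight is the true
  one. Where M < N and nu <= M, the frozen exponent differs from p (x) by at most
  (N - M) / (8 (1 + M)), so that multiplication by nu <= M costs (N - nu) / 8 at
  most and the decay rate 7 / 8 drops to 3 / 4. Where nu > M, v is so small that
  v ^ q is at most the integrable weight (1 + |x|) ^ (- 23 / 8), whatever the
  exponent. *)
Lemma low_level_term (N : nat) (v x : R) : 0 <= v ->
  low_weight N x * psi (v * expR N%:R) <=
  (v `^ pexp x + wgt x `^ (- (3 - 8^-1))) *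
  (expR (- (3 / 4 * `|- ln v - N%:R|)) + expR (- (3 / 4 * `|0 - N%:R|))).
Proof.
rewrite le_eqVlt => /predU1P[<-|v0].
  by rewrite mul0r psi0 mulr0 mulr_ge0// addr_ge0 ?powR_ge0 ?expR_ge0.
set w := wgt x; have w1 : 1 <= w by exact: wgt_ge1.
have w0 : 0 < w by lra.
set M := ln w; have M0 : 0 <= M by exact: ln_ge0.
have wE : w = expR M by rewrite /M lnK ?posrE.
set A := v `^ _; set B := w `^ _; have A0 : 0 <= A by exact: powR_ge0.
have B0 : 0 <= B by exact: powR_ge0.
set G := expR (- (3 / 4 * `|- ln v - _|)); set H := expR (- (3 / 4 * `|0 - _|)).
have G0 : 0 <= G by exact: expR_ge0.
have H0 : 0 <= H by exact: expR_ge0.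
have [AG BG AH] : [/\ A * G <= (A + B) * (G + H), B * G <= (A + B) * (G + H) & A * H <= (A + B) * (G + H)].
  have h1 := mulr_ge0 A0 G0; have h2 := mulr_ge0 A0 H0.
  have h3 := mulr_ge0 B0 G0; have h4 := mulr_ge0 B0 H0.
  by split; rewrite mulrDl !mulrDr; lra.
set nu := - ln v.
have vE : v = expR (- nu) by rewrite /nu opprK lnK ?posrE.
have AE : A = expR (- (pexp x * nu)) by rewrite /A powR_expR_ln// /nu mulrN opprK.
have BE : B = expR (- ((3 - 8^-1) * M)) by rewrite /B powR_expR_ln// mulNr.
have n0 : 0 <= N%:R :> R by [].
have pb := expo_bounds w; rewrite -/(pexp x) in pb.
rewrite /low_weight -/w; set q := expo _.
have qb : 3 - 8^-1 <= q <= 3 + 8^-1 by exact: expo_bounds.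
have gen : expR (- (N%:R * q)) * psi (v * expR N%:R) <= expR (- (q * nu) - 7 / 8 * `|nu - N%:R|).
  rewrite vE -expRD; apply: (@le_trans _ _ (expR (- (N%:R * q)) * expR (q * (- nu + N%:R) - 7 / 8 * `|- nu + N%:R|))).
    by rewrite ler_wpM2l ?expR_ge0// psi_expR.
  by rewrite -expRD ler_expR (addrC (- nu)) (distrC N%:R); lra.
have abs0 := normr_ge0 (nu - N%:R).
(* Where N <= M the exponent is not frozen. *)
have [NM|MN] := leP N%:R M.
  apply: le_trans AG; apply: (le_trans gen).
  have -> : q = pexp x.
    by rewrite /q /pexp -/w; congr expo; apply: max_l; rewrite wE ler_expR.
  by rewrite AE /G -expRD ler_expR; lra.
have maxE : Num.max w (expR N%:R) = expR N%:R by apply: max_r; rewrite wE ler_expR ltW.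
(* Where v >= 1, raising v to the frozen exponent instead of the true one costs a
   power of v that the rate 7 / 8 absorbs. *)
have [nu0|nu0] := leP nu 0.
  apply: le_trans AH; rewrite AE /H -expRD sub0r normrN ger0_norm//.
  apply: (le_trans gen); rewrite ler_expR ler0_norm; last by lra.
  case/andP: pb => p1 p2; case/andP: qb => q1 q2.
  have : (pexp x - q + 7 / 8) * nu <= 0 by apply: mulr_ge0_le0; lra.
  lra.
have [nuM|Mnu] := leP nu M.
  apply: le_trans AG; apply: (le_trans gen); rewrite AE /G -expRD ler_expR.
  have dpq : (pexp x - q) * nu <= 8^-1 * (N%:R - nu).
    have : `|q - pexp x| <= 8^-1 * ((N%:R - M) / (1 + M)).
      rewrite /q maxE -[N%:R in X in _ <= X](expRK N%:R) /pexp -/w.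
      by apply: expo_slow => //; rewrite wE ler_expR ltW.
    move=> h; have : `|q - pexp x| * nu <= 8^-1 * ((N%:R - M) / (1 + M)) * nu by rewrite ler_wpM2r// ltW.
    have h1 : (N%:R - M) / (1 + M) * nu <= N%:R - M.
      rewrite mulrAC ler_pdivrMr; last by lra.
      by rewrite ler_wpM2l; lra.
    have h2 : (pexp x - q) * nu <= `|q - pexp x| * nu.
      by rewrite ler_wpM2r ?(ltW nu0)// distrC ler_norm.
    lra.
  rewrite distrC ger0_norm; lra.
apply: le_trans BG; apply: (le_trans gen); rewrite BE /G -expRD ler_expR.
case/andP: qb => q1 q2.
have : (3 - 8^-1) * M <= q * nu.
  apply: (@le_trans _ _ (q * M)); first by rewrite ler_wpM2r.
  by rewrite ler_wpM2l; lra.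
lra.
Qed.

Section two_sided_geometric_series.
Let b : R := expR (- (3 / 4)).
Let G : R := (1 - b)^-1.

Let b01 : 0 < b < 1.
Proof. by rewrite /b expR_gt0/= -[X in _ < X]expR0 ltr_expR; lra. Qed.

Let G0 : 0 < G. Proof. by rewrite /G invr_gt0 subr_gt0; case/andP: b01. Qed.

Let Gb : b * G + 1 = G.
Proof. by rewrite /G; field; case/andP: b01 => _ h; rewrite gt_eqF// subr_gt0. Qed.

Let geo M : \sum_(n < M) b ^+ n <= G.
Proof.
have b0 : 0 <= b by case/andP: b01 => /ltW.
suff -> : \sum_(n < M) b ^+ n = G - b ^+ M * G.
  by rewrite gerBl// mulr_ge0 ?exprn_ge0// ltW.
elim: M => [|M ih]; first by rewrite big_ord0 expr0 mul1r subrr.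
have h : b ^+ M * G = b ^+ M * (b * G + 1) by rewrite Gb.
by rewrite big_ord_recr/= ih exprSr; lra.
Qed.

Let right_part M (y : R) :
  \sum_(n < M) (if y <= n%:R then expR (- (3 / 4 * (n%:R - y))) else 0) <= G.
Proof.
elim: M y => [|M ih] y; first by rewrite big_ord0 ltW.
have [y0|y0] := leP y 0.
  apply: le_trans (geo M.+1); apply: ler_sum => n _.
  have n0 : 0 <= n%:R :> R by [].
  rewrite ifT; last exact: le_trans n0.
  rewrite /b -expRM_natr ler_expR; lra.
rewrite big_ord_recl/= ifF; last by apply/negbTE; rewrite -ltNge.
rewrite add0r; apply: le_trans (ih (y - 1)).
apply: ler_sum => n _; rewrite /bump/= add1n -natr1 lerBlDr.
by rewrite (_ : n%:R + 1 - y = n%:R - (y - 1))//; ring.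
Qed.

(** The second conjunct carries the induction: while the summation index stays below
  y the sum is geometric with its largest term last. *)
Let left_part M (y : R) :
  let T := \sum_(n < M) (if n%:R < y then expR (- (3 / 4 * (y - n%:R))) else 0) in
  T <= G /\ (M%:R <= y -> T <= expR (- (3 / 4 * (y - M%:R))) * b * G).
Proof.
have b0 : 0 <= b by case/andP: b01 => /ltW.
elim: M => [|M [ih1 ih2]] /=.
  rewrite big_ord0; split; first exact: ltW.
  by move=> _; rewrite !mulr_ge0 ?expR_ge0// ltW.
rewrite big_ord_recr/=; have [My|yM] := ltP M%:R y; last first.
  rewrite addr0; split => // h; have := le_trans h yM.
  by rewrite ler_nat ltnn.
have {ih1 ih2}ih := ih2 (ltW My).
set E := expR _ in ih *; set T := \sum_(_ < _) _ in ih *.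
have E1 : E <= 1 by rewrite /E -[leRHS]expR0 ler_expR; lra.
have : T + E <= E * G by rewrite -[X in _ <= E * X]Gb; lra.
move=> TE; split.
  by apply: (le_trans TE); rewrite ler_piMl// ltW.
move=> _; suff <- : E = expR (- (3 / 4 * (y - M.+1%:R))) * b by [].
by rewrite /E /b -expRD -natr1; congr expR; field.
Qed.

Lemma exp_series : exists2 C : R, 0 <= C & forall y : R,
  (\sum_(n <oo) (expR (- (3 / 4 * `|y - n%:R|)))%:E <= C%:E)%E.
Proof.
exists (G + G) => [|y]; first by rewrite addr_ge0// ltW.
apply: lime_le; first by apply: is_cvg_nneseries => n _ _; rewrite lee_fin expR_ge0.
apply: nearW => M; rewrite sumEFin lee_fin big_mkord.
have [h _] := left_part M y.
apply: le_trans (lerD (right_part M y) h); rewrite -big_split/=; apply: ler_sum => n _.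
have [yn|ny] := leP y n%:R.
  by rewrite addr0 distrC ger0_norm// subr_ge0.
by rewrite add0r ger0_norm// subr_ge0 ltW.
Qed.

End two_sided_geometric_series.

Lemma series_le (u v : nat -> R) (C : R) : 0 <= C -> (forall n, 0 <= u n) ->
  (forall n, 0 <= v n) -> (forall n, u n <= C * v n) ->
  (\sum_(n <oo) (u n)%:E <= C%:E * \sum_(n <oo) (v n)%:E)%E.
Proof.
move=> C0 u0 v0 uv; rewrite -nneseriesZl; last by move=> n _; rewrite lee_fin.
by apply: lee_nneseries => n *; rewrite -?EFinM lee_fin.
Qed.

Lemma high_levels_sum : exists2 C : R, 0 <= C & forall f : R -> R, measurable_fun setT f ->
  (\sum_(n <oo) \int[mu]_t (expR (n%:R * pexp t) * psi (`|f t| * expR (- n%:R)))%:E <=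
   C%:E * \int[mu]_t (`|f t| `^ pexp t)%:E)%E.
Proof.
have [C C0 hC] := exp_series; exists C => // f mf.
have mp := @measurable_pexp R; have mpsi := measurable_psi.
rewrite -ge0_integral_seriesT; last 2 first.
- by move=> n; meas.
- by move=> n t; rewrite mulr_ge0 ?expR_ge0 ?psi_ge0.
rewrite -ge0_integralZT//; last by meas.
apply: ge0_le_integralT.
- apply: ge0_emeasurable_sum => // [n t _ _|n _].
    by rewrite lee_fin mulr_ge0 ?expR_ge0 ?psi_ge0.
  by meas.
- by meas.
- by move=> t; apply: nneseries_ge0 => n _ _; rewrite lee_fin mulr_ge0 ?expR_ge0 ?psi_ge0.
- move=> t; apply: (@le_trans _ _ ((`|f t| `^ pexp t)%:E * \sum_(n <oo) (expR (- (3 / 4 * `|ln `|f t| - n%:R|)))%:E)%E).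
    apply: series_le.
    + exact: powR_ge0.
    + by move=> n; rewrite mulr_ge0 ?expR_ge0 ?psi_ge0.
    + by move=> n; exact: expR_ge0.
    + by move=> n; apply: high_level_term => //; exact: expo_bounds.
  by rewrite EFinM (muleC C%:E) lee_wpmul2l// lee_fin powR_ge0.
Qed.

Lemma integral_wgt_pow : (\int[mu]_t (wgt t `^ (- (3 - 8^-1)))%:E <= 2%:E)%E.
Proof.
apply: le_trans (integral_wgt2 0); apply: le_integralT.
- by rewrite /wgt; meas.
- by rewrite /wgt; meas.
- by move=> t; exact: powR_ge0.
- move=> t; rewrite subr0 -powR_mulrn ?(ltW (wgt_gt0 t))// -powRN ler_powR ?wgt_ge1//; lra.
Qed.

(** The added constant bounds the integral of (1 + |x|) ^ (- 23 / 8). *)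
Lemma low_levels_sum : exists2 C : R, 0 <= C & forall f : R -> R, measurable_fun setT f ->
  (\sum_(N <oo) \int[mu]_t (low_weight N t * psi (`|f t| * expR N%:R))%:E <=
   C%:E * (\int[mu]_t (`|f t| `^ pexp t)%:E + 2%:E))%E.
Proof.
have [C C0 hC] := exp_series; exists (C + C) => [|f mf]; first by rewrite addr_ge0.
have mp := @measurable_pexp R; have mpsi := measurable_psi.
have mw := measurable_low_weight.
rewrite -ge0_integral_seriesT; last 2 first.
- by move=> n; have mwn := mw n; meas.
- by move=> n t; rewrite mulr_ge0 ?expR_ge0 ?psi_ge0.
pose h (t : R) : R := `|f t| `^ pexp t + wgt t `^ (- (3 - 8^-1)).
have mwp : measurable_fun setT (fun t : R => wgt t `^ (- (3 - 8^-1))) by rewrite /wgt; meas.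
have mh : measurable_fun setT h by rewrite /h; meas.
have h0 t : 0 <= h t by rewrite addr_ge0// powR_ge0.
apply: (@le_trans _ _ (\int[mu]_t ((C + C) * h t)%:E)%E).
  apply: ge0_le_integralT.
  - apply: ge0_emeasurable_sum => // [n t _ _|n _].
      by rewrite lee_fin mulr_ge0 ?expR_ge0 ?psi_ge0.
    by have mwn := mw n; meas.
  - by meas.
  - by move=> t; apply: nneseries_ge0 => n _ _; rewrite lee_fin mulr_ge0 ?expR_ge0 ?psi_ge0.
  - move=> t.
    apply: (@le_trans _ _ ((h t)%:E * \sum_(N <oo)
       (expR (- (3 / 4 * `|- ln `|f t| - N%:R|)) + expR (- (3 / 4 * `|0 - N%:R|)))%:E)%E).
      apply: series_le => //.
      + by move=> n; rewrite mulr_ge0 ?expR_ge0 ?psi_ge0.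
      + by move=> n; exact: low_level_term.
    rewrite EFinM (muleC (C + C)%:E) lee_wpmul2l ?lee_fin//.
    under eq_eseriesr do rewrite EFinD.
    rewrite nneseriesD; [|by move=> *; rewrite lee_fin expR_ge0|by move=> *; rewrite lee_fin expR_ge0].
    by rewrite EFinD leeD.
rewrite ge0_integralZT// ?addr_ge0// lee_wpmul2l ?lee_fin ?addr_ge0//.
rewrite /h ge0_integralDT; [|by meas|by meas|by move=> t; exact: powR_ge0|by move=> t; exact: powR_ge0].
by rewrite leeD2l// integral_wgt_pow.
Qed.

(** Only the level next to g is used: between two consecutive levels the power p
  changes by a factor exp p <= exp 4. *)
Lemma layer_cake (g p : R) : 0 <= g -> 2 <= p <= 4 ->
  ((g `^ p)%:E <= (expR 4)%:E *
    (\sum_(n <oo) (if expR n%:R <= g then expR (n%:R * p) else 0)%:E +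
     \sum_(n <oo) (if expR (- n%:R) <= g then expR (- (n%:R * p)) else 0)%:E))%E.
Proof.
move=> g0 /andP[p2 p4].
have t0 (n : nat) : (0 <= (if expR n%:R <= g then expR (n%:R * p) else 0)%:E)%E.
  by rewrite lee_fin; case: ifP => // _; exact: expR_ge0.
have t1 (n : nat) : (0 <= (if expR (- n%:R) <= g then expR (- (n%:R * p)) else 0)%:E)%E.
  by rewrite lee_fin; case: ifP => // _; exact: expR_ge0.
have s0 := nneseries_ge0 (N := 0%N) (P := xpredT) (fun n _ _ => t0 n).
have s1 := nneseries_ge0 (N := 0%N) (P := xpredT) (fun n _ _ => t1 n).
have e0 : (0 <= (expR 4 : R)%:E)%E by rewrite lee_fin expR_ge0.
move: g0; rewrite le_eqVlt => /predU1P[g0|g0].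
  rewrite -{1}g0 powR0; last by rewrite gt_eqF//; lra.
  by rewrite mule_ge0// adde_ge0.
have [g1|g1] := leP 1 g.
  pose n := Num.truncn (ln g).
  have /andP[n1 n2] := truncn_itv (ln_ge0 g1).
  have gn : expR n%:R <= g by rewrite -[leRHS](lnK (_ : g \in Num.pos)) ?posrE// ler_expR.
  apply: (@le_trans _ _ ((expR 4)%:E * (if expR n%:R <= g then expR (n%:R * p) else 0)%:E)%E).
    rewrite gn -EFinM lee_fin -expRD powR_expR_ln// ler_expR.
    have : p * ln g <= p * n.+1%:R by rewrite ler_wpM2l ?(ltW n2)//; lra.
    by rewrite -natr1; move: (n%:R : R) => k; lra.
  by rewrite lee_wpmul2l// -[leLHS]adde0 leeD// (nneseries_term_le n t0).
pose m := Num.truncn (- ln g); pose n := m.+1.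
have lg : 0 <= - ln g by rewrite oppr_ge0; exact/ln_le0/ltW.
have /andP[n1 n2] := truncn_itv lg.
have gn : expR (- n%:R) <= g.
  by rewrite -[leRHS](lnK (_ : g \in Num.pos)) ?posrE// ler_expR lerNl ltW.
apply: (@le_trans _ _ ((expR 4)%:E * (if expR (- n%:R) <= g then expR (- (n%:R * p)) else 0)%:E)%E).
  rewrite gn -EFinM lee_fin -expRD powR_expR_ln// ler_expR.
  have : p * m%:R <= p * - ln g by rewrite ler_wpM2l//; lra.
  have -> : n%:R = m%:R + 1 :> R by rewrite /n natr1.
  by move: (m%:R : R) => k; lra.
by rewrite lee_wpmul2l// -[leLHS]add0e leeD// (nneseries_term_le n t1).
Qed.

End level_sums.

(** * Weighted estimate of one level set *)

Section level_estimates.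
Context {R : realType}.
Local Notation mu := (@lebesgue_measure R).
Implicit Types (f g : R -> R).

Lemma fubini_swap (F : R -> R -> R) :
  measurable_fun setT (fun z : R * R => F z.1 z.2) -> (forall x t, 0 <= F x t) ->
  (\int[mu]_x \int[mu]_t (F x t)%:E = \int[mu]_t \int[mu]_x (F x t)%:E)%E.
Proof.
move=> mF F0; rewrite (@fubini_tonelli _ _ _ _ _ mu mu (fun z : R * R => (F z.1 z.2)%:E))//.
- exact: measurable_EFin.
- by move=> z; rewrite lee_fin.
Qed.

Definition low_exponent (N : nat) (x : R) : R := N%:R * expo (Num.max (wgt x) (expR N%:R)).

Lemma low_weightE N x : low_weight N x = expR (- low_exponent N x).
Proof. by []. Qed.

(** The factor N is compensated by the denominator 1 + ln of the regularity bound,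
  because the frozen variable is at least exp N. *)
Lemma low_exponent_slow N (x t : R) :
  `|low_exponent N x - low_exponent N t| <= 8^-1 * ln (wratio x t).
Proof.
wlog xt : x t / wgt t <= wgt x.
  move=> H; have [/H//|/ltW/H] := leP (wgt t) (wgt x).
  by rewrite distrC wratioC.
have wx := wgt_gt0 x; have wt := wgt_gt0 t; have E0 := expR_gt0 (N%:R : R).
rewrite /low_exponent; set E := expR _; set mx := Num.max (wgt x) E; set mt := Num.max (wgt t) E.
have mtE : E <= mt by rewrite le_max lexx orbT.
have mt0 : 0 < mt by exact: lt_le_trans mtE.
have mt1 : 1 <= mt by rewrite le_max wgt_ge1.
have mtx : mt <= mx by rewrite ge_max !le_max xt lexx orbT.
have mx0 : 0 < mx by exact: lt_le_trans mtx.
have Nl : N%:R <= ln mt by rewrite -(expRK N%:R) ler_ln ?posrE.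
have n0 : 0 <= N%:R :> R by [].
have lmt : ln mt <= ln mx by rewrite ler_ln ?posrE.
rewrite -mulrBr normrM ger0_norm//.
apply: (@le_trans _ _ (N%:R * (8^-1 * ((ln mx - ln mt) / (1 + ln mt))))).
  by rewrite ler_wpM2l// expo_slow.
rewrite mulrCA ler_wpM2l ?invr_ge0//; apply: (@le_trans _ _ (ln mx - ln mt)).
  rewrite mulrA ler_pdivrMr; last by lra.
  by rewrite mulrC ler_wpM2l; lra.
have q0 : 0 < mx / mt by rewrite divr_gt0.
have r0 := wratio_gt0 x t; rewrite -ln_div ?posrE// ler_ln ?posrE//.
rewrite /wratio /wmax (max_l xt) (min_r xt) ler_pdivrMr// mulrAC ler_pdivlMr//.
rewrite /mx; have [xE|Ex] := leP (wgt x) E; last first.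
  by rewrite ler_wpM2l ?(ltW wx)// le_max lexx.
rewrite /mt max_r; last exact: le_trans xE.
by rewrite mulrC ler_wpM2r// ltW.
Qed.

Lemma low_weight_root_slow N (r : nat) : (0 < r)%N ->
  slow_weight (fun x => expR (- (low_exponent N x / r%:R))).
Proof.
move=> r0 x t; rewrite powR_expR_ln ?wratio_gt0// -expRD ler_expR.
have rr : 1 <= r%:R :> R by rewrite ler1n.
have h := low_exponent_slow N x t.
have : `|(low_exponent N x - low_exponent N t) / r%:R| <= 8^-1 * ln (wratio x t).
  apply: le_trans h; rewrite normrM ler_piMr// normfV ger0_norm// invf_le1//.
  exact: lt_le_trans rr.
rewrite ler_norml mulrBl => /andP[h1 h2]; lra.
Qed.

Definition big_part (c : R) f (t : R) : R := if 1 < `|f t| * c then f t else 0.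
Definition small_part (c : R) f (t : R) : R := if 1 < `|f t| * c then 0 else f t.

Lemma big_small_psi (c : R) f t : 0 < c ->
  (big_part c f t * c) ^+ 2 + (small_part c f t * c) ^+ 4 = psi (`|f t| * c).
Proof.
move=> c0; rewrite /big_part /small_part /psi; case: ifP => _; rewrite mul0r expr0n ?addr0 ?add0r.
  by rewrite !exprMn real_normK ?num_real.
by rewrite !exprMn [in RHS](exprM _ 2 2) real_normK ?num_real// -exprM.
Qed.

Lemma psi_le_powR (s p : R) : 0 <= s -> 2 <= p <= 4 -> psi s <= s `^ p.
Proof.
move=> + /andP[p2 p4]; rewrite le_eqVlt => /predU1P[<-|s0]; first by rewrite psi0 powR_ge0.
rewrite /psi; case: ltP => s1; rewrite -powR_mulrn ?(ltW s0)//.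
  by rewrite ler_powR// ltW.
by rewrite ger_powR// s0.
Qed.

Lemma psi_finite (c : R) f (p : R -> R) : 0 < c -> measurable_fun setT f -> measurable_fun setT p ->
  (forall t, 2 <= p t <= 4) -> (\int[mu]_t (`|f t| `^ p t)%:E < +oo)%E ->
  (\int[mu]_t (psi (`|f t| * c))%:E < +oo)%E.
Proof.
move=> c0 mf mp p24 foo; have mpsi : measurable_fun setT (fun t => psi (`|f t| * c)).
  by apply: (measurableT_comp (@measurable_psi R)); meas.
have c1 : 1 <= 1 + c by lra.
apply: (@le_lt_trans _ _ (\int[mu]_t ((1 + c) `^ 4 * `|f t| `^ p t)%:E)%E).
  apply: le_integralT; [by meas|by meas|by move=> t; exact: psi_ge0|move=> t].
  apply: (le_trans (psi_le_powR _ (p24 t))); first by rewrite mulr_ge0// ltW.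
  rewrite powRM ?(ltW c0)// mulrC ler_wpM2r ?powR_ge0//.
  case/andP: (p24 t) => p2 p4.
  apply: (@le_trans _ _ ((1 + c) `^ p t)); last by rewrite ler_powR.
  by rewrite ge0_ler_powR ?nnegrE//; lra.
rewrite ge0_integralZT; [|by meas|by move=> t; exact: powR_ge0|exact: powR_ge0].
by apply: lte_mul_pinfty; rewrite ?lee_fin ?powR_ge0.
Qed.

(** Where |T f| c >= 2, one of the transforms of the parts of f above and below 1 / c
  is at least 1 / c; the first part is estimated by Chebyshev in L^2, the second in
  L^4. The roots phi2 and phi4 of the weight W enter the two bounds. *)
Lemma weighted_level : exists2 K : R, 0 <= K &
  forall (W phi2 phi4 f p : R -> R) (c e : R),
  measurable_fun setT phi2 -> measurable_fun setT phi4 -> measurable_fun setT f ->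
  measurable_fun setT p -> (forall t, 2 <= p t <= 4) ->
  (\int[mu]_t (`|f t| `^ p t)%:E < +oo)%E -> 0 < c -> 0 < e ->
  (forall x, 0 < phi2 x <= 1) -> (forall x, 0 < phi4 x <= 1) ->
  slow_weight phi2 -> slow_weight phi4 ->
  (forall x, phi2 x ^+ 2 = W x) -> (forall x, phi4 x ^+ 4 = W x) ->
  (\int[mu]_x (W x * (if 2 <= `|trunc_hilbert e f x| * c then 1 else 0))%:E <=
   K%:E * \int[mu]_t (W t * psi (`|f t| * c))%:E)%E.
Proof.
have [K2 K20 T2] := @weighted_trunc_hilbert_L2 R.
have [K4 K40 T4] := @weighted_trunc_hilbert_L4 R.
exists (K2 + K4) => [|W phi2 phi4 f p c e m2 m4 mf mp p24 foo c0 e0 phi2b phi4b slow2 slow4 W2 W4].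
  exact: addr_ge0.
have mpsi : measurable_fun setT (fun t => psi (`|f t| * c)).
  by apply: (measurableT_comp (@measurable_psi R)); meas.
have pow4_ge0 (a : R) : 0 <= a ^+ 4 by rewrite (exprM a 2 2) sqr_ge0.
have mW : measurable_fun setT W.
  rewrite (_ : W = fun x => phi2 x ^+ 2); first by meas.
  by apply/funext => x; rewrite W2.
have W0 x : 0 <= W x by rewrite -W2 sqr_ge0.
pose f1 : R -> R := big_part c f; pose f2 : R -> R := small_part c f.
have mf1 : measurable_fun setT f1 by rewrite /f1 /big_part; meas.
have mf2 : measurable_fun setT f2 by rewrite /f2 /small_part; meas.
have psioo := psi_finite c0 mf mp p24 foo.
have split_psi t : (f1 t * c) ^+ 2 + (f2 t * c) ^+ 4 = psi (`|f t| * c) by exact: big_small_psi.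
have ci (r : nat) : 0 <= c^-1 ^+ r by rewrite exprn_ge0// invr_ge0 ltW.
have f1oo : (\int[mu]_t (f1 t ^+ 2)%:E < +oo)%E.
  apply: (@le_lt_trans _ _ (\int[mu]_t (c^-1 ^+ 2 * psi (`|f t| * c))%:E)%E).
    apply: le_integralT; [by meas|by meas|by move=> t; rewrite sqr_ge0|move=> t].
    rewrite -[leLHS]mul1r -(expr1n _ 2) -(mulVf (lt0r_neq0 c0)) exprMn -mulrA ler_wpM2l//.
    by rewrite -split_psi -exprMn mulrC lerDl.
  rewrite ge0_integralZT; [|by meas|by move=> t; exact: psi_ge0|exact: ci].
  by apply: lte_mul_pinfty; rewrite ?lee_fin ?ci.
have f2oo : (\int[mu]_t (f2 t ^+ 4)%:E < +oo)%E.
  apply: (@le_lt_trans _ _ (\int[mu]_t (c^-1 ^+ 4 * psi (`|f t| * c))%:E)%E).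
    apply: le_integralT; [by meas|by meas|by []|move=> t].
    rewrite -[leLHS]mul1r -(expr1n _ 4) -(mulVf (lt0r_neq0 c0)) exprMn -mulrA ler_wpM2l//.
    by rewrite -split_psi -exprMn mulrC lerDr sqr_ge0.
  rewrite ge0_integralZT; [|by meas|by move=> t; exact: psi_ge0|exact: ci].
  by apply: lte_mul_pinfty; rewrite ?lee_fin ?ci.
have TD x : trunc_hilbert e f x = trunc_hilbert e f1 x + trunc_hilbert e f2 x.
  rewrite -trunc_hilbertD.
  - congr trunc_hilbert; apply/funext => t; rewrite /f1 /f2 /big_part /small_part.
    by case: ifP => _; rewrite ?addr0 ?add0r.
  - exact: L2_far_integrable.
  - move=> y; apply: (@integrable_far _ f2 (fun=> 4)); [exact: mf2|exact: measurable_cst| |exact: e0|].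
      by move=> _; rewrite lexx andbT ler_nat.
    under eq_integral do rewrite powR_mulrn// (exprM _ 2 2) real_normK ?num_real// -exprM.
    exact: f2oo.
have h1 := T2 phi2 f1 e 1 m2 mf1 (fun x => proj1 (andP (phi2b x))) (fun x => proj2 (andP (phi2b x))) slow2 e0 f1oo.
have h2 := T4 phi4 f2 e 1 m4 mf2 (fun x => proj1 (andP (phi4b x))) (fun x => proj2 (andP (phi4b x))) slow4 e0 f2oo.
have mT := measurable_trunc_hilbert e mf.
have mT1 := measurable_trunc_hilbert e mf1; have mT2 := measurable_trunc_hilbert e mf2.
have s2 (a b : R) : 0 <= c ^+ 2 * (a * b) ^+ 2 by rewrite mulr_ge0 ?sqr_ge0.
have s4 (a b : R) : 0 <= c ^+ 4 * (a * b) ^+ 4 by rewrite mulr_ge0.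
apply: (@le_trans _ _ (\int[mu]_x (c ^+ 2 * (phi2 x * trunc_hilbert e f1 x) ^+ 2 +
   c ^+ 4 * (phi4 x * trunc_hilbert e f2 x) ^+ 4)%:E)%E).
  apply: le_integralT; [by meas|by meas| |move=> x].
    by move=> x; rewrite mulr_ge0//; case: ifP.
  case: ifP => Tc; last by rewrite mulr0 addr_ge0.
  rewrite mulr1 !exprMn W2 W4 (mulrCA (c ^+ 2)) (mulrCA (c ^+ 4)) -mulrDr ler_peMr//.
  have := ler_normD (trunc_hilbert e f1 x) (trunc_hilbert e f2 x); rewrite -TD => T12.
  have := ler_wpM2r (ltW c0) T12; rewrite mulrDl => T12c.
  have [t1|t1] := leP 1 (`|trunc_hilbert e f1 x| * c).
    apply: ler_wpDr; first by rewrite mulr_ge0.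
    rewrite -exprMn -(real_normK (num_real (_ * _))) normrM (gtr0_norm c0) mulrC.
    by rewrite exprn_ege1.
  have t2 : 1 <= `|trunc_hilbert e f2 x| * c by lra.
  apply: ler_wpDl; first by rewrite mulr_ge0// sqr_ge0.
  have -> : c ^+ 4 * trunc_hilbert e f2 x ^+ 4 = (`|trunc_hilbert e f2 x| * c) ^+ 4.
    by rewrite exprMn -normrX (ger0_norm (pow4_ge0 _)) mulrC.
  exact: exprn_ege1.
rewrite ge0_integralDT; [|by meas|by meas|by []|by []].
rewrite ge0_integralZT; [|by meas|by move=> x; rewrite sqr_ge0|by rewrite sqr_ge0].
rewrite ge0_integralZT; [|by meas|by []|by []].
have c20 : (0 <= (c ^+ 2)%:E)%E by rewrite lee_fin sqr_ge0.
have c40 : (0 <= (c ^+ 4)%:E)%E by rewrite lee_fin.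
apply: (le_trans (leeD (lee_wpmul2l c20 h1) (lee_wpmul2l c40 h2))).
rewrite muleCA (muleCA (c ^+ 4)%:E).
rewrite -(@ge0_integralZT _ (c ^+ 2) (fun t => (phi2 t * f1 t) ^+ 2));
  [|by meas|by move=> x; rewrite sqr_ge0|by rewrite sqr_ge0].
rewrite -(@ge0_integralZT _ (c ^+ 4) (fun t => (phi4 t * f2 t) ^+ 4)); [|by meas|by []|by []].
rewrite EFinD ge0_muleDl ?lee_fin//.
apply: leeD; apply: lee_wpmul2l; rewrite ?lee_fin//.
- apply: le_integralT; [by meas|by meas|by move=> x|move=> x].
  rewrite exprMn W2 mulrCA ler_wpM2l// -split_psi mulrC -exprMn lerDl//.
- apply: le_integralT; [by meas|by meas|by move=> x|move=> x].
  by rewrite exprMn W4 mulrCA ler_wpM2l// -split_psi mulrC -exprMn lerDr sqr_ge0.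
Qed.

End level_estimates.

(** * The modular inequality for truncated Hilbert transforms *)

Section modular_inequality.
Context {R : realType}.
Local Notation mu := (@lebesgue_measure R).
Implicit Types (f g : R -> R).

(** Where 1 + |x| >= exp N the frozen weight is the true one. On the remaining ball,
  of length at most 2 exp N, the integrand is at most exp (- 23 N / 8). *)
Lemma low_level : exists2 K : R, 0 <= K & forall f (e L : R) (N : nat),
  measurable_fun setT f -> (\int[mu]_t (`|f t| `^ pexp t)%:E < +oo)%E -> 0 < e -> 2 <= L ->
  (\int[mu]_x (if expR (- N%:R) <= `|trunc_hilbert e f x| / L then expR (- (N%:R * pexp x)) else 0)%:E <=
   \int[mu]_x (if `|x - 0| <= expR N%:R - 1 then expR (- (N%:R * (3 - 8^-1))) else 0)%:E +
   K%:E * \int[mu]_t (low_weight N t * psi (`|f t| * expR N%:R))%:E)%E.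
Proof.
have [K K0 HK] := @weighted_level R; exists K => // f e L N mf foo e0 L2.
have mT := measurable_trunc_hilbert e mf; have mp := @measurable_pexp R.
have mw := @measurable_low_weight R N.
have E0 : 0 < expR (N%:R : R) by exact: expR_gt0.
have N0 : 0 <= N%:R :> R by [].
have L0 : 0 < L by lra.
pose phi (r : nat) x : R := expR (- (low_exponent N x / r%:R)).
have mphi r : measurable_fun setT (phi r).
  have me : measurable_fun setT (fun x : R => expo (Num.max (wgt x) (expR N%:R))).
    by apply: measurable_expo; rewrite /wgt; meas.
  by rewrite /phi /low_exponent; meas.
have phib r x : 0 < phi r x <= 1.
  rewrite expR_gt0/= -[leRHS]expR0 ler_expR oppr_le0 divr_ge0//.
  by rewrite mulr_ge0//; have := expo_bounds (Num.max (wgt x) (expR N%:R)) => /andP[h _]; lra.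
have phiX r x : (0 < r)%N -> phi r x ^+ r = low_weight N x.
  move=> r0; rewrite low_weightE /phi -expRM_natr mulNr divfK//.
  by rewrite pnatr_eq0 -lt0n.
have hK := HK (low_weight N) (phi 2) (phi 4) f pexp (expR N%:R) e (mphi 2) (mphi 4) mf mp
  (@pexp_bounds R) foo E0 e0 (phib 2) (phib 4)
  (low_weight_root_slow N (isT : 0 < 2)%N) (low_weight_root_slow N (isT : 0 < 4)%N)
  (fun x => phiX 2 x isT) (fun x => phiX 4 x isT).
apply: le_trans (leeD2l _ hK); rewrite -ge0_integralDT; [|by meas|by meas| |]; last 2 first.
- by move=> x; case: ifP => // _; exact: expR_ge0.
- by move=> x; rewrite mulr_ge0 ?expR_ge0//; case: ifP.
apply: le_integralT; [by meas|by meas| |move=> x].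
  by move=> x; case: ifP => // _; exact: expR_ge0.
case: ifP => Tx; last first.
  by rewrite addr_ge0//; [case: ifP => // _; exact: expR_ge0|rewrite mulr_ge0 ?expR_ge0//; case: ifP].
rewrite subr0; case: (leP `|x| (expR N%:R - 1)) => xN.
  apply: ler_wpDr; first by rewrite mulr_ge0 ?expR_ge0//; case: ifP.
  rewrite ler_expR lerN2 ler_wpM2l//.
  by have /andP[] := expo_bounds (wgt x).
rewrite add0r ifT; last first.
  rewrite -ler_pdivrMr// -expRN; apply: le_trans (_ : L * expR (- N%:R) <= _); last first.
    by rewrite mulrC -ler_pdivlMr.
  by rewrite ler_wpM2r ?expR_ge0.
rewrite mulr1 low_weightE ler_expR lerN2 /low_exponent max_l//.
by rewrite /wgt; lra.
Qed.

(** The transform of the far part of f at distance 1 / (n + 1) is at most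
  1 + 32 (n + 1) ^ 2; a fixed multiple of exp n exceeds twice that for every n. *)
Lemma threshold : exists2 L : R, 4 <= L &
  forall n : nat, 2 * (1 + 32 / (n.+1%:R^-1) ^+ 2) <= L * expR (n%:R : R).
Proof.
exists (2 * (33 * 4)) => [|n]; first by lra.
rewrite exprVn invrK.
have h : 1 + n%:R / 2 <= expR (n%:R / 2 : R) by exact: expR_ge1Dx.
have n0 : 0 <= n%:R :> R by [].
have : (1 + n%:R / 2) ^+ 2 <= expR (n%:R / 2 : R) ^+ 2.
  by rewrite ler_sqr ?nnegrE ?expR_ge0// addr_ge0// divr_ge0.
rewrite -expRM_natr divfK// -[n.+1%:R]natr1.
move: (n%:R : R) n0 {h} => k k0; have : 0 <= k * k by rewrite mulr_ge0.
by rewrite !expr2; lra.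
Qed.

Let far_distance (d a b c : R) : 2 * d < a -> b <= d -> a <= c + b -> d < c.
Proof. by lra. Qed.

Let near_dominates (A E L T T1 T2 : R) : 2 * (1 + A) <= L * E -> T2 <= 1 + A ->
  L * E <= T -> T <= T1 + T2 -> 4 * E <= L * E -> 2 * E <= T1.
Proof. by lra. Qed.

(** On an interval of radius d only the part of f within distance 2 d of the center
  matters: the transform of the far part is at most half the level. The weight
  enters later, when y is averaged. *)
Lemma local_level : exists2 K : R, 0 <= K & forall f (e L y : R) (n : nat),
  measurable_fun setT f -> (\int[mu]_t (`|f t| `^ pexp t)%:E <= 1)%E -> 0 < e -> 4 <= L ->
  2 * (1 + 32 / (n.+1%:R^-1) ^+ 2) <= L * expR (n%:R : R) ->
  (\int[mu]_x (if `|x - y| <= n.+1%:R^-1 then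
      if expR n%:R <= `|trunc_hilbert e f x| / L then 1 else 0 else 0)%:E <=
   K%:E * \int[mu]_t (if `|t - y| <= 2 * n.+1%:R^-1 then psi (`|f t| * expR (- n%:R)) else 0)%:E)%E.
Proof.
have [K K0 HK] := @weighted_level R; exists K => // f e L y n mf f1 e0 L4.
set d : R := n.+1%:R^-1 => Ln; have d0 : 0 < d by rewrite invr_gt0.
have d1 : d <= 1 by rewrite invf_le1// ler1n.
have L0 : 0 < L by lra.
have mp := @measurable_pexp R; have p24 := @pexp_bounds R.
pose f1' (t : R) : R := if `|t - y| <= 2 * d then f t else 0.
pose f2' (t : R) : R := if `|t - y| <= 2 * d then 0 else f t.
have mf1 : measurable_fun setT f1' by rewrite /f1'; meas.
have mf2 : measurable_fun setT f2' by rewrite /f2'; meas.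
have pw0 (t : R) : (0 : R) `^ pexp t = 0.
  by rewrite powR0// gt_eqF//; have /andP[h _] := p24 t; lra.
have f1le : (\int[mu]_t (`|f1' t| `^ pexp t)%:E <= 1)%E.
  apply: le_trans f1; apply: le_integralT; [by meas|by meas|by move=> t; exact: powR_ge0|move=> t].
  by rewrite /f1'; case: ifP => // _; rewrite normr0 pw0 powR_ge0.
have f2le : (\int[mu]_t (`|f2' t| `^ pexp t)%:E <= 1)%E.
  apply: le_trans f1; apply: le_integralT; [by meas|by meas|by move=> t; exact: powR_ge0|move=> t].
  by rewrite /f2'; case: ifP => // _; rewrite normr0 pw0 powR_ge0.
have E0 : 0 < expR (- n%:R : R) by exact: expR_gt0.
have one : slow_weight (fun _ : R => 1 : R).
  move=> x t; rewrite mul1r -[leLHS](powRr0 (wratio x t)) ler_powR// ?wratio_ge1//.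
have ob : R -> 0 < (1 : R) <= 1 by rewrite ltr01 lexx.
have hK := HK (fun=> 1) (fun=> 1) (fun=> 1) f1' pexp (expR (- n%:R)) e
  (measurable_cst _) (measurable_cst _) mf1 mp p24 (le_lt_trans f1le (ltry _)) E0 e0 ob ob one one
  (fun _ => expr1n _ _) (fun _ => expr1n _ _).
have mT := measurable_trunc_hilbert e mf; have mT1 := measurable_trunc_hilbert e mf1.
have -> : (\int[mu]_t (if `|t - y| <= 2 * d then psi (`|f t| * expR (- n%:R)) else 0)%:E =
    \int[mu]_t (1 * psi (`|f1' t| * expR (- n%:R)))%:E)%E.
  apply: eq_integralR => t _; rewrite mul1r /f1'; case: ifP => // _.
  by rewrite normr0 mul0r psi0.
apply: le_trans hK; apply: le_integralT; [by meas|by meas| |move=> x].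
  by move=> x; case: ifP => // _; case: ifP.
rewrite mul1r; case: ifP => xy; last by case: ifP.
case: ifP => Tx; last by case: ifP.
rewrite ifT//.
have TD : trunc_hilbert e f x = trunc_hilbert e f1' x + trunc_hilbert e f2' x.
  rewrite -trunc_hilbertD.
  - congr trunc_hilbert; apply/funext => t; rewrite /f1' /f2'.
    by case: ifP => _; rewrite ?addr0 ?add0r.
  - by move=> z; apply: (integrable_far mf1 mp p24 z e0 (le_lt_trans f1le (ltry _))).
  - by move=> z; apply: (integrable_far mf2 mp p24 z e0 (le_lt_trans f2le (ltry _))).
pose e' := Num.max e d.
have e'0 : 0 < e' by rewrite lt_max e0.
have far : trunc_hilbert e f2' x = trunc_hilbert e' f2' x.
  apply: eq_Rintegral => t _; rewrite /f2'; case: (leP `|t - y| (2 * d)) => ty; first by rewrite !mul0r.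
  have tx : d < `|t - x|.
    exact: far_distance ty xy (ler_distD x t y).
  congr (_ * _); rewrite /tkernel /e' gt_max tx andbT//.
have T2 : `|trunc_hilbert e f2' x| <= 1 + 32 / d ^+ 2.
  rewrite far; apply: Rintegral_abs_le.
    exact: (integrable_far mf2 mp p24 x e'0 (le_lt_trans f2le (ltry _))).
  have de' : d <= e' by rewrite le_max lexx orbT.
  apply: le_trans (integral_far_le mf2 mp p24 x d0 d1 de') _.
  by rewrite EFinD leeD2r.
have LT : L * expR n%:R <= `|trunc_hilbert e f x| by rewrite mulrC -ler_pdivlMr.
have T1 : 2 * expR n%:R <= `|trunc_hilbert e f1' x|.
  have T12 := ler_normD (trunc_hilbert e f1' x) (trunc_hilbert e f2' x); rewrite -TD in T12.
  have L4n : 4 * expR n%:R <= L * expR (n%:R : R) by rewrite ler_wpM2r// expR_ge0.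
  exact: near_dominates Ln T2 LT T12 L4n.
by rewrite expRN ler_pdivlMr ?expR_gt0.
Qed.

(** Over distances at most 2 / (n + 1) the weight exp (n p) is constant up to a
  factor exp 1. *)
Let exponent_shift (n p q u d : R) : 0 <= n -> n * d <= 1 -> `|p - q| <= 8^-1 * u -> u <= 2 * d ->
  n * p <= n * q + 1.
Proof.
move=> n0 nd pq ud; have := ler_norm (p - q) => h.
have h1 : n * (p - q) <= n * (8^-1 * (2 * d)) by rewrite ler_wpM2l//; lra.
lra.
Qed.

(** The local estimate is multiplied by the value of the weight at the center y of
  the interval and integrated over y; both sides then carry a multiple of the
  length of the interval, which cancels. *)
Lemma high_level : exists2 K : R, 0 <= K & forall f (e L : R) (n : nat),
  measurable_fun setT f -> (\int[mu]_t (`|f t| `^ pexp t)%:E <= 1)%E -> 0 < e -> 4 <= L ->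
  2 * (1 + 32 / (n.+1%:R^-1) ^+ 2) <= L * expR (n%:R : R) ->
  (\int[mu]_x (if expR n%:R <= `|trunc_hilbert e f x| / L then expR (n%:R * pexp x) else 0)%:E <=
   K%:E * \int[mu]_t (expR (n%:R * pexp t) * psi (`|f t| * expR (- n%:R)))%:E)%E.
Proof.
have [K K0 HK] := local_level.
pose E1 : R := expR 1; have E10 : 0 < E1 by exact: expR_gt0.
exists (2 * (K * (E1 * E1))) => [|f e L n mf f1 e0 L4 Ln].
  by rewrite !mulr_ge0// ltW.
pose d : R := n.+1%:R^-1; have d0 : 0 < d by rewrite invr_gt0.
have n0 : 0 <= n%:R :> R by [].
have nd : n%:R * d <= 1 by rewrite ler_pdivrMr// mul1r ler_nat.
have mT := measurable_trunc_hilbert e mf; have mp := @measurable_pexp R.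
pose X (x : R) : R := if expR n%:R <= `|trunc_hilbert e f x| / L then 1 else 0.
have mX : measurable_fun setT X by rewrite /X; meas.
have X0 x : 0 <= X x by rewrite /X; case: ifP.
pose P (t : R) : R := psi (`|f t| * expR (- n%:R)).
have mP : measurable_fun setT P by apply: (measurableT_comp (@measurable_psi R)); meas.
have P0 t : 0 <= P t by exact: psi_ge0.
pose Y (x : R) : R := expR (n%:R * pexp x).
have mY : measurable_fun setT Y by rewrite /Y; meas.
have Y0 x : 0 <= Y x by exact: expR_ge0.
have shift x y : `|x - y| <= 2 * d -> Y x <= E1 * Y y.
  move=> xy; rewrite /Y /E1 -expRD ler_expR addrC.
  exact: exponent_shift n0 nd (pexp_lipschitz x y) xy.
pose F (x y : R) : R := (if `|x - y| <= d then X x else 0) * (E1 * Y y).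
have F0 x y : 0 <= F x y.
  by rewrite /F !mulr_ge0// ?(ltW E10)//; case: ifP.
have mX1 : measurable_fun setT (fun z : R * R => X z.1) by exact: measurableT_comp mX (measurable_fst).
have mY2 : measurable_fun setT (fun z : R * R => Y z.2) by exact: measurableT_comp mY (measurable_snd).
have mF : measurable_fun setT (fun z : R * R => F z.1 z.2) by rewrite /F; meas.
pose k (y t : R) : R := if `|t - y| <= 2 * d then 1 else 0.
have mk : measurable_fun setT (fun z : R * R => k z.1 z.2) by rewrite /k; meas.
pose g (t : R) : R := K * (E1 * E1) * (Y t * P t).
have g0 t : 0 <= g t by rewrite /g !mulr_ge0// ltW.
have mg : measurable_fun setT g by rewrite /g; meas.
have mg2 : measurable_fun setT (fun z : R * R => g z.2) by exact: measurableT_comp mg (measurable_snd).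
have k0 y t : 0 <= k y t by rewrite /k; case: ifP.
have mkg : measurable_fun setT (fun z : R * R => k z.1 z.2 * g z.2) by meas.
have step1 : (\int[mu]_x (2 * d * (X x * Y x))%:E <= \int[mu]_x \int[mu]_y (F x y)%:E)%E.
  apply: ge0_le_integralT; [by meas|exact: measurable_integral_param| |move=> x].
    by move=> x; rewrite lee_fin !mulr_ge0// ltW.
  rewrite (_ : 2 * d * (X x * Y x) = X x * Y x * (2 * d)); last by rewrite mulrC.
  rewrite -(integral_ball_cst (X x * Y x) x (ltW d0)).
  apply: le_integralT; [by meas| |by move=> y; case: ifP => // _; rewrite mulr_ge0|move=> y].
    by rewrite /F; meas.
  rewrite /F distrC; case: ifP => xy; last by rewrite mul0r.
  by rewrite ler_wpM2l// shift// (le_trans xy)//; lra.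
have step2 : (\int[mu]_x \int[mu]_y (F x y)%:E <= \int[mu]_y \int[mu]_t (k y t * g t)%:E)%E.
  rewrite fubini_swap; [|exact: mF|exact: F0]; apply: ge0_le_integralT.
  - apply: (@measurable_integral_param _ (fun y x => F x y)) => //.
    by rewrite /F; meas.
  - by apply: measurable_integral_param => // y t; rewrite mulr_ge0.
  - by move=> y; apply: integralT_ge0.
  - move=> y; rewrite /F; under eq_integral do rewrite mulrC.
    rewrite ge0_integralZT; [|by meas|by move=> x; case: ifP|by rewrite mulr_ge0// ltW].
    have EY0 : (0 <= (E1 * Y y)%:E)%E by rewrite lee_fin mulr_ge0// ltW.
    pose Q (t : R) : R := if `|t - y| <= 2 * d then P t else 0.
    have mQ : measurable_fun setT Q by rewrite /Q; meas.
    have Q0 t : 0 <= Q t by rewrite /Q; case: ifP.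
    have HKy : (\int[mu]_x (if `|x - y| <= d then X x else 0)%:E <= K%:E * \int[mu]_t (Q t)%:E)%E.
      exact: HK f e L y n mf f1 e0 L4 Ln.
    apply: (le_trans (lee_wpmul2l EY0 HKy)).
    rewrite -ge0_integralZT// -ge0_integralZT; [|by meas|by move=> t; rewrite mulr_ge0|by rewrite mulr_ge0// ltW].
    apply: le_integralT; [by meas|by rewrite /k; meas| |move=> t].
      by move=> t; rewrite !mulr_ge0// ltW.
    rewrite /k /Q; case: ifP => ty; last by rewrite !mulr0 mul0r.
    rewrite mul1r /g.
    rewrite (_ : E1 * Y y * (K * P t) = K * E1 * P t * Y y); last by ring.
    rewrite (_ : K * (E1 * E1) * (Y t * P t) = K * E1 * P t * (E1 * Y t)); last by ring.
    by rewrite ler_wpM2l// ?mulr_ge0 ?(ltW E10)// shift// distrC.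
have step3 : (\int[mu]_y \int[mu]_t (k y t * g t)%:E <= \int[mu]_t (2 * (2 * d) * g t)%:E)%E.
  apply: (@tonelli_le _ k g (fun=> 2 * (2 * d))) => // t.
  rewrite /k; under eq_integral do rewrite distrC.
  by rewrite integral_ball_cst ?mulr_ge0 ?(ltW d0)// mul1r.
have := le_trans step1 (le_trans step2 step3).
rewrite ge0_integralZT; [|by meas|by move=> x; rewrite mulr_ge0|by rewrite mulr_ge0// ltW].
rewrite ge0_integralZT; [|by meas|by []|by rewrite !mulr_ge0// ltW].
rewrite /g ge0_integralZT; [|by meas|by move=> x; rewrite mulr_ge0|by rewrite !mulr_ge0// ltW].
rewrite muleA -EFinM (_ : 2 * (2 * d) * (K * (E1 * E1)) = 2 * d * (2 * (K * (E1 * E1)))); last by ring.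
rewrite (EFinM (2 * d) (2 * (K * (E1 * E1)))) -muleA lee_pmul2l//; last by rewrite lte_fin mulr_gt0.
apply: le_trans; rewrite le_eqVlt; apply/orP; left; apply/eqP.
by apply: eq_integralR => x _; rewrite /X /Y; case: ifP => _; rewrite ?mul1r ?mul0r.
Qed.

(** Dividing by L raises every level by the constant factor that the level estimates
  ask for, and costs L ^ 4 at most. *)
Lemma modular_bound : exists2 C : R, 0 <= C & forall f (e : R),
  measurable_fun setT f -> (\int[mu]_t (`|f t| `^ pexp t)%:E <= 1)%E -> 0 < e ->
  (\int[mu]_x (`|trunc_hilbert e f x| `^ pexp x)%:E <= C%:E)%E.
Proof.
have [L L4 Ln] := threshold.
have [KH KH0 high] := high_level; have [KL KL0 low] := low_level.
have [CH CH0 highs] := @high_levels_sum R; have [CL CL0 lows] := @low_levels_sum R.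
have [CS CS0 exps] := @exp_series R.
have L0 : 0 < L by lra.
pose C : R := KH * CH + (2 * CS + KL * (CL * (1 + 2))).
have C0 : 0 <= C by rewrite !addr_ge0// !mulr_ge0// addr_ge0.
exists (L ^+ 4 * expR 4 * C) => [|f e mf f1 e0].
  by rewrite !mulr_ge0 ?expR_ge0 ?exprn_ge0// ltW.
have mT := measurable_trunc_hilbert e mf; have mp := @measurable_pexp R.
pose g (x : R) : R := `|trunc_hilbert e f x| / L.
have mg : measurable_fun setT g by rewrite /g; meas.
have g0 x : 0 <= g x by rewrite divr_ge0// ltW.
pose A (n : nat) (x : R) : R := if expR n%:R <= g x then expR (n%:R * pexp x) else 0.
pose B (n : nat) (x : R) : R := if expR (- n%:R) <= g x then expR (- (n%:R * pexp x)) else 0.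
have mA n : measurable_fun setT (A n) by rewrite /A; meas.
have mB n : measurable_fun setT (B n) by rewrite /B; meas.
have A0 n x : 0 <= A n x by rewrite /A; case: ifP => // _; exact: expR_ge0.
have B0 n x : 0 <= B n x by rewrite /B; case: ifP => // _; exact: expR_ge0.
have E0 : (0 <= (L ^+ 4 * expR 4)%:E)%E by rewrite lee_fin mulr_ge0 ?expR_ge0 ?exprn_ge0// ltW.
have mS (h : nat -> R -> R) : (forall n, measurable_fun setT (h n)) -> (forall n x, 0 <= h n x) ->
    measurable_fun setT (fun x => \sum_(n <oo) (h n x)%:E)%E.
  move=> mh h0; apply: ge0_emeasurable_sum => // [n x _ _|n _]; first by rewrite lee_fin.
  exact: measurable_EFin.
have S0 (h : nat -> R -> R) x : (forall n x, 0 <= h n x) -> (0 <= \sum_(n <oo) (h n x)%:E)%E.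
  by move=> h0; apply: nneseries_ge0 => n _ _; rewrite lee_fin.
apply: (@le_trans _ _ (\int[mu]_x ((L ^+ 4 * expR 4)%:E *
    (\sum_(n <oo) (A n x)%:E + \sum_(n <oo) (B n x)%:E)))%E).
  apply: ge0_le_integralT; first by meas.
  - by apply: measurable_funeM; apply: emeasurable_funD; exact: mS.
  - by move=> x; rewrite lee_fin powR_ge0.
  - move=> x; have p24 := pexp_bounds x.
    apply: (@le_trans _ _ ((L ^+ 4)%:E * (g x `^ pexp x)%:E)%E); last first.
      rewrite (EFinM (L ^+ 4) (expR 4)) -muleA lee_wpmul2l ?lee_fin ?exprn_ge0 ?(ltW L0)//.
      exact: layer_cake.
    rewrite -EFinM lee_fin.
    rewrite (_ : `|trunc_hilbert e f x| = L * g x); last by rewrite mulrC divfK// gt_eqF.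
    rewrite powRM ?(ltW L0)// ler_wpM2r ?powR_ge0//.
    rewrite -powR_mulrn ?(ltW L0)// ler_powR//; first by lra.
    by case/andP: p24.
rewrite ge0_integralZl//; last 2 first.
- by apply: emeasurable_funD; exact: mS.
- by move=> x _; rewrite adde_ge0// S0.
rewrite (EFinM (L ^+ 4 * expR 4) C) lee_wpmul2l//.
rewrite ge0_integralD//; last 4 first.
- by move=> x _; exact: S0.
- exact: mS.
- by move=> x _; exact: S0.
- exact: mS.
rewrite !ge0_integral_seriesT// /C EFinD; apply: leeD.
  apply: (@le_trans _ _ (\sum_(n <oo) (KH%:E * \int[mu]_t (expR (n%:R * pexp t) * psi (`|f t| * expR (- n%:R)))%:E))%E).
    apply: lee_nneseries => [n _ _|n _]; first exact: integralT_ge0.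
    exact: high.
  rewrite nneseriesZl; last first.
    by move=> n _; apply: integralT_ge0 => t; rewrite mulr_ge0 ?expR_ge0 ?psi_ge0.
  rewrite (EFinM KH CH) lee_wpmul2l//; apply: (le_trans (highs f mf)).
  by rewrite -[leRHS]mule1 lee_wpmul2l.
have foo := le_lt_trans f1 (ltry 1).
apply: (@le_trans _ _ (\sum_(n <oo) ((2 * expR (- (3 / 4 * `|0 - n%:R|)))%:E +
   KL%:E * \int[mu]_t (low_weight n t * psi (`|f t| * expR n%:R))%:E))%E).
  apply: lee_nneseries => [n _ _|n _]; first exact: integralT_ge0.
  have L2 : 2 <= L by lra.
  apply: (le_trans (low f e L n mf foo e0 L2)); rewrite leeD2r//.
  have n0 : 0 <= n%:R :> R by [].
  have E1 : 1 <= expR (n%:R : R) by rewrite -[leLHS]expR0 ler_expR.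
  rewrite integral_ball_cst ?subr_ge0// lee_fin sub0r normrN ger0_norm//.
  apply: (@le_trans _ _ (expR (- (n%:R * (3 - 8^-1))) * (2 * expR n%:R))).
    by rewrite ler_wpM2l ?expR_ge0//; lra.
  rewrite mulrCA ler_wpM2l// -expRD ler_expR; move: (n%:R : R) n0 => k; lra.
rewrite nneseriesD; last 2 first.
- by move=> n _ _; rewrite lee_fin mulr_ge0 ?expR_ge0.
- by move=> n _ _; rewrite mule_ge0//; apply: integralT_ge0 => t; rewrite mulr_ge0 ?expR_ge0 ?psi_ge0.
rewrite EFinD; apply: leeD.
  under eq_eseriesr do rewrite (EFinM 2).
  rewrite nneseriesZl; last by move=> n _; rewrite lee_fin expR_ge0.
  by rewrite (EFinM 2 CS) lee_wpmul2l.
rewrite nneseriesZl; last first.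
  by move=> n _; apply: integralT_ge0 => t; rewrite mulr_ge0 ?expR_ge0 ?psi_ge0.
rewrite (EFinM KL (CL * (1 + 2))) lee_wpmul2l//; apply: (le_trans (lows f mf)).
by rewrite (EFinM CL (1 + 2)) lee_wpmul2l// (EFinD 1 2) leeD2r.
Qed.

End modular_inequality.

(** * Complex limits and slow oscillation of the exponent *)

Section complex_limits.
Context {R : realType}.
Local Notation C := R[i]^o.

Lemma normcE_sqrt (z : R[i]) : normc z = Num.sqrt (complex.Re z ^+ 2 + complex.Im z ^+ 2).
Proof. by case: z. Qed.

Lemma norm_normc (z : C) : `|z| = (normc z)%:C.
Proof. by rewrite normc_def normcE_sqrt. Qed.

Lemma normcR (r : R) : normc (r%:C) = `|r|.
Proof. by rewrite normcE_sqrt/= expr0n addr0 sqrtr_sqr. Qed.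

Lemma Re_le_normc (z : R[i]) : `|complex.Re z| <= normc z.
Proof. by rewrite normcE_sqrt -sqrtr_sqr ler_wsqrtr// lerDl sqr_ge0. Qed.

Lemma Im_le_normc (z : R[i]) : `|complex.Im z| <= normc z.
Proof. by rewrite normcE_sqrt -sqrtr_sqr ler_wsqrtr// lerDr sqr_ge0. Qed.

Lemma normc_le_ReIm (z : R[i]) : normc z <= `|complex.Re z| + `|complex.Im z|.
Proof.
rewrite normcE_sqrt -(ger0_norm (_ : 0 <= `|complex.Re z| + `|complex.Im z|)) ?addr_ge0//.
rewrite -sqrtr_sqr ler_wsqrtr// sqrrD !real_normK ?num_real//.
by rewrite addrAC lerDl mulrn_wge0// mulr_ge0.
Qed.

Lemma normc_ge0 (z : R[i]) : 0 <= normc z.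
Proof. by rewrite normcE_sqrt sqrtr_ge0. Qed.

Lemma gt0_complexE (e : R[i]) : 0 < e -> e = (complex.Re e)%:C /\ 0 < complex.Re e.
Proof.
case: e => a b; rewrite ltcE/= => /andP[/eqP -> a0].
by split.
Qed.

Lemma Re_div_real (z : R[i]) (r : R) : complex.Re (z / r%:C) = complex.Re z / r.
Proof.
have [->|r0] := eqVneq r 0; first by rewrite !invr0 !mulr0.
by rewrite -fmorphV; case: z => a b /=; rewrite mulr0 subr0.
Qed.

Lemma Im_div_real (z : R[i]) (r : R) : complex.Im (z / r%:C) = complex.Im z / r.
Proof.
have [->|r0] := eqVneq r 0; first by rewrite !invr0 !mulr0.
by rewrite -fmorphV; case: z => a b /=; rewrite mulr0 add0r.
Qed.

Lemma normc_div_real (z : R[i]) (r : R) : 0 < r -> normc (z / r%:C) = normc z / r.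
Proof. by move=> r0; rewrite normcM normcV normcR gtr0_norm. Qed.

Lemma cvg_complex {T : Type} (F : set_system T) {FF : Filter F} (a b : T -> R) (la lb : R) :
  a t @[t --> F] --> la -> b t @[t --> F] --> lb ->
  ((a t +i* b t : C) @[t --> F] --> (la +i* lb : C)).
Proof.
move=> al bl; apply/cvgrPdist_lt => e /gt0_complexE[-> e0].
have e20 : 0 < complex.Re e / 2 by rewrite divr_gt0.
near=> t; rewrite norm_normc ltcR; apply: (le_lt_trans (normc_le_ReIm _)) => /=.
rewrite [ltRHS](splitr (complex.Re e)) ltrD//; near: t.
  by apply: cvgr_dist_lt.
by apply: cvgr_dist_lt.
Unshelve. all: by end_near. Qed.

Lemma cvg_Re {T : Type} (F : set_system T) {FF : Filter F} (f : T -> C) (l : C) :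
  f t @[t --> F] --> l -> complex.Re (f t) @[t --> F] --> complex.Re l.
Proof.
move=> fl; apply/cvgrPdist_lt => e e0.
have e0' : (0 : R[i]) < e%:C by rewrite ltcR.
near=> t.
have : `|l - f t| < e%:C by near: t; exact: cvgr_dist_lt fl _ e0'.
rewrite norm_normc ltcR; apply: le_lt_trans; apply: le_trans (Re_le_normc _).
by case: (l) => ? ?; case: (f t).
Unshelve. all: by end_near. Qed.

Lemma cvg_Im {T : Type} (F : set_system T) {FF : Filter F} (f : T -> C) (l : C) :
  f t @[t --> F] --> l -> complex.Im (f t) @[t --> F] --> complex.Im l.
Proof.
move=> fl; apply/cvgrPdist_lt => e e0.
have e0' : (0 : R[i]) < e%:C by rewrite ltcR.
near=> t.
have : `|l - f t| < e%:C by near: t; exact: cvgr_dist_lt fl _ e0'.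
rewrite norm_normc ltcR; apply: le_lt_trans; apply: le_trans (Im_le_normc _).
by case: (l) => ? ?; case: (f t).
Unshelve. all: by end_near. Qed.

End complex_limits.

Section slow_oscillation.
Context {R : realType}.
Local Notation mu := (@lebesgue_measure R).
Local Notation C := R[i]^o.

Lemma continuous_pexp : continuous (@pexp R).
Proof.
move=> x; apply/cvgrPdist_lt => e e0; near=> t.
apply: (le_lt_trans (pexp_lipschitz x t)).
apply: (@le_lt_trans _ _ `|x - t|); first by rewrite ler_piMl//; lra.
by near: t; apply: cvgr_dist_lt.
Unshelve. all: by end_near. Qed.

(** Over the shell ln (1 + |t|) changes by at most 1. *)
Lemma pexp_annulus (x s t : R) : 1 <= x -> x <= `|s| <= 2 * x -> x <= `|t| <= 2 * x ->
  `|pexp s - pexp t| <= (1 + ln (1 + x))^-1.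
Proof.
move=> x1 sb tb; wlog st : s t sb tb / wgt t <= wgt s.
  move=> H; have [h|/ltW h] := leP (wgt t) (wgt s); first exact: H.
  by rewrite distrC; exact: H.
have t0 := wgt_gt0 t; have s0 := wgt_gt0 s.
case/andP: sb => s1 s2; case/andP: tb => t1 t2.
have xt : 1 + x <= wgt t by rewrite /wgt lerD2l.
have x0 : 0 < 1 + x by lra.
have lx : 0 <= ln (1 + x) by apply: ln_ge0; lra.
have lxt : ln (1 + x) <= ln (wgt t) by rewrite ler_ln ?posrE.
apply: (le_trans (expo_slow (wgt_ge1 t) st)).
have : ln (wgt s) - ln (wgt t) <= 1.
  rewrite -ln_div ?posrE// (_ : wgt s / wgt t = 1 + (wgt s - wgt t) / wgt t); last first.
    by field; rewrite gt_eqF.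
  have h0 : 0 <= (wgt s - wgt t) / wgt t by rewrite divr_ge0 ?subr_ge0// ltW.
  apply: (le_trans (le_ln1Dx _)); first by lra.
  by rewrite ler_pdivrMr// mul1r; rewrite /wgt in xt st *; lra.
move=> d1; apply: (@le_trans _ _ (8^-1 * (1 / (1 + ln (1 + x))))).
  rewrite ler_wpM2l ?invr_ge0//; apply: ler_pM; rewrite ?subr_ge0 ?ler_ln ?posrE//.
    by rewrite invr_ge0; lra.
  by rewrite lef_pV2 ?posrE; lra.
rewrite div1r ler_piMl ?invr_ge0; lra.
Qed.

Lemma SO_pexp : SO (fun x : R => (pexp x)%:C).
Proof.
split.
- move=> x; apply: cvg_complex; first exact: continuous_pexp.
  exact: cvg_cst.
- exists 4 => x; rewrite normcR ger0_norm; have /andP[] := pexp_bounds x => // h1 h2.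
  by lra.
- have inv_cvg : ((1 + ln (1 + x))^-1 : R)%:E @[x --> +oo%R] --> 0%E.
    apply: cvg_EFin; first exact: nearW.
    apply/cvgrPdist_lt => e e0; near=> x; rewrite /= sub0r normrN.
    have xe : expR e^-1 <= x by near: x; exact: nbhs_pinfty_ge (num_real _).
    have x0 : 0 < x by exact: lt_le_trans (expR_gt0 _) xe.
    have lx : e^-1 <= ln (1 + x).
      rewrite -[leLHS]expRK ler_ln ?posrE ?expR_gt0//; lra.
    have ei : 0 < e^-1 by rewrite invr_gt0.
    rewrite gtr0_norm; last by rewrite invr_gt0; lra.
    by rewrite -[ltRHS]invrK ltf_pV2 ?posrE; lra.
  apply: (@squeeze_cvge _ _ _ _ (cst 0%E) _ _ _ 0%E _ inv_cvg); last exact: cvg_cst.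
  near=> x; have x1 : 1 <= x by near: x; exact: nbhs_pinfty_ge (num_real _).
  have memJ (s : R) : (`[- (2 * x), - x] `|` `[x, 2 * x])%classic s -> x <= `|s| <= 2 * x.
    by case; rewrite /= in_itv/= => /andP[h1 h2]; [rewrite ler0_norm|rewrite ger0_norm]; lra.
  apply/andP; split.
    apply: (@le_trans _ _ (normc ((pexp x)%:C - (pexp x)%:C))%:E); first by rewrite lee_fin normc_ge0.
    apply: ereal_sup_ubound; exists (x, x) => //.
    by split; right; rewrite /= in_itv/=; lra.
  apply: ge_ereal_sup => _ [[s t] /= [Js Jt] <-]; rewrite lee_fin.
  rewrite subrr expr0n addr0 sqrtr_sqr.
  exact: pexp_annulus x1 (memJ _ Js) (memJ _ Jt).
Unshelve. all: by end_near. Qed.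

Lemma pexp_ln_ln (th : R) : 0 <= th ->
  pexp (expR (expR th - 1) - 1) = 3 + 8^-1 * sin th.
Proof.
move=> th0; have e1 : 1 <= expR th by rewrite -[leLHS]expR0 ler_expR.
have e2 : 1 <= expR (expR th - 1) by rewrite -[leLHS]expR0 ler_expR subr_ge0.
have K (a : R) : 1 + (a - 1) = a by rewrite addrC subrK.
by rewrite /pexp /expo /wgt ger0_norm ?subr_ge0// K expRK K expRK.
Qed.

(** Along the points where the phase is pi / 2, resp. - pi / 2, modulo 2 pi, p takes
  the values 3 + 1 / 8 and 3 - 1 / 8. *)
Lemma not_Cdot_pexp : ~ Cdot (fun x : R => (pexp x)%:C).
Proof.
move=> [_ [l [_ lp]]].
have cv : pexp t @[t --> +oo%R] --> complex.Re l by exact: (cvg_Re lp).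
have e0 : 0 < 8^-1 :> R by rewrite invr_gt0.
have : \forall t \near +oo%R, `|complex.Re l - pexp t| < 8^-1 by exact: cvgr_dist_lt cv _ e0.
move=> [A [Ar HA]].
pose n := (Num.truncn `|A|).+1.
have nA : A < n%:R by apply: le_lt_trans (ler_norm A) (truncnS_gt _).
have pt (c : R) : -2 <= c -> exists2 x : R, A < x & pexp x = 3 + 8^-1 * sin c.
  move=> c2; pose th := c + (pi *+ 2) *+ n.+1.
  have thn : n%:R <= th.
    rewrite /th -mulrnA -[pi *+ _]mulr_natr natrM -[n.+1%:R]natr1.
    have p2 := @pi_ge2 R; have n0 : 0 <= n%:R :> R by [].
    have : 2 * (2 * (n%:R + 1)) <= pi * (2 * (n%:R + 1)) :> R.
      by rewrite ler_wpM2r//; lra.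
    lra.
  have th0 : 0 <= th by exact: le_trans thn.
  exists (expR (expR th - 1) - 1).
    have := expR_ge1Dx th; have := expR_ge1Dx (expR th - 1); lra.
  by rewrite pexp_ln_ln// /th (periodicn (@sinD2pi R)).
have p2 := @pi_ge2 R; have p1 : pi / 2 <= 2 :> R by exact/ltW/pihalf_lt2.
have c1 : -2 <= pi / 2 :> R by lra.
have c2 : -2 <= - (pi / 2) :> R by lra.
have [x Ax px] := pt _ c1.
have [y Ay py] := pt _ c2.
have := HA _ Ax; have := HA _ Ay; rewrite /= px py sinN sin_pihalf => h1 h2.
move: h1 h2; rewrite !ltr_distl => /andP[h1 h2] /andP[h3 h4].
by move: h1 h2 h3 h4; move: (complex.Re l) => L; lra.
Qed.

End slow_oscillation.

(** * Limits of the truncations *)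

Section principal_value_limits.
Context {R : realType}.
Local Notation mu := (@lebesgue_measure R).
Implicit Types (f g : R -> R).

Lemma cvg_powR_base (u : nat -> R) (l p : R) : 0 < p -> (forall n, 0 <= u n) ->
  u n @[n --> \oo] --> l -> u n `^ p @[n --> \oo] --> l `^ p.
Proof.
move=> p0 u0 ul.
have l0 : 0 <= l.
  by rewrite -(cvg_lim _ ul)//; apply: limr_ge; [apply/cvg_ex; exists l|exact: nearW].
move: l0; rewrite le_eqVlt => /predU1P[l0|l0].
  rewrite -l0 powR0 ?gt_eqF//; apply/cvgrPdist_lt => e e0.
  have d0 : 0 < e `^ p^-1 by exact: powR_gt0.
  near=> n; rewrite sub0r normrN ger0_norm ?powR_ge0//.
  have un : u n < e `^ p^-1.
    have : `|l - u n| < e `^ p^-1 by near: n; exact: cvgr_dist_lt ul _ d0.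
    by rewrite -l0 sub0r normrN ger0_norm.
  have := gt0_ltr_powR p0 (_ : u n \in Num.nneg) (_ : e `^ p^-1 \in Num.nneg) un.
  rewrite -powRrM mulVf ?gt_eqF// powRr1 ?(ltW e0)//.
  by apply; rewrite nnegrE ?(ltW d0).
rewrite (powR_expR_ln p l0).
have cl : p * ln (u n) @[n --> \oo] --> p * ln l.
  apply: cvgM; first exact: cvg_cst.
  exact: (cvg_comp _ _ ul (continuous_ln l0)).
have ce := cvg_comp _ _ cl (@continuous_expR R (p * ln l)).
apply: cvg_trans ce; apply: near_eq_cvg; near=> n.
rewrite /= powR_expR_ln//; near: n.
exact: cvgr_gt ul _ l0.
Unshelve. all: by end_near. Qed.

Variables (f p : R -> R).
Hypotheses (mf : measurable_fun setT f) (mp : measurable_fun setT p).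
Hypothesis p24 : forall t, 2 <= p t <= 4.
Hypothesis foo : (\int[mu]_t (`|f t| `^ p t)%:E < +oo)%E.

Definition grid (n k : nat) : R := k.+1%:R / n.+1%:R.

Let upper (a : R) (n : nat) : R := grid n (Num.truncn (a * n.+1%:R)).

Let upper_gt a n : 0 <= a -> a < upper a n.
Proof. by move=> a0; rewrite ltr_pdivlMr//; exact: truncnS_gt. Qed.

Let upper_le a n : 0 <= a -> upper a n <= a + n.+1%:R^-1.
Proof.
move=> a0; rewrite ler_pdivrMr// mulrDl mulVf// -natr1 lerD2r.
by rewrite truncn_le// mulr_ge0.
Qed.

Let upper_cvg a : 0 <= a -> upper a n @[n --> \oo] --> a.
Proof.
move=> a0; apply/cvgrPdist_lt => e e0; near=> n.
have h1 := upper_gt n a0; have h2 := upper_le n a0.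
have h3 : n.+1%:R^-1 < e by near: n; exact: near_infty_natSinv_lt (PosNum e0).
by rewrite distrC gtr0_norm ?subr_gt0// ltrBlDl (le_lt_trans h2)// ltrD2l.
Unshelve. all: by end_near. Qed.

(** The truncation at distance a removes |t - x| <= a, so the kernel is continuous
  from the right in a. This is why grid points strictly above a approximate it. *)
Let trunc_hilbert_upper a x : 0 < a ->
  trunc_hilbert (upper a n) f x @[n --> \oo] --> trunc_hilbert a f x.
Proof.
move=> a0; have a0' := ltW a0.
have fi := integrable_far mf mp p24 x a0 foo.
apply: (@Rintegral_dominated _ _ _ (fun t => `|f t * tkernel a (t - x)|)).
- by move=> n; have := mf => mf'; rewrite /tkernel; meas.
- by have := mf => mf'; rewrite /tkernel; meas.
- move=> t; rewrite /tkernel; case: (ltP a `|t - x|) => at_.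
    apply: cvg_near_cst; near=> n; rewrite ifT//; near: n.
    exact: cvgr_lt (upper_cvg a0') _ at_.
  apply: cvg_near_cst; apply: nearW => n.
  by rewrite ltNge (le_trans at_)// ltW// upper_gt.
- exact: integrable_abs_lty.
- move=> n t; rewrite !normrM ler_wpM2l// /tkernel.
  case: ifP => h1; last by rewrite normr0.
  by rewrite ifT//; apply: lt_trans h1; exact: upper_gt.
Unshelve. all: by end_near. Qed.

Definition pv_set : set R := [set x | cvg (trunc_hilbert e f x @[e --> (0 : R)^'+])].

Let osc_set (k m n1 k1 n2 k2 : nat) : set R :=
  [set x | grid n1 k1 < m.+1%:R^-1 -> grid n2 k2 < m.+1%:R^-1 ->
    `|trunc_hilbert (grid n1 k1) f x - trunc_hilbert (grid n2 k2) f x| <= k.+1%:R^-1].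

Let measurable_osc_set k m n1 k1 n2 k2 : measurable (osc_set k m n1 k1 n2 k2).
Proof.
have [h1|h1] := boolP (grid n1 k1 < m.+1%:R^-1); last first.
  by rewrite (_ : osc_set _ _ _ _ _ _ = setT)//; apply/seteqP; split => // x _ /= /idPn; rewrite h1.
have [h2|h2] := boolP (grid n2 k2 < m.+1%:R^-1); last first.
  by rewrite (_ : osc_set _ _ _ _ _ _ = setT)//; apply/seteqP; split => // x _ /= _ /idPn; rewrite h2.
have m1 := measurable_trunc_hilbert (grid n1 k1) mf.
have m2 := measurable_trunc_hilbert (grid n2 k2) mf.
pose g x : R := `|trunc_hilbert (grid n1 k1) f x - trunc_hilbert (grid n2 k2) f x|.
have mg : measurable_fun setT g by rewrite /g; meas.
rewrite (_ : osc_set _ _ _ _ _ _ = g @^-1` `]-oo, k.+1%:R^-1]).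
  by rewrite -[X in measurable X]setTI; apply: mg => //; exact: measurable_itv.
apply/seteqP; split => x; rewrite /osc_set/= in_itv/=; first by apply.
by [].
Qed.

Let grid_gt0 n k : 0 < grid n k. Proof. by rewrite divr_gt0. Qed.

Let dist_le_halves (l a b i : R) : `|l - a| < i / 2 -> `|l - b| < i / 2 -> `|a - b| <= i.
Proof. by move=> la lb; have := ler_distD l a b; rewrite (distrC a l); lra. Qed.

(** The Cauchy criterion at 0 restricted to the rational grid, which suffices by
  right continuity; this makes the set measurable. *)
Lemma pv_setE : pv_set = \bigcap_k \bigcup_m \bigcap_n1 \bigcap_k1 \bigcap_n2 \bigcap_k2 osc_set k m n1 k1 n2 k2.
Proof.
have inv0 (k : nat) : 0 < (k.+1%:R^-1 : R) by rewrite invr_gt0.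
apply/seteqP; split => x /=.
  case/cvg_ex => l cl k _; have k20 : 0 < (k.+1%:R^-1 : R) / 2 by rewrite divr_gt0.
  have : \forall e \near (0 : R)^'+, `|l - trunc_hilbert e f x| < k.+1%:R^-1 / 2.
    exact: cvgr_dist_lt cl _ k20.
  move=> [d /= d0 hd].
  have [m md] : exists m : nat, m.+1%:R^-1 < d.
    exists (Num.truncn d^-1); rewrite -[d]invrK ltf_pV2 ?posrE ?invr_gt0//.
    by rewrite invrK; exact: truncnS_gt.
  exists m => // n1 _ k1 _ n2 _ k2 _ h1 h2.
  have close n k' : grid n k' < m.+1%:R^-1 -> `|l - trunc_hilbert (grid n k') f x| < k.+1%:R^-1 / 2.
    move=> h; apply: hd => //=; rewrite sub0r normrN gtr0_norm// (lt_trans h)//.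
  exact: dist_le_halves (close _ _ h1) (close _ _ h2).
move=> H; apply: cauchy_cvg; apply: cauchy_exP => e e0.
pose k := Num.truncn e^-1.
have ke : k.+1%:R^-1 < e.
  by rewrite -[ltRHS]invrK ltf_pV2 ?posrE ?invr_gt0//; exact: truncnS_gt.
have [m _ Hm] := H k I.
have close a b : 0 < a -> a < m.+1%:R^-1 -> 0 < b -> b < m.+1%:R^-1 ->
    `|trunc_hilbert a f x - trunc_hilbert b f x| <= k.+1%:R^-1.
  move=> a0 am b0 bm.
  have c : `|trunc_hilbert (upper a n) f x - trunc_hilbert (upper b n) f x| @[n --> \oo] -->
      `|trunc_hilbert a f x - trunc_hilbert b f x|.
    by apply: cvg_norm; apply: cvgB; exact: trunc_hilbert_upper.
  rewrite -(cvg_lim _ c)//; apply: limr_le; first by apply/cvg_ex; eexists; exact: c.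
  near=> n; apply: Hm => //.
    by near: n; exact: cvgr_lt (upper_cvg (ltW a0)) _ am.
  by near: n; exact: cvgr_lt (upper_cvg (ltW b0)) _ bm.
pose b : R := m.+2%:R^-1.
have b0 : 0 < b by rewrite invr_gt0.
have bm : b < m.+1%:R^-1 by rewrite ltf_pV2 ?posrE// ltr_nat.
exists (trunc_hilbert b f x).
change (\forall a \near (0 : R)^'+, ball (trunc_hilbert b f x) e (trunc_hilbert a f x)).
near=> a.
have a0 : 0 < a by near: a; exact: nbhs_right_gt.
have am : a < m.+1%:R^-1 by near: a; apply: nbhs_right_lt; exact: inv0.
by rewrite /ball/=; apply: le_lt_trans ke; exact: close.
Unshelve. all: by end_near. Qed.

Lemma measurable_pv_set : measurable pv_set.
Proof.
rewrite pv_setE; apply: bigcap_measurableType => k _; apply: bigcup_measurable => m _.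
do 4 (apply: bigcap_measurableType => ? _).
exact: measurable_osc_set.
Qed.

(** Set to 0 where the truncations diverge, so that it is measurable on the whole line. *)
Definition pv_lim (x : R) : R := \1_pv_set x * lim (trunc_hilbert e f x @[e --> (0 : R)^'+]).

Let cutoff (n : nat) (x : R) : R := \1_pv_set x * trunc_hilbert n.+1%:R^-1 f x.

Lemma cutoff_cvg x : cutoff n x @[n --> \oo] --> pv_lim x.
Proof.
rewrite /cutoff /pv_lim indicE; case: (boolP (x \in pv_set)) => [|_].
  rewrite inE => cx; apply: cvgM; first exact: cvg_cst.
  apply: (cvg_at_rightP _ _ _).1 cx _ _; split.
    by move=> n; rewrite invr_gt0.
  apply/cvgrPdist_lt => e e0; near=> n; rewrite sub0r normrN gtr0_norm ?invr_gt0//.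
  by near: n; exact: near_infty_natSinv_lt (PosNum e0).
by rewrite mul0r; under eq_fun do rewrite mul0r; exact: cvg_cst.
Unshelve. all: by end_near. Qed.

Let measurable_cutoff n : measurable_fun setT (cutoff n).
Proof.
have mT := measurable_trunc_hilbert n.+1%:R^-1 mf.
apply: measurable_funM => //; exact: measurable_indic measurable_pv_set.
Qed.

Lemma measurable_pv_lim : measurable_fun setT pv_lim.
Proof. by apply: (measurable_fun_cvg measurable_cutoff) => x _; exact: cutoff_cvg. Qed.

(** Fatou's lemma along e = 1 / (n + 1). *)
Lemma pv_lim_modular (C s : R) : 0 < s ->
  (forall e : R, 0 < e -> (\int[mu]_x ((`|trunc_hilbert e f x| / s) `^ p x)%:E <= C%:E)%E) ->
  (\int[mu]_x ((`|pv_lim x| / s) `^ p x)%:E <= C%:E)%E.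
Proof.
move=> s0 HC; have p0 x : 0 < p x by have /andP[h _] := p24 x; lra.
apply: (@fatou_bound _ (fun n x => (`|cutoff n x| / s) `^ p x)).
- by move=> n; have := measurable_cutoff n => mc; have := mp => mp'; meas.
- by move=> n x; exact: powR_ge0.
- move=> x; apply: cvg_powR_base => //; first by move=> n; rewrite divr_ge0// ltW.
  by apply: cvgM; [apply: cvg_norm; exact: cutoff_cvg|exact: cvg_cst].
- move=> n; have n0 : 0 < (n.+1%:R^-1 : R) by rewrite invr_gt0.
  apply: le_trans (HC _ n0).
  have mT := measurable_trunc_hilbert n.+1%:R^-1 mf.
  have mc := measurable_cutoff n; have mp' := mp.
  apply: le_integralT; [by meas|by meas|by move=> x; exact: powR_ge0|move=> x].
  rewrite ge0_ler_powR ?nnegrE ?(ltW (p0 x)) ?divr_ge0 ?(ltW s0)//.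
  rewrite ler_wpM2r ?invr_ge0 ?(ltW s0)// /cutoff normrM ler_piMl// indicE.
  by case: (_ \in _); rewrite ?normr1 ?normr0.
Qed.

End principal_value_limits.

(** * Boundedness of the singular integral *)

Section singular_integral_on_the_space.
Context {R : realType}.
Local Notation mu := (@lebesgue_measure R).
Local Notation C := R[i]^o.
Local Notation p := (fun x : R => (pexp x)%:E).
Implicit Types f : R -> C.

Lemma ae_and (P Q : R -> Prop) : {ae mu, forall x, P x} -> {ae mu, forall x, Q x} ->
  {ae mu, forall x, P x /\ Q x}.
Proof.
move=> hP hQ; apply: (@negligibleS _ _ _ mu (~` [set x | P x] `|` ~` [set x | Q x])).
  by move=> x /not_andP[]; [left|right].
exact: negligibleU.
Qed.

Lemma modularE f : modular p f = (\int[mu]_x (normc (f x) `^ pexp x)%:E)%E.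
Proof. by []. Qed.

Lemma modular_div f (l : R) : 0 < l ->
  modular p (fun x => f x / l%:C) = (\int[mu]_x ((normc (f x) / l) `^ pexp x)%:E)%E.
Proof. by move=> l0; rewrite modularE; apply: eq_integralR => x _; rewrite normc_div_real. Qed.

Lemma measurable_normc f : cmeasurable_fun setT f -> measurable_fun setT (fun x => normc (f x)).
Proof.
move=> [mRe mIm]; under eq_fun do rewrite normcE_sqrt.
by apply: (measurableT_comp (continuous_measurable_fun (@sqrt_continuous R))); meas.
Qed.

Let p_ge1 x : 1 <= pexp x :> R. Proof. by have /andP[h _] := pexp_bounds x; lra. Qed.
Let p_gt0 x : 0 < pexp x :> R. Proof. exact: lt_le_trans (p_ge1 x). Qed.

Lemma modular_finite f : Lvar p f -> (\int[mu]_x (normc (f x) `^ pexp x)%:E < +oo)%E.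
Proof.
move=> [mf [l l0]]; rewrite (modular_div f l0) => foo.
have mN := measurable_normc mf; have mp := @measurable_pexp R.
apply: (@le_lt_trans _ _ (\int[mu]_x ((1 + l) `^ 4 * (normc (f x) / l) `^ pexp x)%:E)%E).
  apply: le_integralT; [by meas|by meas|by move=> x; exact: powR_ge0|move=> x].
  have e : normc (f x) = l * (normc (f x) / l) by rewrite mulrC divfK// gt_eqF.
  rewrite [in leLHS]e powRM ?(ltW l0) ?divr_ge0 ?normc_ge0 ?(ltW l0)//.
  rewrite ler_wpM2r ?powR_ge0//; have /andP[p2 p4] := pexp_bounds x.
  apply: (@le_trans _ _ ((1 + l) `^ pexp x)).
    by rewrite ge0_ler_powR ?nnegrE ?(ltW (p_gt0 x))//; lra.
  by rewrite ler_powR//; lra.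
rewrite ge0_integralZT; [|by meas|by move=> x; exact: powR_ge0|exact: powR_ge0].
by apply: lte_mul_pinfty; rewrite ?lee_fin ?powR_ge0.
Qed.

(** As p >= 1, dividing f by 1 + m divides its modular m by 1 + m at least. *)
Lemma unit_modular_scale f : Lvar p f -> exists2 l : R, 0 < l & (modular p (fun x => (f x / l%:C)%R) <= 1)%E.
Proof.
move=> [mf [l l0]]; rewrite (modular_div f l0).
have mN := measurable_normc mf; have mp := @measurable_pexp R.
set I := (X in (X < _)%E) => Ioo.
have I0 : (0 <= I)%E by apply: integralT_ge0 => x; exact: powR_ge0.
have IE : I = (fine I)%:E by rewrite fineK// ge0_fin_numE.
have m0 : 0 <= fine I by exact: fine_ge0.
set m := fine I in m0 IE *; have m1 : 0 < 1 + m by lra.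
have lm0 : 0 < l * (1 + m) by rewrite mulr_gt0.
exists (l * (1 + m)) => //; rewrite (modular_div f lm0).
apply: (@le_trans _ _ (\int[mu]_x ((1 + m)^-1 * (normc (f x) / l) `^ pexp x)%:E)%E).
  apply: le_integralT; [by meas|by meas|by move=> x; exact: powR_ge0|move=> x].
  rewrite invfM mulrA powRM ?divr_ge0 ?normc_ge0 ?invr_ge0 ?(ltW l0) ?(ltW m1)//.
  rewrite mulrC ler_wpM2r ?powR_ge0// -[leRHS]powRr1 ?invr_ge0 ?(ltW m1)//.
  by rewrite ger_powR// invr_gt0 m1 invf_le1//; lra.
rewrite ge0_integralZT; [|by meas|by move=> x; exact: powR_ge0|by rewrite invr_ge0 ltW].
by rewrite -/I IE -EFinM lee_fin mulrC ler_pdivrMr//; lra.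
Qed.

(** The sum of two numbers is at most twice their maximum, and
  (c s) ^ p <= c s ^ p for c <= 1 <= p. With M = 4 B + 2 the result is
  2 (B + B) / M <= 1. *)
Lemma modular_of_parts (Z a b : R -> R) (B l : R) : 0 <= B -> 0 < l ->
  measurable_fun setT Z -> measurable_fun setT a -> measurable_fun setT b ->
  (forall x, 0 <= Z x) -> {ae mu, forall x, Z x <= `|a x| + `|b x|} ->
  (\int[mu]_x ((`|a x| / l) `^ pexp x)%:E <= B%:E)%E ->
  (\int[mu]_x ((`|b x| / l) `^ pexp x)%:E <= B%:E)%E ->
  (\int[mu]_x ((Z x / ((4 * B + 2) * l)) `^ pexp x)%:E <= 1)%E.
Proof.
move=> B0 l0 mZ ma mb Z0 Zab aB bB; have mp := @measurable_pexp R.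
set M := 4 * B + 2; have M0 : 0 < M by rewrite /M; lra.
have Ml0 : 0 < M * l by rewrite mulr_gt0.
(* The truncation makes the bound hold everywhere, not only almost everywhere. *)
pose Z' x := Num.min (Z x) (`|a x| + `|b x|).
have mZ' : measurable_fun setT Z' by rewrite /Z'; meas.
have Z'0 x : 0 <= Z' x by rewrite le_min Z0 addr_ge0.
rewrite (@ge0_ae_eq_integral _ _ _ mu setT _ (fun x => ((Z' x / (M * l)) `^ pexp x)%:E)) //; first last.
- by apply: ae_imply Zab => x Zx _; rewrite /Z' min_l.
- by move=> x _; rewrite lee_fin powR_ge0.
- by move=> x _; rewrite lee_fin powR_ge0.
- by meas.
- by meas.
pose A x := `|a x| / l; pose A' x := `|b x| / l.
have mA : measurable_fun setT A by rewrite /A; meas.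
have mA' : measurable_fun setT A' by rewrite /A'; meas.
have A0 x : 0 <= A x by rewrite divr_ge0// ltW.
have A'0 x : 0 <= A' x by rewrite divr_ge0// ltW.
have M2 : 0 < 2 / M <= 1.
  by rewrite divr_gt0//= ler_pdivrMr// mul1r /M; lra.
have c0 : 0 <= 2 / M by case/andP: M2 => /ltW.
apply: (@le_trans _ _ (\int[mu]_x (2 / M * (A x `^ pexp x + A' x `^ pexp x))%:E)%E).
  apply: le_integralT; [by meas|by meas|by move=> x; exact: powR_ge0|move=> x].
  have max0 : 0 <= Num.max (A x) (A' x) by rewrite le_max A0.
  have le1 : Z' x / (M * l) <= 2 / M * Num.max (A x) (A' x).
    apply: (@le_trans _ _ ((A x + A' x) / M)).
      rewrite /A /A' -mulrDl -[leRHS]mulrA -invfM (mulrC l) ler_wpM2r ?invr_ge0 ?(ltW Ml0)//.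
      by rewrite ge_min lexx orbT.
    rewrite [leRHS]mulrAC ler_wpM2r ?invr_ge0 ?(ltW M0)//.
    by rewrite mulr_natl mulr2n lerD// le_max lexx ?orbT.
  apply: (@le_trans _ _ ((2 / M * Num.max (A x) (A' x)) `^ pexp x)).
    have d0 : 0 <= Z' x / (M * l) by rewrite divr_ge0// ltW.
    have m0 : 0 <= 2 / M * Num.max (A x) (A' x) by exact: mulr_ge0.
    by rewrite ge0_ler_powR ?nnegrE ?(ltW (p_gt0 x)).
  rewrite powRM//; apply: ler_pM; rewrite ?powR_ge0//.
    by rewrite -[leRHS](powRr1 c0) ger_powR.
  by case: (leP (A x) (A' x)) => _; rewrite ?lerDl ?lerDr powR_ge0.
rewrite ge0_integralZT; [|by meas|by move=> x; rewrite addr_ge0// powR_ge0|by []].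
rewrite ge0_integralDT; [|by meas|by meas|by move=> x; exact: powR_ge0|by move=> x; exact: powR_ge0].
have c0' : (0 <= (2 / M)%:E)%E by rewrite lee_fin.
apply: (le_trans (lee_wpmul2l c0' (leeD aB bB))).
by rewrite -EFinD -EFinM lee_fin mulrAC ler_pdivrMr// mul1r /M; lra.
Qed.

Section one_function.
Variable f : R -> C.
Hypotheses (mf : cmeasurable_fun setT f).
Hypothesis foo : (\int[mu]_x (normc (f x) `^ pexp x)%:E < +oo)%E.

Let u x := complex.Re (f x).
Let v x := complex.Im (f x).
Let mRe : measurable_fun setT u. Proof. exact: proj1 mf. Qed.
Let mIm : measurable_fun setT v. Proof. exact: proj2 mf. Qed.
Let mp : measurable_fun setT (@pexp R). Proof. exact: measurable_pexp. Qed.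
Let p24 (x : R) : 2 <= pexp x <= 4. Proof. exact: pexp_bounds. Qed.

Let part_le (w : R -> R) (l : R) : 0 < l -> measurable_fun setT w -> (forall x, `|w x| <= normc (f x)) ->
  (\int[mu]_x (`|w x / l| `^ pexp x)%:E <= \int[mu]_x ((normc (f x) / l) `^ pexp x)%:E)%E.
Proof.
move=> l0 mw wf; have mN := measurable_normc mf; have mp' := mp.
apply: le_integralT; [by meas|by meas|by move=> x; exact: powR_ge0|move=> x].
rewrite normrM normfV (gtr0_norm l0).
rewrite ge0_ler_powR ?nnegrE ?(ltW (p_gt0 x)) ?divr_ge0 ?normc_ge0 ?(ltW l0)//.
by rewrite ler_wpM2r// invr_ge0 ltW.
Qed.

Let part_finite (w : R -> R) : measurable_fun setT w -> (forall x, `|w x| <= normc (f x)) ->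
  (\int[mu]_x (`|w x| `^ pexp x)%:E < +oo)%E.
Proof.
move=> mw wf; apply: le_lt_trans foo; have := part_le ltr01 mw wf.
by under eq_integral do rewrite divr1; under [X in (_ <= X)%E]eq_integral do rewrite divr1.
Qed.

Let u_le x : `|u x| <= normc (f x). Proof. exact: Re_le_normc. Qed.
Let v_le x : `|v x| <= normc (f x). Proof. exact: Im_le_normc. Qed.
Let uoo : (\int[mu]_x (`|u x| `^ pexp x)%:E < +oo)%E. Proof. exact: part_finite. Qed.
Let voo : (\int[mu]_x (`|v x| `^ pexp x)%:E < +oo)%E. Proof. exact: part_finite. Qed.

Let measurable_off_ball (x e : R) : measurable (off_ball x e).
Proof.
have mg : measurable_fun setT (fun t : R => `|t - x|) by meas.
rewrite (_ : off_ball x e = (fun t : R => `|t - x|) @^-1` `]e, +oo[).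
  by rewrite -[X in measurable X]setTI; apply: mg => //; exact: measurable_itv.
by apply/seteqP; split => t; rewrite /off_ball/= in_itv/= andbT.
Qed.

Let restrict_off_ball (w : R -> R) (x e : R) :
  (fun t => w t / (t - x)) \_ (off_ball x e) = (fun t => w t * tkernel e (t - x)).
Proof.
apply/funext => t; rewrite patchE /tkernel; case: ifPn.
  by rewrite inE/off_ball/= => ->.
by rewrite notin_setE/off_ball/= => /negP/negbTE ->; rewrite mulr0.
Qed.

(** The kernel is real, so the operator acts separately on real and imaginary
  parts. *)
Lemma truncated_CauchyE (x e : R) : truncated_Cauchy f x e = trunc_hilbert e u x +i* trunc_hilbert e v x.
Proof.
rewrite /truncated_Cauchy /cintegral /Cauchy_integrand; congr (_ +i* _).
- under eq_Rintegral do rewrite Re_div_real.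
  by rewrite Rintegral_mkcond (restrict_off_ball u).
- under eq_Rintegral do rewrite Im_div_real.
  by rewrite Rintegral_mkcond (restrict_off_ball v).
Qed.

Let integrable_off_ball (w : R -> R) (x e : R) : 0 < e -> measurable_fun setT w ->
  (\int[mu]_x (`|w x| `^ pexp x)%:E < +oo)%E ->
  mu.-integrable (off_ball x e) (fun t => (w t / (t - x))%:E).
Proof.
move=> e0 mw woo; have gi := integrable_far mw mp p24 x e0 woo.
have giD : mu.-integrable (off_ball x e) (EFin \o (fun t : R => w t * tkernel e (t - x))).
  by apply: integrableS gi => //; exact: measurable_off_ball.
apply: eq_integrable giD; first exact: measurable_off_ball.
move=> t; rewrite inE /off_ball/= => et.
by rewrite /tkernel et.
Qed.

Lemma Cauchy_integrable (x e : R) : 0 < e -> cintegrable (off_ball x e) (Cauchy_integrand f x).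
Proof.
move=> e0; split.
- by under eq_fun do rewrite Re_div_real; exact: integrable_off_ball.
- by under eq_fun do rewrite Im_div_real; exact: integrable_off_ball.
Qed.

Let D : set R := pv_set u `&` pv_set v.

Let mD : measurable D.
Proof.
by apply: measurableI; [exact: measurable_pv_set mRe mp p24 uoo|exact: measurable_pv_set mIm mp p24 voo].
Qed.

Let D_ae : {ae mu, forall x, D x}.
Proof. by apply: ae_and; [exact: pv_ae mRe mp p24 uoo|exact: pv_ae mIm mp p24 voo]. Qed.

Let D_cvg x : D x -> truncated_Cauchy f x e @[e --> (0 : R)^'+] --> (pv_lim u x +i* pv_lim v x : C).
Proof.
move=> [Du Dv]; under eq_fun do rewrite truncated_CauchyE.
by apply: cvg_complex; rewrite /pv_lim indicE mem_set// mul1r.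
Qed.

(** Convergence of the complex truncations is equivalent to convergence of both
  parts, so S f is described at every point, divergence included. *)
Let cvg_D x : cvg (truncated_Cauchy f x e @[e --> (0 : R)^'+]) -> D x.
Proof.
move=> /cvg_ex[l cl]; split; apply/cvg_ex.
- exists (complex.Re l); apply: cvg_trans (cvg_Re cl); apply: near_eq_cvg; apply: nearW => e.
  by rewrite truncated_CauchyE.
- exists (complex.Im l); apply: cvg_trans (cvg_Im cl); apply: near_eq_cvg; apply: nearW => e.
  by rewrite truncated_CauchyE.
Qed.

Let k : C := ((pi : R)%:C * 'i%C)^-1.

Let S_on x : D x -> Cauchy_S f x = k * (pv_lim u x +i* pv_lim v x).
Proof. by move=> Dx; rewrite /Cauchy_S (cvg_lim (@norm_hausdorff _ _) (D_cvg Dx)). Qed.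

Let S_off x : ~ D x -> Cauchy_S f x = k * point.
Proof. by move=> Dx; rewrite /Cauchy_S dvgP// => /cvg_D. Qed.

Lemma cmeasurable_Cauchy_S : cmeasurable_fun setT (Cauchy_S f).
Proof.
have mI : measurable_fun setT (\1_D : R -> R) by exact: measurable_indic.
have mu' := measurable_pv_lim mRe mp p24 uoo; have mv' := measurable_pv_lim mIm mp p24 voo.
have mulRe (z w : C) : complex.Re (z * w) = complex.Re z * complex.Re w - complex.Im z * complex.Im w.
  by case: z w => [a b] [c d].
have mulIm (z w : C) : complex.Im (z * w) = complex.Re z * complex.Im w + complex.Im z * complex.Re w.
  by case: z w => [a b] [c d].
split.
- rewrite (_ : (fun x => _) = fun x => \1_D x * (complex.Re k * pv_lim u x - complex.Im k * pv_lim v x) +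
     (1 - \1_D x) * complex.Re (k * point)); first by meas.
  apply/funext => x; rewrite indicE; have [xD|xD] := boolP (x \in D).
    by rewrite subrr mul0r addr0 mul1r S_on ?mulRe//; rewrite inE in xD.
  by rewrite subr0 mul0r add0r mul1r S_off//; move: xD; rewrite notin_setE.
- rewrite (_ : (fun x => _) = fun x => \1_D x * (complex.Re k * pv_lim v x + complex.Im k * pv_lim u x) +
     (1 - \1_D x) * complex.Im (k * point)); first by meas.
  apply/funext => x; rewrite indicE; have [xD|xD] := boolP (x \in D).
    by rewrite subrr mul0r addr0 mul1r S_on ?mulIm//; rewrite inE in xD.
  by rewrite subr0 mul0r add0r mul1r S_off//; move: xD; rewrite notin_setE.
Qed.

Lemma Cauchy_S_defined_of_modular : Cauchy_S_defined f.
Proof.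
split; last first.
  apply: ae_imply D_ae => x Dx; split; first by move=> e; exact: Cauchy_integrable.
  by apply/cvg_ex; eexists; exact: D_cvg.
split => // K cK.
have mN := measurable_normc mf; have mp' := mp.
have /compact_bounded[r0 [_ Kr]] := cK.
pose r := `|r0| + 1; have r1 : 0 <= r by rewrite addr_ge0.
have {}Kr t : K t -> `|t| <= r.
  by move=> Kt; apply: (Kr r) => //; rewrite (le_lt_trans (ler_norm _))// ltrDl.
pose G (t : R) : R := (if `|t - 0| <= r then 1 else 0) + normc (f t) `^ pexp t.
have mG : measurable_fun setT G by rewrite /G; meas.
have mK := compact_measurable cK.
have G0 t : 0 <= G t by rewrite addr_ge0 ?powR_ge0//; case: ifP.
apply: (@le_lt_trans _ _ (\int[mu]_(t in K) (G t)%:E)%E).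
  apply: ge0_le_integral => //.
  - by move=> t _; rewrite lee_fin normc_ge0.
  - by apply: measurable_funTS; exact: measurable_EFin.
  - by apply: measurable_funTS; exact: measurable_EFin.
  - move=> t Kt; rewrite lee_fin /G subr0 Kr//.
    have [f1|f1] := leP (normc (f t)) 1; first by rewrite ler_wpDr// powR_ge0.
    apply: ler_wpDl => //; rewrite -[leLHS]powRr1 ?normc_ge0//.
    by rewrite ler_powR// ltW.
apply: (@le_lt_trans _ _ (\int[mu]_t (G t)%:E)%E).
  apply: ge0_subset_integral => //; first exact: measurable_EFin.
  by move=> t _; rewrite lee_fin.
rewrite ge0_integralDT; [|by meas|by meas|by move=> t; case: ifP|by move=> t; exact: powR_ge0].
rewrite integral_ball_cst//; apply: lte_add_pinfty; [exact: ltry|exact: foo].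
Qed.

Let normc_k : normc k <= 1.
Proof.
rewrite /k normcV normcM normcR (gtr0_norm (@pi_gt0 R)) normcE_sqrt/=.
rewrite expr0n expr1n add0r sqrtr1 mulr1 invf_le1 ?pi_gt0//.
by have := @pi_ge2 R; lra.
Qed.

(** The modular inequality, stated for modular at most 1, is applied to the two
  parts of f divided by l. *)
Lemma Cauchy_S_unit_modular (B l : R) :
  (forall (g : R -> R) (e : R), measurable_fun setT g ->
    (\int[mu]_t (`|g t| `^ pexp t)%:E <= 1)%E -> 0 < e ->
    (\int[mu]_x (`|trunc_hilbert e g x| `^ pexp x)%:E <= B%:E)%E) ->
  0 <= B -> 0 < l -> (modular p (fun x => (f x / l%:C)%R) <= 1)%E ->
  (modular p (fun x => (Cauchy_S f x / ((4 * B + 2) * l)%:C)%R) <= 1)%E.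
Proof.
move=> HB B0 l0; rewrite (modular_div f l0) => fl1.
set M := 4 * B + 2; have M0 : 0 < M by rewrite /M; lra.
have Ml0 : 0 < M * l by rewrite mulr_gt0.
rewrite (modular_div (Cauchy_S f) Ml0).
have mS := measurable_normc cmeasurable_Cauchy_S; have mp' := mp.
have mlu := measurable_pv_lim mRe mp p24 uoo; have mlv := measurable_pv_lim mIm mp p24 voo.
have part (w : R -> R) : measurable_fun setT w -> (forall x, `|w x| <= normc (f x)) ->
    (\int[mu]_x (`|w x| `^ pexp x)%:E < +oo)%E ->
    (\int[mu]_x ((`|pv_lim w x| / l) `^ pexp x)%:E <= B%:E)%E.
  move=> mw wf woo; apply: (pv_lim_modular mw mp p24 woo l0) => e e0.
  have mwl : measurable_fun setT (fun t => w t / l) by meas.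
  have := HB _ e mwl (le_trans (part_le l0 mw wf) fl1) e0.
  apply: le_trans; rewrite le_eqVlt; apply/orP; left; apply/eqP.
  apply: eq_integralR => x _; congr (_ `^ _)%:E.
  rewrite -[in LHS](gtr0_norm l0) -normfV -normrM; congr `|_|.
  rewrite mulrC /trunc_hilbert -RintegralZl//; last exact: (integrable_far mw mp p24 x e0 woo).
  by apply: eq_Rintegral => t _; rewrite mulrA [l^-1 * _]mulrC.
apply: (modular_of_parts B0 l0 mS mlu mlv _ _ (part u mRe u_le uoo) (part v mIm v_le voo)).
  by move=> x; exact: normc_ge0.
apply: ae_imply D_ae => x Dx; rewrite (S_on Dx) normcM.
have h2 := normc_le_ReIm (pv_lim u x +i* pv_lim v x); rewrite /= in h2.
apply: le_trans h2; apply: ler_piMl; [exact: normc_ge0|exact: normc_k].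
Qed.

End one_function.

(** Every l admissible in the definition of the norm of f gives M l admissible for
  S f; the infimum over l follows. *)
Lemma Cauchy_S_bounded_pexp : Cauchy_S_bounded p.
Proof.
have [B B0 HB] := @modular_bound R.
set M := 4 * B + 2; have M0 : 0 < M by rewrite /M; lra.
exists M => f Lf; have [mf _] := Lf; have foo := modular_finite Lf.
have Sl (l : R) : 0 < l -> (modular p (fun x => (f x / l%:C)%R) <= 1)%E ->
    (modular p (fun x => (Cauchy_S f x / (M * l)%:C)%R) <= 1)%E.
  by move=> l0; apply: Cauchy_S_unit_modular.
have [l l0 fl] := unit_modular_scale Lf.
split; first exact: Cauchy_S_defined_of_modular.
  split; first exact: cmeasurable_Cauchy_S.
  by exists (M * l); [rewrite mulr_gt0|exact: le_lt_trans (Sl l l0 fl) (ltry _)].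
rewrite /Lvar_norm mulrC -ler_pdivrMr//; apply: lb_le_inf; first by exists l.
move=> r [r0 fr]; rewrite ler_pdivrMr// mulrC.
apply: ge_inf; first by exists 0 => s [/ltW].
by split; [rewrite mulr_gt0|exact: Sl].
Qed.

Lemma class_E_pexp : class_E p.
Proof.
split.
- split.
  + by apply: measurable_EFin; exact: measurable_pexp.
  + by move=> x; rewrite lee_fin.
  + by apply: aeW => x; rewrite ltry.
- move=> x; apply: cvg_EFin; first exact: nearW.
  exact: continuous_pexp.
- apply: (@lt_le_trans _ _ 2%:E); first by rewrite lte_fin ltr1n.
  by apply/ess_infP; apply: aeW => x; rewrite lee_fin; have /andP[] := pexp_bounds x.
- apply: (@le_lt_trans _ _ 4%:E); last exact: ltry.
  by apply/ess_supP; apply: aeW => x; rewrite lee_fin; have /andP[] := pexp_bounds x.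
- exact: Cauchy_S_bounded_pexp.
Qed.

End singular_integral_on_the_space.

Theorem lemma1p1 (R : realType) :
  exists p : R -> R,
    class_E (fun x : R => (p x)%:E) /\
    (SO `\` Cdot) (fun x : R => (p x)%:C).
Proof.
exists pexp; split; first exact: class_E_pexp.
by split; [exact: SO_pexp|exact: not_Cdot_pexp].
Qed.
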